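(* For every $0\le\eta<\frac23$ there exists a prolate uniaxial critical point of $J(\cdot,\eta)$. Furthermore, if $\eta_j\to\frac23$ from below, $Q_j$ are prolate uniaxial critical points of $J(\cdot,\eta_j)$ and $f_j$ is the optimal energy distribution for $(Q_j,\eta_j)$, then there exist rotations $R_j\in\mathrm{SO}(3)$ such that $[R_jf_j]\overset{*}{\rightharpoonup}\frac12(\delta_{e_1}+\delta_{-e_1})$ in $C(\mathbb{S}^2)^*$, where $e_1$ is a fixed unit vector.
   Context: $\mathbb{S}^2\subset\mathbb{R}^3$ is the unit sphere and $dp$ is the 2-dimensional Hausdorff measure on it. $\mathrm{Sym}_0(3)$ is the space of traceless symmetric real $3\times3$ matrices; $\mathcal{Q}=\{Q\in\mathrm{Sym}_0(3):v_{\min}(Q)>-\frac13\}$, $v_{\min}$ denoting the smallest eigenvalue. $\mathcal{P}(\mathbb{S}^2)=\{f\in L^1(\mathbb{S}^2): f\ge 0 \text{ a.e.},\ \int_{\mathbb{S}^2}f\,dp=1\}$. For $Q\in\mathcal{Q}$, $A(Q)=\{f\in\mathcal{P}(\mathbb{S}^2):\int_{\mathbb{S}^2}(p\otimes p-\frac13I)f(p)\,dp=Q\}$, and $$J(Q,\eta)=\inf_{f\in A(Q)}\int_{\mathbb{S}^2}f(p)\ln f(p)-f(p)\ln(Qp\cdot p-\eta)\,dp,$$ where $-\ln$ is extended by $+\infty$ for non-positive arguments, $0\times(+\infty)=0$, $0\ln0=0$. For fixed $\eta$, the set $\mathrm{dom}(J)=\{Q\in\mathcal{Q}:J(Q,\eta)<+\infty\}$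 is open in $\mathrm{Sym}_0(3)$ and $J$ is $C^1$ there; a critical point is $Q\in\mathrm{dom}(J)$ with $\frac{\partial J}{\partial Q}(Q,\eta)=0$ (as a derivative over all of $\mathrm{Sym}_0(3)$). For $Q\in\mathrm{dom}(J)$ the infimum is attained at a unique element of $A(Q)$, the optimal energy distribution. $Q$ is prolate uniaxial if $Q=S(e\otimes e-\frac13I)$ with $e\in\mathbb{S}^2$, $S\in(0,1)$. For $R\in\mathrm{SO}(3)$, $[Rf](p)=f(Rp)$. *)

(* Defs.v *)
From HB Require Import structures.
From mathcomp Require Import all_boot all_order all_algebra.
From mathcomp Require Import all_classical all_reals all_analysis.

Set Implicit Arguments.
Unset Strict Implicit.
Unset Printing Implicit Defensive.
Import Order.TTheory GRing.Theory Num.Theory.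
Import numFieldNormedType.Exports.
Local Open Scope classical_set_scope.
Local Open Scope ring_scope.

(* The topology of 'cV[R]_3 is that of the library (sup norm); distances and
   diameters below are Euclidean. *)
Definition enorm (R : realType) (x : 'cV[R]_3) : R :=
  Num.sqrt (\sum_i x i 0 ^+ 2).

Definition sphere (R : realType) : set 'cV[R]_3 := [set p | enorm p = 1].
Arguments sphere : clear implicits.

Definition outer_square (R : realType) (p : 'cV[R]_3) : 'M[R]_3 := p *m p^T.

Definition quad (R : realType) (Q : 'M[R]_3) (p : 'cV[R]_3) : R :=
  (p^T *m Q *m p) 0 0.

Definition SO3 (R : realType) : set 'M[R]_3 :=
  [set A | A^T *m A = 1%:M /\ \det A = 1].
Arguments SO3 : clear implicits.

(* The element 0 makes the diameter of the empty set equal to 0. *)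
Definition diam (R : realType) (A : set 'cV[R]_3) : \bar R :=
  ereal_sup (0%E |` [set (enorm (x - y))%:E | x in A & y in A]).

(* The weight pi / 4 is the area of a planar disc of diameter 1; with it the
   measure below extends Lebesgue measure on planes. *)
Definition hausdorff_weight (R : realType) (A : set 'cV[R]_3) : \bar R :=
  ((pi / 4)%:E * (diam A * diam A))%E.

Definition delta_cover (R : realType) (delta : R) (A : set 'cV[R]_3) :
    set ((set 'cV[R]_3)^nat) :=
  [set U | (forall k, diam (U k) <= delta%:E)%E /\ A `<=` \bigcup_k U k].

Definition hausdorff_delta (R : realType) (delta : R) (A : set 'cV[R]_3) :
    \bar R :=
  ereal_inf
    [set \sum_(k <oo) hausdorff_weight (U k) | U in delta_cover delta A]%E.

Definition hausdorff2 (R : realType) (A : set 'cV[R]_3) : \bar R :=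
  ereal_sup [set hausdorff_delta delta A | delta in [set d : R | 0 < d]].

Section hausdorff_outer_measure.
Context {R : realType}.
Local Open Scope ereal_scope.
Implicit Types (A B : set 'cV[R]_3) (delta : R).

Lemma diam_ge0 A : 0 <= diam A.
Proof. by apply: ereal_sup_ubound; left. Qed.

Lemma diam0 : diam (set0 : set 'cV[R]_3) = 0.
Proof.
apply/eqP; rewrite eq_le diam_ge0 andbT.
by apply: ge_ereal_sup => x [->//|/= [a []]].
Qed.

Lemma hausdorff_weight_ge0 A : 0 <= hausdorff_weight A.
Proof.
apply: mule_ge0; last by apply: mule_ge0; exact: diam_ge0.
by rewrite lee_fin divr_ge0 ?pi_ge0.
Qed.
Hint Resolve hausdorff_weight_ge0 : core.

Lemma hausdorff_weight0 : hausdorff_weight (set0 : set 'cV[R]_3) = 0.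
Proof. by rewrite /hausdorff_weight diam0 !mule0. Qed.

Lemma hausdorff_delta_ge0 delta A : 0 <= hausdorff_delta delta A.
Proof. by apply: le_ereal_inf_tmp => _ [U _ <-]; exact: nneseries_ge0. Qed.

Lemma hausdorff_delta0 delta : (0 < delta)%R ->
  hausdorff_delta delta set0 = 0.
Proof.
move=> d0; apply/eqP; rewrite eq_le hausdorff_delta_ge0 andbT.
apply: ereal_inf_lbound; exists (fun=> set0).
  by split=> // k; rewrite diam0 lee_fin ltW.
by apply: eseries0 => k _ _; exact: hausdorff_weight0.
Qed.

Lemma le_hausdorff_delta delta A B : A `<=` B ->
  hausdorff_delta delta A <= hausdorff_delta delta B.
Proof.
move=> AB; apply/ereal_inf_le_tmp => _ [U [dU BU] <-].
by exists U => //; split => //; exact: subset_trans BU.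
Qed.

Lemma hausdorff_delta_sigma_subadditive delta :
  sigma_subadditive (@hausdorff_delta R delta).
Proof.
move=> A.
have [[i ioo]|] := pselect (exists i, hausdorff_delta delta (A i) = +oo).
  rewrite (eseries_pinfty _ _ ioo) ?leey// => n _.
  by rewrite -ltNye (lt_le_trans _ (hausdorff_delta_ge0 _ _)).
rewrite -forallNE => Aoo.
apply/lee_addgt0Pr => _/posnumP[e].
rewrite (le_trans _ (epsilon_trick _ _ _))//; last first.
  by move=> n; exact: hausdorff_delta_ge0.
pose P n (B : (set 'cV[R]_3)^nat) := delta_cover delta (A n) B /\
  \sum_(k <oo) hausdorff_weight (B k) <=
    hausdorff_delta delta (A n) + (e%:num / (2 ^ n.+1)%:R)%:E.
have [G PG] : {G : ((set 'cV[R]_3)^nat)^nat & forall n, P n (G n)}.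
  apply: (@choice _ _ P) => n; rewrite /P.
  have Afin : hausdorff_delta delta (A n) \is a fin_num.
    rewrite ge0_fin_numE ?hausdorff_delta_ge0// ltey.
    by apply/eqP; exact: Aoo.
  have en1 : (0 < e%:num / (2 ^ n.+1)%:R)%R by [].
  have [x [B AnB <-] xS] := lb_ereal_inf_adherent en1 Afin.
  by exists B; split => //; exact/ltW.
pose w := @hausdorff_weight R \o uncurry G.
apply: (@le_trans _ _ (\esum_(i in setT) w i)).
  apply: ereal_inf_lbound => /=.
  have /card_esym/ppcard_eqP[f] := card_nat2.
  exists (uncurry G \o f).
    split => [i|t [i _]]; first by rewrite /=; case: (f i) => a b; exact: (PG a).1.1.
    move=> /(PG i).1.2[j _ Gij]; exists (f^-1%FUN (i, j)) => //=.
    by rewrite invK ?inE.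
  rewrite -(esum_pred_image w _ xpredT) ?[fun=> _]set_true//.
    by rewrite image_eq.
  by move=> ? _; exact: hausdorff_weight_ge0.
rewrite (_ : esum _ _ =
    \sum_(i <oo) \sum_(j <oo) hausdorff_weight (G i j)); last first.
  pose J : nat -> set (nat * nat) := fun i => [set (i, j) | j in setT].
  rewrite (_ : setT = \bigcup_k J k); last first.
    by rewrite predeqE => -[a b]; split => // _; exists a => //; exists b.
  rewrite esum_bigcupT /=; last 2 first.
    - apply/trivIsetP => i j _ _ ij.
      rewrite predeqE => -[n m] /=; split => //= -[] [_] _ [<-{n} _].
      by move=> [m' _] [] /esym/eqP; rewrite (negbTE ij).
    - by move=> ?; exact: hausdorff_weight_ge0.
  rewrite -(image_id [set: nat]) -fun_true esum_pred_image//; last first.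
    by move=> n _; apply: esum_ge0 => *; exact: hausdorff_weight_ge0.
  apply: eq_eseriesr => /= j _.
  rewrite -(esum_pred_image w (pair j) predT)//=; last 2 first.
  - by move=> ? _; exact: hausdorff_weight_ge0.
  - by move=> ? ? _ _; exact: (@can_inj _ _ _ snd).
  by congr esum; rewrite predeqE => -[a b]; split; move=> [i _ <-]; exists i.
apply: lee_nneseries => n _; first by move=> _; exact: nneseries_ge0.
exact: (PG n).2.
Qed.

Lemma hausdorff2_0 : hausdorff2 (set0 : set 'cV[R]_3) = 0.
Proof.
rewrite /hausdorff2 (_ : image _ _ = [set 0]) ?ereal_sup1//.
apply/seteqP; split => [_ [d /= d0 <-]|_ ->]; first exact: hausdorff_delta0.
by exists 1%R => //=; exact: hausdorff_delta0.
Qed.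

Lemma hausdorff2_ge0 A : 0 <= hausdorff2 A.
Proof.
apply: (le_trans (hausdorff_delta_ge0 1 A)).
by apply: ereal_sup_ubound; exists 1%R => /=.
Qed.

Lemma le_hausdorff2 :
  {homo (@hausdorff2 R) : A B / A `<=` B >-> A <= B}.
Proof.
move=> A B AB; apply: ge_ereal_sup => _ [d d0 <-].
apply: (le_trans (le_hausdorff_delta d AB)).
by apply: ereal_sup_ubound; exists d.
Qed.

Lemma hausdorff2_sigma_subadditive : sigma_subadditive (@hausdorff2 R).
Proof.
move=> F; apply: ge_ereal_sup => _ [d d0 <-].
apply: (le_trans (hausdorff_delta_sigma_subadditive d F)).
apply: lee_nneseries => n _; first by move=> _; exact: hausdorff_delta_ge0.
by apply: ereal_sup_ubound; exists d.
Qed.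

HB.instance Definition _ := isOuterMeasure.Build R 'cV[R]_3 (@hausdorff2 R)
  hausdorff2_0 hausdorff2_ge0 le_hausdorff2 hausdorff2_sigma_subadditive.

End hausdorff_outer_measure.

(* 'cV[R]_3 with the sigma-algebra of the Caratheodory-measurable sets of the
   2-dimensional Hausdorff outer measure; it contains the Borel sets. *)
Definition space3 (R : realType) := caratheodory_type (@hausdorff2 R).
HB.instance Definition _ (R : realType) :=
  Measurable.copy (space3 R) (caratheodory_type (@hausdorff2 R)).

Definition H2 (R : realType) : {measure set (space3 R) -> \bar R} :=
  let mu : {outer_measure set 'cV[R]_3 -> \bar R} := @hausdorff2 R in
  (OuterMeasure.sort mu : set (caratheodory_type mu) -> \bar R).
Arguments H2 : clear implicits.

Definition sym0 (R : realType) : {pred 'M[R]_3} :=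
  fun Q => (Q^T == Q) && (\tr Q == 0).

Fact sym0_submod_closed (R : realType) : submod_closed (@sym0 R).
Proof.
split; first by rewrite unfold_in trmx0 mxtrace0 !eqxx.
move=> a P Q; rewrite !unfold_in => /andP[/eqP P1 /eqP P2] /andP[/eqP Q1 /eqP Q2].
by rewrite linearP /= linearP /= P1 Q1 P2 Q2 mulr0 addr0 !eqxx.
Qed.
HB.instance Definition _ (R : realType) :=
  GRing.isSubmodClosed.Build R 'M[R]_3 (@sym0 R) (@sym0_submod_closed R).

Record Sym0 (R : realType) :=
  MkSym0 { sym0_val :> 'M[R]_3; _ : sym0_val \in @sym0 R }.

HB.instance Definition _ (R : realType) := [isSub for @sym0_val R].
HB.instance Definition _ (R : realType) := [Choice of Sym0 R by <:].
HB.instance Definition _ (R : realType) :=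
  [SubChoice_isSubLmodule of Sym0 R by <:].

Section sym0_norm.
Context {R : realType}.
Implicit Types P Q : Sym0 R.

Let nrm Q : R := `|sym0_val Q|.

Fact sym0_ler_normD P Q : nrm (P + Q) <= nrm P + nrm Q.
Proof. exact: ler_normD. Qed.

Fact sym0_normrZ (a : R) Q : nrm (a *: Q) = `|a| * nrm Q.
Proof. exact: normrZ. Qed.

Fact sym0_normr0_eq0 Q : nrm Q = 0 -> Q = 0.
Proof. by move=> /normr0_eq0 Q0; apply: val_inj. Qed.

HB.instance Definition _ := Lmodule_isNormed.Build R (Sym0 R)
  sym0_ler_normD sym0_normrZ sym0_normr0_eq0.

End sym0_norm.

Definition vmin (R : realType) (Q : 'M[R]_3) : R :=
  inf [set a | eigenvalue Q a].

Definition Qset (R : realType) : set (Sym0 R) :=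
  [set Q | - 3^-1 < vmin Q].
Arguments Qset : clear implicits.

(* Elements of L^1 are represented by functions on the whole space, of which
   only the restriction to the sphere is relevant. *)
Definition densities (R : realType) : set ('cV[R]_3 -> R) :=
  [set f | [/\ (H2 R).-integrable (sphere R) (EFin \o f),
    {ae H2 R, forall p, sphere R p -> 0 <= f p} &
    (\int[H2 R]_(p in sphere R) (f p)%:E = 1)%E]].
Arguments densities : clear implicits.

Definition admissible (R : realType) (Q : Sym0 R) : set ('cV[R]_3 -> R) :=
  [set f | densities R f /\
    \matrix_(i, j) \int[H2 R]_(p in sphere R)
      ((outer_square p - 3^-1%:M) i j * f p) = Q :> 'M[R]_3].

(* lne is -oo on non-positive arguments, 0 * -oo = 0 and ln 0 = 0. *)
Definition energy (R : realType) (Q : Sym0 R) (eta : R) (f : 'cV[R]_3 -> R) :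
    \bar R :=
  (\int[H2 R]_(p in sphere R)
     ((f p * ln (f p))%:E - (f p)%:E * lne (quad Q p - eta)%:E))%E.

Definition J (R : realType) (Q : Sym0 R) (eta : R) : \bar R :=
  ereal_inf [set energy Q eta f | f in admissible Q].

Definition domJ (R : realType) (eta : R) : set (Sym0 R) :=
  [set Q | Qset R Q /\ (J Q eta < +oo)%E].

(* J is real-valued on domJ, which is open, so that the derivative at a point
   of domJ does not depend on the values of fine outside domJ. *)
Definition critical_point (R : realType) (eta : R) (Q : Sym0 R) : Prop :=
  let g := fun P : Sym0 R => fine (J P eta) in
  [/\ domJ eta Q, differentiable g Q & 'd g Q = 0 :> (Sym0 R -> R)].

Definition optimal_distribution (R : realType) (Q : Sym0 R) (eta : R)
    (f : 'cV[R]_3 -> R) : Prop :=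
  admissible Q f /\ energy Q eta f = J Q eta.

Definition prolate_uniaxial (R : realType) (Q : Sym0 R) : Prop :=
  exists e S, [/\ sphere R e, 0 < S < 1 &
    Q = S *: (outer_square e - 3^-1%:M) :> 'M[R]_3].

Definition rotate (R : realType) (A : 'M[R]_3) (f : 'cV[R]_3 -> R) :
    'cV[R]_3 -> R := fun p => f (A *m p).

(* Elements of the dual of C(S^2) are given by their action on test functions;
   a density g acts by integration and the Dirac mass at e by evaluation. *)
Definition density_functional (R : realType) (g phi : 'cV[R]_3 -> R) : R :=
  \int[H2 R]_(p in sphere R) (phi p * g p).

Definition dirac_functional (R : realType) (e : 'cV[R]_3)
    (phi : 'cV[R]_3 -> R) : R := phi e.

Definition weak_star_cvg (R : realType) (l_ : nat -> ('cV[R]_3 -> R) -> R)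
    (l : ('cV[R]_3 -> R) -> R) : Prop :=
  forall phi : 'cV[R]_3 -> R, {within sphere R, continuous phi} ->
    l_ j phi @[j --> \oo] --> l phi.

(* Main.v *)
Require Import Defs.
From HB Require Import structures.
From mathcomp Require Import all_boot all_order all_algebra.
From mathcomp Require Import all_classical all_reals all_analysis.
From mathcomp Require Import perm measurable_realfun lra.

Set Implicit Arguments.
Unset Strict Implicit.
Unset Printing Implicit Defensive.
Import Order.TTheory GRing.Theory Num.Theory.
Import numFieldNormedType.Exports.
Local Open Scope classical_set_scope.
Local Open Scope ring_scope.


(* Existence. For Q0 = s (e3 (x) e3 - I/3) the candidate optimal distribution is the
   Gibbs density (Q0 p.p - eta)^+ exp(l u) / Z with u = p_3^2 - 1/3. Criticality of
   Q0 amounts to two scalar equations in (s, l). With t = eta / s one of them has,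
   for each t in [0, 2/3), exactly one root l(t), which is continuous in t; the
   mean of u then determines s = s(t) in (3 t / 2, 1), and t s(t) takes the value
   eta by the intermediate value theorem.
   Near Q0, J is squeezed: keeping l fixed, Gibbs' inequality gives J >= L with L
   differentiable and L'(Q0) = 0 (circles are null sets, and the symmetries about
   e3 reduce L' to the scalar equation), while an admissible correction of the
   Gibbs density gives J(P) <= L(P) + C |P - Q0|^2. Hence J'(Q0) = 0.
   Concentration. Finite energy forces f_j = 0 almost everywhere off
   {Q_j p.p > eta_j}, that is, off two caps about the axis of Q_j which shrink to
   its poles because s_j < 1 and eta_j -> 2/3. By strict convexity of the entropy
   f_j is even, so both caps carry mass 1/2. *)

(** * Two-dimensional Hausdorff measure on the sphere *)

(** No surface integral is ever evaluated. Of the measure on the sphere only qualitative facts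
    enter: Borel sets are measurable, isometries preserve it, the sphere has finite measure,
    horizontal circles are null and patches that project onto a rectangle have positive measure. The
    substitution [t = eta / s] turns the set [s u > eta] into [u > t] and lets the factor [s] of the
    weight cancel, so that the equation for [l] no longer contains [s]; this is what makes two
    one-dimensional arguments suffice. The obstacle to differentiating J is that the true multiplier
    of a nearby P is only implicit and the weight has a kink. A fixed multiplier gives a lower bound
    that touches J at Q0. For the upper bound, the Gibbs density of P misses the moments of P by
    O(|P - Q0|) only, and its correction has mass zero, so that the first-order change of the
    relative entropy integrates to zero and a quadratic error remains. *)

Lemma sum_ord3 (V : nmodType) (F : 'I_3 -> V) :
  \sum_i F i = F 0 + F 1 + F 2%:R.
Proof.
rewrite !big_ord_recl big_ord0 addr0 addrA.
by congr (F _ + F _ + F _); apply/val_inj.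
Qed.

Lemma ord3_ind (P : 'I_3 -> Prop) : P 0 -> P 1 -> P 2%:R -> forall i, P i.
Proof.
move=> P0 P1 P2 [[|[|[|//]]] i]; [move: P0|move: P1|move: P2];
  by congr P; apply/val_inj.
Qed.

Lemma norm_entry_le (R : realType) m n (A : 'M[R]_(m, n)) i j : `|A i j| <= `|A|.
Proof.
rewrite [leRHS](mx_normrE A).
exact: (le_bigmax _ (fun ij : 'I_m * 'I_n => `|A ij.1 ij.2|) (i, j)).
Qed.

Lemma norm_entries_le (R : realType) m n (A : 'M[R]_(m, n)) c : 0 <= c ->
  (forall i j, `|A i j| <= c) -> `|A| <= c.
Proof. by move=> c0 Ac; rewrite [leLHS](mx_normrE A); apply: bigmax_le. Qed.

Section euclidean.
Context {R : realType}.
Implicit Types x y p q : 'cV[R]_3.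

Lemma enormE p : enorm p = Num.sqrt (p 0 0 ^+ 2 + p 1 0 ^+ 2 + p 2%:R 0 ^+ 2).
Proof. by rewrite /enorm sum_ord3. Qed.

Lemma enorm_ge0 p : 0 <= enorm p.
Proof. exact: sqrtr_ge0. Qed.

Lemma enorm_sqr p : enorm p ^+ 2 = p 0 0 ^+ 2 + p 1 0 ^+ 2 + p 2%:R 0 ^+ 2.
Proof. by rewrite enormE sqr_sqrtr// !addr_ge0// sqr_ge0. Qed.

Lemma enorm_mxE p : enorm p ^+ 2 = (p^T *m p) 0 0.
Proof. by rewrite enorm_sqr mxE sum_ord3 !mxE !expr2. Qed.

Lemma enorm_le p c : 0 <= c -> p 0 0 ^+ 2 + p 1 0 ^+ 2 + p 2%:R 0 ^+ 2 <= c ^+ 2 ->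
  enorm p <= c.
Proof. by move=> c0; rewrite -enorm_sqr ler_pXn2r// nnegrE// enorm_ge0. Qed.

Lemma enormN p : enorm (- p) = enorm p.
Proof. by rewrite !enormE !mxE !sqrrN. Qed.

Lemma enormB x y : enorm (x - y) = enorm (y - x).
Proof. by rewrite -opprB enormN. Qed.

Lemma enormD x y : enorm (x + y) <= enorm x + enorm y.
Proof.
have hx := enorm_sqr x; have hy := enorm_sqr y.
have := enorm_ge0 x; have := enorm_ge0 y; move: hx hy.
move: (enorm x) (enorm y) => a b ha hb b0 a0.
apply: enorm_le; first exact: addr_ge0.
rewrite !mxE.
suff : x 0 0 * y 0 0 + x 1 0 * y 1 0 + x 2%:R 0 * y 2%:R 0 <= a * b by nra.
rewrite (le_trans (ler_norm _))// -ler_sqr ?nnegrE ?mulr_ge0//.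
rewrite real_normK ?num_real// exprMn ha hb.
have := sqr_ge0 (x 0 0 * y 1 0 - x 1 0 * y 0 0).
have := sqr_ge0 (x 0 0 * y 2%:R 0 - x 2%:R 0 * y 0 0).
have := sqr_ge0 (x 1 0 * y 2%:R 0 - x 2%:R 0 * y 1 0).
nra.
Qed.

Lemma enorm_triangle p x y : enorm (x - y) <= enorm (x - p) + enorm (p - y).
Proof. by rewrite -[x - y](subrKA p) enormD. Qed.

Lemma norm_coord_le p i : `|p i 0| <= enorm p.
Proof.
rewrite -sqrtr_sqr enormE ler_wsqrtr//.
elim/ord3_ind: i; have := sqr_ge0 (p 0 0); have := sqr_ge0 (p 1 0);
  have := sqr_ge0 (p 2%:R 0); lra.
Qed.

Lemma norm_le_enorm p : `|p| <= enorm p.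
Proof.
apply: norm_entries_le (enorm_ge0 p) _ => i j.
by rewrite (ord1 j); exact: norm_coord_le.
Qed.

End euclidean.

(** * Caratheodory's criterion for the Hausdorff outer measure *)

Section metric_outer_measure.
Context {R : realType}.
Local Notation mu := (@hausdorff2 R).
Implicit Types A B X : set 'cV[R]_3.
Local Open Scope ereal_scope.

Lemma le_diam A p q : A p -> A q -> (enorm (p - q))%:E <= diam A.
Proof. by move=> Ap Aq; apply: ereal_sup_ubound; right; exists p => //; exists q. Qed.

Lemma diam_le A (d : R) : (0 <= d)%R ->
  (forall p q, A p -> A q -> enorm (p - q) <= d)%R -> diam A <= d%:E.
Proof.
move=> d0 Ad; apply: ge_ereal_sup => _ [->|[p Ap [q Aq <-]]]; rewrite lee_fin//.
exact: Ad.
Qed.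

Lemma hausdorff_delta_anti (d1 d2 : R) A : (d1 <= d2)%R ->
  hausdorff_delta d2 A <= hausdorff_delta d1 A.
Proof.
move=> d12; apply/ereal_inf_le_tmp => _ [U [dU AU] <-].
by exists U => //; split=> // k; rewrite (le_trans (dU k))// lee_fin.
Qed.

(** A set of diameter at most [d] cannot meet both [A] and [B], so a cover of the union splits into
    a cover of each without counting any member twice. *)
Lemma hausdorff_delta_separated (d : R) A B :
  (forall p q, A p -> B q -> d < enorm (p - q))%R ->
  hausdorff_delta d A + hausdorff_delta d B <= hausdorff_delta d (A `|` B).
Proof.
move=> AB; apply: le_ereal_inf_tmp => _ [U [dU ABU] <-].
(* The members that miss [C] are replaced by the empty set, of weight zero, so that the indexing is
   kept. *)
pose r C k := if `[< U k `&` C !=set0 >] then U k else set0.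
have cov C : C `<=` A `|` B -> delta_cover d C (r C).
  move=> CAB; split.
    move=> k; rewrite /r; case: ifP => // _; rewrite diam0.
    exact: le_trans (diam_ge0 _) (dU k).
  move=> p Cp; have [k _ Ukp] := ABU p (CAB p Cp); exists k => //.
  by rewrite /r; case: asboolP => //; case; exists p.
have le C : C `<=` A `|` B ->
    hausdorff_delta d C <= \sum_(k <oo) hausdorff_weight (r C k).
  by move=> /cov CAB; apply: ereal_inf_lbound; exists (r C).
apply: (le_trans (leeD (le A _) (le B _))); [exact: subsetUl|exact: subsetUr|].
rewrite -nneseriesD; do ?by move=> *; exact: hausdorff_weight_ge0.
apply: lee_nneseries => k _.
  by move=> _; rewrite adde_ge0// hausdorff_weight_ge0.
rewrite /r; case: asboolP => [[p [Up Ap]]|_]; case: asboolP => [[q [Uq Bq]]|_];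
  rewrite ?hausdorff_weight0 ?add0e ?adde0 ?hausdorff_weight_ge0//.
have := AB _ _ Ap Bq; rewrite ltNge => /negP[].
by rewrite -lee_fin (le_trans (le_diam Up Uq)).
Qed.

Lemma hausdorff2_separated (d : R) A B : (0 < d)%R ->
  (forall p q, A p -> B q -> d <= enorm (p - q))%R ->
  mu A + mu B <= mu (A `|` B).
Proof.
move=> d0 AB.
have [->|fin] := eqVneq (mu (A `|` B)) +oo; first exact: leey.
have fn C : C `<=` A `|` B -> mu C \is a fin_num.
  move=> CAB; rewrite ge0_fin_numE ?hausdorff2_ge0//.
  by rewrite (le_lt_trans (le_hausdorff2 CAB))// ltey.
have fA : mu A \is a fin_num by apply: fn; exact: subsetUl.
have fB : mu B \is a fin_num by apply: fn; exact: subsetUr.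
have key d1 d2 : (0 < d1)%R -> (0 < d2)%R ->
    hausdorff_delta d1 A + hausdorff_delta d2 B <= mu (A `|` B).
  move=> d10 d20.
  (* One scale below both [d1] and [d2] serves the two suprema at once; [d / 2] turns the weak
     separation into the strict one. *)
  pose m := (Num.min (Num.min d1 d2) (d / 2))%R.
  have m0 : (0 < m)%R by rewrite !lt_min d10 d20 divr_gt0.
  apply: (@le_trans _ _ (hausdorff_delta m (A `|` B))); last first.
    by apply: ereal_sup_ubound; exists m.
  apply: le_trans (hausdorff_delta_separated _) => [|p q Ap Bq].
    by apply: leeD; apply: hausdorff_delta_anti; rewrite !ge_min lexx ?orbT.
  apply: lt_le_trans (AB _ _ Ap Bq); rewrite gt_min; apply/orP; right; lra.
have fdB d2 : (0 < d2)%R -> hausdorff_delta d2 B \is a fin_num.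
  move=> d20; rewrite ge0_fin_numE ?hausdorff_delta_ge0//.
  have /le_lt_trans : hausdorff_delta d2 B <= mu B.
    by apply: ereal_sup_ubound; exists d2.
  by apply; rewrite -ge0_fin_numE ?hausdorff2_ge0.
rewrite -leeBrDr//; apply: ge_ereal_sup => _ [d1 /= d10 <-].
rewrite leeBrDr// addeC.
have fdA : hausdorff_delta d1 A \is a fin_num.
  rewrite ge0_fin_numE ?hausdorff_delta_ge0//.
  have /le_lt_trans : hausdorff_delta d1 A <= mu A.
    by apply: ereal_sup_ubound; exists d1.
  by apply; rewrite -ge0_fin_numE ?hausdorff2_ge0.
rewrite -leeBrDr//; apply: ge_ereal_sup => _ [d2 /= d20 <-].
by rewrite leeBrDr// addeC; exact: key.
Qed.

End metric_outer_measure.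

(** The form [k.*2 + 0] lets one statement about [k.*2 + i] treat both parities. *)
Lemma sum_even_odd (R : realType) (f : nat -> \bar R) N :
  (\sum_(0 <= k < N.*2) f k =
   \sum_(0 <= k < N) f (k.*2 + 0)%N + \sum_(0 <= k < N) f (k.*2 + 1)%N)%E.
Proof.
elim: N => [|N IH]; first by rewrite !big_geq// adde0.
rewrite doubleS !big_nat_recr//= IH addn0 addn1 -!addeA; congr (_ + _)%E.
by rewrite addeCA addeA [X in (X + _)%E]addeC -!addeA.
Qed.

Section lipschitz_sublevel.
Context {R : realType}.
Local Notation mu := (@hausdorff2 R).
Variable g : 'cV[R]_3 -> R.
Hypothesis lipg : forall p q, g p - g q <= enorm (p - q).
Local Open Scope ereal_scope.

(** With these offsets the bands [k.*2 + i], [k < N], fit exactly into [above X (N.*2 + i)], and the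
    next one of that parity is at positive distance from it. *)
Let band X (k : nat) :=
  X `&` [set p | (k.+3%:R^-1 < g p)%R /\ (g p <= k.+2%:R^-1)%R].

Let above X (k : nat) := X `&` [set p | (k.+1%:R^-1 < g p)%R].

Let inv_lt (m n : nat) : (m < n)%N -> (n.+1%:R^-1 < m.+1%:R^-1 :> R)%R.
Proof. by move=> mn; rewrite ltf_pV2 ?posrE// ltr_nat. Qed.

(* Bands two steps apart are at positive distance from each other. *)
Let sum_bands X i N :
  \sum_(0 <= k < N) mu (band X (k.*2 + i)) <= mu (above X (N.*2 + i)).
Proof.
elim: N => [|N IH]; first by rewrite big_geq// hausdorff2_ge0.
rewrite big_nat_recr//=; apply: (le_trans (leeD IH (lexx _))).
set m := (N.*2 + i)%N.
have gm : (0 < m.+1%:R^-1 - m.+2%:R^-1 :> R)%R by rewrite subr_gt0 inv_lt.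
apply: le_trans (hausdorff2_separated gm _) _.
  move=> p q [_ /= gp] [_ [_ gq]].
  by apply: le_trans (lipg p q); apply: lerB gq; exact: ltW.
apply: le_hausdorff2 => p [[Xp /= gp]|[Xp /= [gp _]]]; split=> //=.
apply: lt_trans gp; apply: inv_lt.
by rewrite doubleS !addSn -/m; exact: ltnW.
Qed.

(** The part of [X] where [g] exceeds a positive level is at positive distance from the sublevel
    set, so the measure adds up there. What is left out is covered by a tail of bands. The bands of
    each parity have total measure at most [mu X], hence the series converges and its tails
    vanish. *)
Lemma caratheodory_sublevel : caratheodory_measurable mu [set p | (g p <= 0)%R].
Proof.
pose A := [set p | (g p <= 0)%R].
apply: (@le_caratheodory_measurable R _ mu) => X.
change (mu (X `&` A) + mu (X `&` ~` A) <= mu X).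
have [->|Xoo] := eqVneq (mu X) +oo; first exact: leey.
have Xfin : mu X < +oo by rewrite ltey.
have fin C : C `<=` X -> mu C \is a fin_num.
  move=> CX; rewrite ge0_fin_numE ?hausdorff2_ge0//.
  exact: le_lt_trans (le_hausdorff2 CX) Xfin.
have bnd0 k : 0 <= mu (band X k) by exact: hausdorff2_ge0.
have bound N : \sum_(0 <= k < N) mu (band X k) <= mu X + mu X.
  have : \sum_(0 <= k < N.*2) mu (band X k) <= mu X + mu X.
    rewrite (sum_even_odd (fun k => mu (band X k))).
    by apply: leeD; apply: (le_trans (sum_bands _ _ _));
      apply: le_hausdorff2 => p [].
  apply: le_trans; apply: lee_sum_nneg_natr => //.
  by rewrite -addnn leq_addr.
have sfin : \sum_(0 <= k <oo) mu (band X k) < +oo.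
  apply: (@le_lt_trans _ _ (mu X + mu X)); last by rewrite lte_add_pinfty.
  apply: lime_le; first exact: is_cvg_nneseries.
  by apply: nearW => N; exact: bound.
have tail : \sum_(N <= k <oo) mu (band X k) @[N --> \oo] --> 0.
  exact: nneseries_tail_cvg.
have key N : mu (X `&` A) + mu (X `&` ~` A) <=
    mu X + \sum_(N <= k <oo) mu (band X k).
  have gN : (0 < N.+2%:R^-1 :> R)%R by rewrite invr_gt0.
  apply: (@le_trans _ _ (mu (X `&` A) +
      (mu (above X N.+1) + \sum_(N <= k <oo) mu (band X k)))); last first.
    rewrite addeA leeD2r//.
    apply: le_trans (hausdorff2_separated gN _) _; last first.
      by apply: le_hausdorff2 => p [[]|[]].
    move=> p q [_ /= gp] [_ /= gq]; rewrite enormB.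
    by apply: le_trans (lipg _ _); rewrite -[leLHS]subr0; apply: lerB gp; exact: ltW.
  rewrite leeD2l//.
  apply: le_trans (leeD2l _ (outer_measure_sigma_subadditive_tail mu N _)).
  apply: le_trans (outer_measureU2 _ _ _).
  apply: le_hausdorff2 => p [Xp] /= /negP; rewrite -ltNge => gp.
  have [gpN|gpN] := ltP (N.+2%:R^-1)%R (g p); [by left|right].
  (* Minimality of [m] gives the upper bound of the band; for [m = 0] that bound comes from [gpN]
     instead. *)
  have [m m1 m2] : exists2 m, (m.+3%:R^-1 < g p)%R &
      forall k, (k.+3%:R^-1 < g p)%R -> (m <= k)%N.
    have ex : exists m : nat, (m.+3%:R^-1 < g p)%R.
      exists (Num.truncn (g p)^-1).
      rewrite invf_plt ?posrE//.
      apply: lt_le_trans (truncnS_gt _) _.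
      by rewrite ler_nat ltnS -addn2 leq_addr.
    by case: (ex_minnP ex) => m h1 h2; exists m.
  exists m => /=.
    apply/negP; rewrite -leqNgt leqNgt; apply/negP => mN.
    move: gpN; rewrite leNgt => /negP; apply; apply: le_lt_trans m1.
    by rewrite lef_pV2 ?posrE// ler_nat.
  split=> //=; split=> //.
  case: m m1 m2 => [|m] m1 m2.
    apply: (le_trans gpN).
    by rewrite lef_pV2 ?posrE// ler_nat.
  by rewrite leNgt; apply/negP => /m2; rewrite ltnn.
rewrite -[leRHS]adde0.
have lim : mu X + \sum_(N <= k <oo) mu (band X k) @[N --> \oo] --> mu X + 0.
  by apply: cvgeD; [rewrite fin_num_adde_defl|exact: cvg_cst|].
rewrite -(cvg_lim (@ereal_hausdorff R) lim); apply: lime_ge.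
  by apply/cvg_ex; eexists; exact: lim.
exact: nearW.
Qed.

End lipschitz_sublevel.

Section borel_measurability.
Context {R : realType}.
Implicit Types (C D : set 'cV[R]_3).

(** A nonempty closed set is the sublevel set at 0 of its Euclidean distance function, which is
    1-Lipschitz. *)
Lemma closed_measurable_space3 C : closed C -> measurable (C : set (space3 R)).
Proof.
move=> cC; have [->|/set0P[q0 Cq0]] := eqVneq C set0; first exact: measurable0.
pose g p := inf [set enorm (p - q) | q in C].
have has p : has_inf [set enorm (p - q) | q in C].
  split; first by exists (enorm (p - q0)), q0.
  by exists 0 => _ [q _ <-]; exact: enorm_ge0.
have gle p q : C q -> g p <= enorm (p - q).
  by move=> Cq; apply: ge_inf; [exact: (has p).2|exists q].
rewrite (_ : C = [set p | g p <= 0]).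
  apply: caratheodory_sublevel => p q.
  rewrite lerBlDr addrC -lerBlDr; apply: lb_le_inf; first exact: (has q).1.
  move=> _ [r Cr <-]; rewrite lerBlDr.
  by rewrite (le_trans (gle p r Cr))// [leRHS]addrC enorm_triangle.
apply/seteqP; split => p /=.
  by move=> /(gle p); rewrite subrr (_ : enorm 0 = 0)// enormE !mxE expr0n !addr0 sqrtr0.
move=> gp; apply: cC => U /nbhs_ballP[e /= e0 eU].
have /inf_adherent : has_inf [set enorm (p - q) | q in C] by [].
move=> /(_ _ e0)[_ [q Cq <-] qe]; exists q; split=> //; apply: eU.
rewrite -ball_normE /ball_ /=.
by rewrite (le_lt_trans (norm_le_enorm _))// (lt_le_trans qe)// -/(g p); lra.
Qed.

Lemma open_measurable_space3 C : open C -> measurable (C : set (space3 R)).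
Proof.
by move=> oC; rewrite -(setCK C); apply: measurableC;
  apply: closed_measurable_space3; exact: open_closedC.
Qed.

Lemma within_continuous_measurable_fun D (f : 'cV[R]_3 -> R) :
  measurable (D : set (space3 R)) -> {within D, continuous f} ->
  measurable_fun (D : set (space3 R)) (f : space3 R -> R).
Proof.
move=> mD /continuousP fc.
apply: (measurability _ (RGenOpens.measurableE R)) => _ [_ [a [b ->]] <-].
have ob : open (`]a, b[%classic : set R) by exact: interval_open.
have /open_subspaceP[V oV VD] := fc _ ob.
rewrite setIC -VD; apply: measurableI => //; exact: open_measurable_space3.
Qed.

Lemma continuous_measurable_fun3 D (f : 'cV[R]_3 -> R) :
  measurable (D : set (space3 R)) -> continuous f ->
  measurable_fun (D : set (space3 R)) (f : space3 R -> R).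
Proof.
move=> mD fc; apply: within_continuous_measurable_fun => //.
exact: continuous_subspaceT.
Qed.

Lemma continuous_entry i : continuous (fun p : 'cV[R]_3 => p i 0).
Proof. exact: coord_continuous. Qed.

Lemma sphereE : sphere R =
  [set p | p 0 0 ^+ 2 + p 1 0 ^+ 2 + p 2%:R 0 ^+ 2 = 1].
Proof.
apply/seteqP; split => p /=; first by rewrite -enorm_sqr => ->; rewrite expr1n.
by rewrite /sphere /= enormE => ->; rewrite sqrtr1.
Qed.

Lemma closed_sphere : closed (sphere R).
Proof.
pose f (p : 'cV[R]_3) := p 0 0 ^+ 2 + p 1 0 ^+ 2 + p 2%:R 0 ^+ 2.
rewrite sphereE -[X in closed X]/(f @^-1` [set 1]).
have fc : continuous f.
  move=> p; pose h i := fun p : 'cV[R]_3 => p i 0 ^+ 2.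
  have hc i : {for p, continuous (h i)}.
    apply: (@continuous_comp _ _ _ (fun p : 'cV[R]_3 => p i 0) (fun x => x ^+ 2)).
      exact: coord_continuous.
    exact: exprn_continuous.
  apply: (@continuousD R R^o 'cV[R]_3 _ _ _ _ (hc 2%:R)).
  exact: (@continuousD R R^o 'cV[R]_3 _ _ _ (hc 0) (hc 1)).
by apply: preimage_closed => [p _|]; [exact: fc|exact: closed_eq].
Qed.

Lemma measurable_sphere : measurable (sphere R : set (space3 R)).
Proof. exact: closed_measurable_space3 closed_sphere. Qed.

Lemma continuous_trmx m n : continuous (@trmx R m n).
Proof.
move=> A P [U AU UP]; exists (fun i j => U j i) => [i j|B UB].
  by have := AU j i; rewrite mxE.
by apply: UP => i j; rewrite mxE; exact: UB.
Qed.

Lemma compact_sphere : compact (sphere R).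
Proof.
have cS : compact [set v : 'rV[R]_3 | sphere R v^T].
  apply: bounded_closed_compact.
    exists 1; split; first exact: num_real.
    move=> r r1 v /= Sv; apply: norm_entries_le => [|i j].
      by rewrite (le_trans _ (ltW r1)).
    have := norm_coord_le v^T j; rewrite mxE (ord1 i) => /le_trans; apply.
    by move: Sv; rewrite /sphere /= => ->; exact: ltW.
  apply: (@preimage_closed _ _ (@trmx R 1 3)) closed_sphere => v _.
  exact: continuous_trmx.
rewrite (_ : sphere R = trmx @` [set v : 'rV[R]_3 | sphere R v^T]).
  apply: continuous_compact cS.
  by apply: continuous_subspaceT; exact: continuous_trmx.
apply/seteqP; split => [p Sp|_ [v Sv <-]//].
by exists p^T; rewrite /= trmxK.
Qed.

End borel_measurability.

(** * Invariance of the measure and of integrals under isometries *)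

Section isometry_invariance.
Context {R : realType}.
Local Notation mu := (@hausdorff2 R).
Variables f g : 'cV[R]_3 -> 'cV[R]_3.
Hypothesis isof : forall p q, enorm (f p - f q) = enorm (p - q).
Hypothesis fK : cancel f g.
Hypothesis gK : cancel g f.

Let isog p q : enorm (g p - g q) = enorm (p - q).
Proof. by rewrite -isof !gK. Qed.

Let hausdorff2_preimage_le (h : 'cV[R]_3 -> 'cV[R]_3) X :
  (forall p q, enorm (h p - h q) = enorm (p - q)) ->
  (mu (h @^-1` X) <= mu X)%E.
Proof.
move=> isoh.
have diamh U : (diam (h @^-1` U) <= diam U)%E.
  apply: ge_ereal_sup => _ [->|[p /= Up [q Uq <-]]]; first exact: diam_ge0.
  by rewrite -isoh; exact: le_diam.
apply: ge_ereal_sup => _ [d d0 <-].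
apply: (@le_trans _ _ (hausdorff_delta d X)); last first.
  by apply: ereal_sup_ubound; exists d.
apply: le_ereal_inf_tmp => _ [U [dU XU] <-].
apply: (@le_trans _ _ (\sum_(k <oo) hausdorff_weight (h @^-1` U k))%E).
  apply: ereal_inf_lbound; exists (fun k => h @^-1` U k) => //; split=> [k|p Xp].
    exact: le_trans (diamh _) (dU k).
  by have [k _ Uk] := XU _ Xp; exists k.
apply: lee_nneseries => k _; first by move=> _; exact: hausdorff_weight_ge0.
apply: lee_pmul => //; rewrite ?lee_fin ?divr_ge0 ?pi_ge0//.
  by apply: mule_ge0; exact: diam_ge0.
by apply: lee_pmul; rewrite ?diam_ge0.
Qed.

Lemma hausdorff2_isometry X : mu (f @^-1` X) = mu X.
Proof.
apply/eqP; rewrite eq_le hausdorff2_preimage_le//=.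
rewrite [in leLHS](_ : X = g @^-1` (f @^-1` X)) ?hausdorff2_preimage_le//.
by apply/seteqP; split => p /=; rewrite gK.
Qed.

Let caratheodory_isometry X :
  caratheodory_measurable mu X -> caratheodory_measurable mu (f @^-1` X).
Proof.
move=> mX E.
have EE : E = f @^-1` (g @^-1` E).
  by apply/seteqP; split => p /=; rewrite fK.
rewrite [in RHS]EE preimage_setC -!preimage_setI !hausdorff2_isometry.
have -> : mu E = mu (g @^-1` E) by rewrite [in LHS]EE hausdorff2_isometry.
exact: mX.
Qed.

Lemma measurable_fun_isometry :
  measurable_fun setT (f : space3 R -> space3 R).
Proof. by move=> _ X mX; rewrite setTI; exact: caratheodory_isometry mX. Qed.

(** The pushforward of the measure is the measure itself; the change of variables is applied to the
    positive and negative parts separately. *)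
Lemma integral_isometry (D : set 'cV[R]_3) (F : 'cV[R]_3 -> \bar R) :
  measurable (D : set (space3 R)) ->
  measurable_fun (D : set (space3 R)) (F : space3 R -> \bar R) ->
  (\int[H2 R]_(p in f @^-1` D) F (f p) = \int[H2 R]_(p in D) F p)%E.
Proof.
move=> mD mF.
have E : pushforward (H2 R) (f : space3 R -> space3 R) = H2 R :> (set _ -> _).
  by apply/funext => X; exact: hausdorff2_isometry.
have H (G : space3 R -> \bar R) : measurable_fun (D : set (space3 R)) G ->
    (forall p, 0 <= G p)%E ->
    (\int[H2 R]_(p in f @^-1` D) G (f p) = \int[H2 R]_(p in D) G p)%E.
  move=> mG G0.
  have := @ge0_integral_pushforward _ _ _ _ _ _ measurable_fun_isometry (H2 R)
    (D : set (space3 R)) G mD mG (fun p _ => G0 p).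
  by rewrite E => ->.
rewrite integralE [RHS]integralE; congr (_ - _)%E; rewrite -H//.
- by rewrite -[fun p => F (f p)]/(F \o f) funepos_comp.
- exact: measurable_funepos.
- by rewrite -[fun p => F (f p)]/(F \o f) funeneg_comp.
- exact: measurable_funeneg.
Qed.

End isometry_invariance.

(** * Finiteness of the sphere, null circles and patches of positive measure *)

Section finite_covers.
Context {R : realType}.
Local Notation mu := (@hausdorff2 R).
Implicit Types (A : set 'cV[R]_3).

Lemma hausdorff2_le_cover A (C : R) :
  (forall delta, 0 < delta -> exists (I : finType) (U : I -> set 'cV[R]_3) d,
     [/\ 0 <= d <= delta, forall i, (diam (U i) <= d%:E)%E,
         A `<=` \bigcup_i U i & #|I|%:R * d ^+ 2 <= C]) ->
  (mu A <= (pi / 4 * C)%:E)%E.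
Proof.
move=> cov; apply: ge_ereal_sup => _ [delta /= d0 <-].
have [I [U [d [/andP[d0' dd] dU AU IC]]]] := cov _ d0.
(* The finite family becomes a sequence, padded with empty sets of weight zero. *)
pose V k := if insub k is Some i then U (enum_val (i : 'I_#|I|)) else set0.
have wV k : (hausdorff_weight (V k) <= (pi / 4 * d ^+ 2)%:E)%E.
  rewrite /V; case: insubP => [i _ _|_].
    rewrite EFinM lee_pmul ?lee_fin ?divr_ge0 ?pi_ge0//.
      by rewrite mule_ge0 ?diam_ge0.
    by rewrite expr2 EFinM lee_pmul ?diam_ge0.
  by rewrite hausdorff_weight0 lee_fin mulr_ge0 ?divr_ge0 ?pi_ge0 ?sqr_ge0.
apply: (@le_trans _ _ (\sum_(k <oo) hausdorff_weight (V k))%E).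
  apply: ereal_inf_lbound; exists V => //; split=> [k|p Ap].
    rewrite /V; case: insubP => [i _ _|_].
      by rewrite (le_trans (dU _))// lee_fin.
    by rewrite diam0 lee_fin ltW.
  have [i _ Uip] := AU p Ap; exists (enum_rank i : nat) => //.
  by rewrite /V valK enum_rankK.
rewrite (nneseries_split 0 #|I|); last by move=> *; exact: hausdorff_weight_ge0.
rewrite add0n eseries0 ?adde0; last first.
  move=> k Ik _; rewrite /V insubF ?hausdorff_weight0//.
  by apply/negbTE; rewrite -leqNgt.
apply: (@le_trans _ _ (\sum_(0 <= k < #|I|) (pi / 4 * d ^+ 2)%:E)%E).
  by apply: lee_sum => k _; exact: wV.
rewrite sumEFin lee_fin big_mkord sumr_const card_ord -[leLHS]mulr_natl.
by rewrite [leLHS]mulrCA ler_wpM2l// divr_ge0// pi_ge0.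
Qed.

(** The truncation that defines the index equals [2 * n.+1] at [t = 1]; the bound [3 * n.+1] makes
    room for it. *)
Lemma grid_cell (n : nat) (t : R) : -1 <= t <= 1 ->
  exists k : 'I_(3 * n.+1), k%:R / n.+1%:R - 1 <= t <= k.+1%:R / n.+1%:R - 1.
Proof.
move=> /andP[t1 t2]; have n0 : (0 : R) < n.+1%:R by [].
have x0 : 0 <= (t + 1) * n.+1%:R by rewrite mulr_ge0//; lra.
have /andP[k1 k2] := truncn_itv x0.
have kn : (Num.truncn ((t + 1) * n.+1%:R) < 3 * n.+1)%N.
  rewrite -(ltr_nat R) (le_lt_trans k1)// natrM ltr_pM2r//; lra.
exists (Ordinal kn) => /=.
by rewrite lerBlDr lerBrDr ler_pdivrMr// ler_pdivlMr// k1 ltW.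
Qed.

(* On a part of the sphere where one coordinate dominates the others and has
   constant sign, the dominating coordinate is Lipschitz in the others. *)
Lemma dist_le_of_sqr_eq (x x' s s' : R) :
  0 <= x * x' -> x ^+ 2 - x' ^+ 2 = s' -> `|s'| <= s * (`|x| + `|x'|) -> 0 <= s ->
  `|x - x'| <= s.
Proof.
move=> xx h1 h2 s0.
have E : `|x + x'| = `|x| + `|x'|.
  apply/eqP; rewrite -(@eqrXn2 _ 2)// ?addr_ge0// real_normK ?num_real//.
  rewrite !sqrrD !real_normK ?num_real// -normrM ger0_norm//.
have : `|x - x'| * (`|x| + `|x'|) <= s * (`|x| + `|x'|).
  by rewrite -E -normrM (_ : (x - x') * (x + x') = s') ?E// -h1; lra.
have : 0 <= `|x| + `|x'| by rewrite addr_ge0.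
rewrite le_eqVlt => /orP[/eqP xx0|xx0]; last by rewrite ler_pM2r.
have := normr_ge0 x; have := normr_ge0 x' => h3 h4 _.
have /normr0_eq0 -> : `|x| = 0 by lra.
have /normr0_eq0 -> : `|x'| = 0 by lra.
by rewrite subrr normr0.
Qed.

End finite_covers.

Section signed_permutations.
Context {R : realType}.
Implicit Types (p q : 'cV[R]_3) (k l : 'I_3).

Definition flip k p : 'cV[R]_3 := \col_i (if i == k then - p i 0 else p i 0).

Definition swap k l p : 'cV[R]_3 := \col_i p (tperm k l i) 0.

Lemma flipK k : involutive (flip k).
Proof.
by move=> p; apply/colP => i; rewrite !mxE; case: (i == k); rewrite ?opprK.
Qed.

Lemma swapK k l : involutive (swap k l).
Proof. by move=> p; apply/colP => i; rewrite !mxE tpermK. Qed.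

Lemma flip_isometry k p q : enorm (flip k p - flip k q) = enorm (p - q).
Proof.
congr Num.sqrt; apply: eq_bigr => i _; rewrite !mxE; case: (i == k) => //.
by rewrite -opprD sqrrN.
Qed.

Lemma swap_isometry k l p q : enorm (swap k l p - swap k l q) = enorm (p - q).
Proof.
congr Num.sqrt; rewrite [RHS](reindex_inj (@perm_inj _ (tperm k l))) /=.
by apply: eq_bigr => i _; rewrite !mxE.
Qed.

Lemma enorm_isometry0 (f : 'cV[R]_3 -> 'cV[R]_3) p : f 0 = 0 ->
  (forall p q, enorm (f p - f q) = enorm (p - q)) -> enorm (f p) = enorm p.
Proof. by move=> f0 /(_ p 0); rewrite f0 !subr0. Qed.

Lemma flip0 k : flip k 0 = 0.
Proof. by apply/colP => i; rewrite !mxE; case: (i == k); rewrite ?oppr0. Qed.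

Lemma swap0 k l : swap k l 0 = 0.
Proof. by apply/colP => i; rewrite !mxE. Qed.

Lemma sphere_flip k : flip k @^-1` sphere R = sphere R.
Proof.
apply/seteqP; split => p; rewrite /sphere /= enorm_isometry0 ?flip0//;
  exact: flip_isometry.
Qed.

Lemma sphere_swap k l : swap k l @^-1` sphere R = sphere R.
Proof.
apply/seteqP; split => p; rewrite /sphere /= enorm_isometry0 ?swap0//;
  exact: swap_isometry.
Qed.

Lemma hausdorff2_swap k l X : hausdorff2 (swap k l @^-1` X) = hausdorff2 X.
Proof. exact: (hausdorff2_isometry (@swap_isometry k l) (@swapK k l)). Qed.

End signed_permutations.

Section sphere_size.
Context {R : realType}.
Local Notation mu := (@hausdorff2 R).

Lemma sphere_sqr (p : 'cV[R]_3) : sphere R p ->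
  p 0 0 ^+ 2 + p 1 0 ^+ 2 + p 2%:R 0 ^+ 2 = 1.
Proof. by move=> Sp; rewrite -enorm_sqr Sp expr1n. Qed.

Lemma sphere_coord (p : 'cV[R]_3) i : sphere R p -> -1 <= p i 0 <= 1.
Proof. by move=> Sp; rewrite -ler_norml -Sp norm_coord_le. Qed.

Let cap : set 'cV[R]_3 := [set p | sphere R p /\
  (`|p 0 0| <= `|p 2%:R 0| /\ `|p 1 0| <= `|p 2%:R 0|)].

Let half (c : R) : set 'cV[R]_3 := [set p | sphere R p /\
  (p 2%:R 0 = c /\ `|p 1 0| <= `|p 0 0|)].

Let cell n k (t : R) := k%:R / n.+1%:R - 1 <= t <= k.+1%:R / n.+1%:R - 1.

Let cell_dist n k t t' : cell n k t -> cell n k t' -> `|t - t'| <= n.+1%:R^-1.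
Proof.
have k1 : k.+1%:R = k%:R + 1 :> R by rewrite natr1.
rewrite /cell k1 mulrDl mul1r; move: (k%:R / n.+1%:R : R) (n.+1%:R^-1 : R) => a b.
move=> /andP[h1 h2] /andP[h3 h4].
by rewrite ler_norml; apply/andP; split; lra.
Qed.

Let small_inv (e : R) : 0 < e -> exists n : nat, n.+1%:R^-1 <= e.
Proof.
move=> e0; exists (Num.truncn e^-1); rewrite invf_ple ?posrE//.
exact: ltW (truncnS_gt _).
Qed.

Let sqr_le_of_norm (x h : R) : `|x| <= h -> x ^+ 2 <= h ^+ 2.
Proof.
move=> xh; rewrite -real_normK ?num_real// ler_pXn2r ?nnegrE//.
exact: le_trans xh.
Qed.

(** With [h] the mesh, there are [2 * (3 / h) ^ 2] pieces. On each, two coordinates vary by at most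
    [h] and the dominating one by at most [2 h], so the diameter is at most [3 h]; and
    [2 * 9 * 9 = 162]. *)
Let hausdorff2_cap : (mu cap <= (pi / 4 * 162)%:E)%E.
Proof.
apply: hausdorff2_le_cover => delta d0.
have d30 : 0 < delta / 3 by rewrite divr_gt0.
have [n nd] := small_inv d30; set h : R := n.+1%:R^-1 in nd.
have h0 : 0 <= h by rewrite invr_ge0.
pose U (i : (bool * 'I_(3 * n.+1)) * 'I_(3 * n.+1)) : set 'cV[R]_3 :=
  cap `&` [set p | (if i.1.1 then 0 <= p 2%:R 0 else p 2%:R 0 <= 0) /\
                   (cell n i.1.2 (p 0 0) /\ cell n i.2 (p 1 0))].
exists _, U, (3 * h); split.
- by rewrite mulr_ge0//=; lra.
- move=> [[b k] l]; apply: diam_le; first by rewrite mulr_ge0.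
  move=> p q [[Sp [p0 p1]] [/= pb [pk pl]]] [[Sq [q0 q1]] [/= qb [qk ql]]].
  have dx := cell_dist pk qk; have dy := cell_dist pl ql.
  have dz : `|p 2%:R 0 - q 2%:R 0| <= 2 * h.
    apply: (@dist_le_of_sqr_eq _ _ _ _
      ((q 0 0 ^+ 2 - p 0 0 ^+ 2) + (q 1 0 ^+ 2 - p 1 0 ^+ 2))).
    + by case: (b) pb qb => ? ?; [rewrite mulr_ge0|rewrite mulr_le0].
    + by have := sphere_sqr Sp; have := sphere_sqr Sq; lra.
    + rewrite mulr_natl mulrnAl mulr2n; apply: (le_trans (ler_normD _ _)).
      have H s s' t t' : `|s - s'| <= h -> `|s| <= t -> `|s'| <= t' ->
          `|s' ^+ 2 - s ^+ 2| <= h * (t + t').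
        move=> ss st s't'; rewrite subr_sqr normrM ler_pM//.
          by rewrite distrC.
        by rewrite addrC (le_trans (ler_normD _ _))// lerD.
      by apply: lerD; apply: H.
    + by rewrite mulr_ge0.
  apply: enorm_le; first by rewrite mulr_ge0.
  rewrite !mxE.
  have := sqr_le_of_norm dx; have := sqr_le_of_norm dy; have := sqr_le_of_norm dz.
  by rewrite -/h; have := sqr_ge0 h; nra.
- move=> p [Sp pz].
  have [k pk] := grid_cell n (sphere_coord 0 Sp).
  have [l pl] := grid_cell n (sphere_coord 1 Sp).
  exists (0 <= p 2%:R 0, k, l) => //; split => //=; split => //.
  by case: ifPn => //; rewrite -ltNge => /ltW.
- rewrite !card_prod card_bool !card_ord !natrM.
  have : n.+1%:R * h = 1 by rewrite mulfV.
  by move: (n.+1%:R : R) => N Nh; nra.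
Qed.

(** Exchanging a coordinate of largest absolute value with the last one moves any point into [cap],
    so three copies of [cap] cover the sphere; [swap 2%:R 2%:R] is the identity and keeps the three
    cases uniform. *)
Lemma hausdorff2_sphere : (mu (sphere R) < +oo)%E.
Proof.
have le k : (mu (swap k 2%:R @^-1` cap) < +oo)%E.
  by rewrite hausdorff2_swap (le_lt_trans hausdorff2_cap)// ltry.
pose cover := swap 2%:R 2%:R @^-1` cap `|`
  (swap 0 2%:R @^-1` cap `|` swap 1 2%:R @^-1` cap).
apply: (@le_lt_trans _ _ (mu cover)).
  apply: le_hausdorff2 => p Sp.
  have S k : sphere R (swap k 2%:R p) by rewrite -(sphere_swap k 2%:R) in Sp.
  have t02 : tperm (0 : 'I_3) 2%:R 1 = 1 by rewrite tpermD.
  have t12 : tperm (1 : 'I_3) 2%:R 0 = 0 by rewrite tpermD.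
  rewrite /cover /setU /preimage /cap /= !mxE !tpermL !tpermR t02 t12 !tperm1 !perm1.
  have [h1|h1] := leP `|p 0 0| `|p 2%:R 0|.
    have [h2|h2] := leP `|p 1 0| `|p 2%:R 0|; first by left; split.
    by right; right; split => //; split; [exact: le_trans h1 (ltW h2)|exact: ltW].
  have [h3|h3] := leP `|p 0 0| `|p 1 0|.
    by right; right; split => //; split => //; exact: ltW (lt_le_trans h1 h3).
  by right; left; split => //; split; exact: ltW.
have U2 A B : (mu A < +oo -> mu B < +oo -> mu (A `|` B) < +oo)%E.
  move=> Aoo Boo; apply: le_lt_trans (outer_measureU2 _ _ _) _.
  exact: lte_add_pinfty.
by apply: U2 (le _) (U2 _ _ (le _) (le _)).
Qed.

Let hausdorff2_half c : mu (half c) = 0.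
Proof.
apply/eqP; rewrite eq_le hausdorff2_ge0 andbT; apply/lee_addgt0Pr => e e0.
rewrite add0e.
have pi0 : 0 < pi / 4 :> R by rewrite divr_gt0// pi_gt0.
have -> : e = pi / 4 * (e / (pi / 4)).
  by rewrite mulrCA mulfV ?mulr1// gt_eqF.
set C := e / _; have C0 : 0 < C by rewrite divr_gt0.
apply: hausdorff2_le_cover => delta d0.
(* The [6 / h] pieces of diameter at most [2 h] contribute [6 / h * (2 h) ^ 2 = 24 h]. *)
have d30 : 0 < Num.min (delta / 2) (C / 24).
  by rewrite lt_min; apply/andP; split; rewrite divr_gt0.
have [n] := small_inv d30; set h : R := n.+1%:R^-1.
rewrite le_min => /andP[nd nC].
have h0 : 0 <= h by rewrite invr_ge0.
pose U (i : bool * 'I_(3 * n.+1)) : set 'cV[R]_3 :=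
  half c `&` [set p | (if i.1 then 0 <= p 0 0 else p 0 0 <= 0) /\
                      cell n i.2 (p 1 0)].
exists _, U, (2 * h); split.
- by rewrite mulr_ge0//=; lra.
- move=> [b k]; apply: diam_le; first by rewrite mulr_ge0.
  move=> p q [[Sp [pz p1]] [/= pb pk]] [[Sq [qz q1]] [/= qb qk]].
  have dy := cell_dist pk qk.
  have dx : `|p 0 0 - q 0 0| <= h.
    apply: (@dist_le_of_sqr_eq _ _ _ _ (q 1 0 ^+ 2 - p 1 0 ^+ 2)) => //.
    + by case: (b) pb qb => ? ?; [rewrite mulr_ge0|rewrite mulr_le0].
    + by have := sphere_sqr Sp; have := sphere_sqr Sq; rewrite pz qz; lra.
    + rewrite subr_sqr normrM ler_pM//; first by rewrite distrC.
      by rewrite addrC (le_trans (ler_normD _ _))// lerD.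
  apply: enorm_le; first by rewrite mulr_ge0.
  rewrite !mxE pz qz subrr expr0n /= addr0.
  have := sqr_le_of_norm dx; have := sqr_le_of_norm dy.
  by rewrite -/h; have := sqr_ge0 h; nra.
- move=> p [Sp pz].
  have [k pk] := grid_cell n (sphere_coord 1 Sp).
  exists (0 <= p 0 0, k) => //; split => //=; split => //.
  by case: ifPn => //; rewrite -ltNge => /ltW.
- rewrite card_prod card_bool card_ord !natrM.
  have : n.+1%:R * h = 1 by rewrite mulfV.
  by move: (n.+1%:R : R) => N Nh; nra.
Qed.

Lemma hausdorff2_circle (c : R) : mu (sphere R `&` [set p | p 2%:R 0 = c]) = 0.
Proof.
apply/eqP; rewrite eq_le hausdorff2_ge0 andbT.
have h2 : mu (swap 0 1 @^-1` half c) = 0.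
  by rewrite hausdorff2_swap; exact: hausdorff2_half.
apply: (@le_trans _ _ (mu (half c `|` swap 0 1 @^-1` half c))); last first.
  have U2 A B : (mu (A `|` B) <= mu A + mu B)%E := outer_measureU2 _ A B.
  by rewrite (le_trans (U2 _ _))// hausdorff2_half h2 adde0.
apply: le_hausdorff2 => p [Sp pc].
have [h|h] := leP `|p 1 0| `|p 0 0|; [by left|right].
have S : sphere R (swap 0 1 p) by rewrite -(sphere_swap 0 1) in Sp.
have t01 : tperm (0 : 'I_3) 1 2%:R = 2%:R by rewrite tpermD.
by rewrite /preimage /half /= !mxE tpermL tpermR t01; split => //; split => //; exact: ltW.
Qed.

End sphere_size.

Section patches.
Context {R : realType}.
Local Notation mu := (@hausdorff2 R).
Local Notation leb := (@lebesgue_measure R).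

Let leb_itv_le (x y : R) : x <= y -> (leb `[x, y] <= (y - x)%:E)%E.
Proof.
move=> xy; rewrite lebesgue_measure_itv /=; case: ifPn => _ //.
by rewrite lee_fin subr_ge0.
Qed.

(* The projection of [X] to the first two coordinates is 1-Lipschitz and covers
   a rectangle. *)
Lemma hausdorff2_patch_gt0 (X : set 'cV[R]_3) (a b c d : R) : a < b -> c < d ->
  (forall x y, a <= x <= b -> c <= y <= d ->
     exists2 p, X p & p 0 0 = x /\ p 1 0 = y) ->
  (0 < mu X)%E.
Proof.
move=> ab cd proj.
(* A set of diameter [r] projects into a square of side [2 r] about the projection of one of its
   points; its weight [pi / 4 * r ^ 2] is [pi / 16] times the area of that square. *)
have pos : 0 < pi / 16 * ((b - a) * (d - c)) :> R.
  by rewrite !mulr_gt0 ?subr_gt0 ?pi_gt0// invr_gt0.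
rewrite -lte_fin in pos; apply: (lt_le_trans pos).
apply: (@le_trans _ _ (hausdorff_delta 1 X)); last first.
  by apply: ereal_sup_ubound; exists 1 => /=.
apply: le_ereal_inf_tmp => _ [U [dU XU] <-].
have dUfin k : diam (U k) \is a fin_num.
  by rewrite ge0_fin_numE ?diam_ge0// (le_lt_trans (dU k))// ltry.
pose r k := fine (diam (U k)).
have r0 k : 0 <= r k by rewrite fine_ge0 ?diam_ge0.
pose P k p := U k !=set0 -> U k p.
have [p_ Up] : {p_ : nat -> 'cV[R]_3 & forall k, P k (p_ k)}.
  apply: (@choice _ _ P) => k.
  have [[q Uq]|nU] := pselect (U k !=set0); first by exists q.
  by exists 0.
pose I k i := `[p_ k i 0 - r k, p_ k i 0 + r k]%classic.
pose m2 := (leb \x leb)%E.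
have mI k i : measurable (I k i) by exact: measurable_itv.
have mR : measurable (`[a, b]%classic `*` `[c, d]%classic).
  by apply: measurableX; exact: measurable_itv.
have sub : `[a, b]%classic `*` `[c, d]%classic `<=` \bigcup_k (I k 0 `*` I k 1).
  move=> [x y] /= [xab ycd].
  have [p Xp [px py]] := proj x y xab ycd.
  have [k _ Ukp] := XU p Xp; exists k => //.
  have Ukq : U k (p_ k) by apply: Up; exists p.
  have pq i : `|p i 0 - p_ k i 0| <= r k.
    have := norm_coord_le (p - p_ k) i; rewrite !mxE => /le_trans; apply.
    by rewrite -lee_fin fineK//; exact: le_diam.
  have := pq 0; have := pq 1; rewrite px py !ler_norml => /andP[? ?] /andP[? ?].
  by rewrite /I /= !in_itv/=; split; apply/andP; split; lra.
have le : (m2 (`[a, b]%classic `*` `[c, d]%classic) <=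
    \sum_(k <oo) m2 (I k 0%R `*` I k 1%R))%E.
  apply: (@measure_sigma_subadditive _ _ _ m2) => // k.
  by apply: measurableX; exact: mI.
have m2E A B : measurable A -> measurable B -> m2 (A `*` B) = (leb A * leb B)%E.
  by move=> mA mB; exact: product_measure1E.
rewrite m2E// !lebesgue_measure_itv/= !lte_fin ab cd in le.
rewrite EFinM.
have := lee_wpmul2l (_ : 0 <= (pi / 16)%:E :> \bar R)%E le.
rewrite lee_fin divr_ge0 ?pi_ge0// => /(_ isT)/le_trans; apply.
rewrite -nneseriesZl; last by move=> *; exact: measure_ge0.
apply: lee_nneseries => k _.
  by move=> _; rewrite mule_ge0// ?lee_fin ?divr_ge0 ?pi_ge0.
rewrite (m2E _ _ (mI k 0) (mI k 1)) /hausdorff_weight -(fineK (dUfin k)) -/(r k).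
apply: (@le_trans _ _ ((pi / 16)%:E * ((2 * r k)%:E * (2 * r k)%:E))%E).
  rewrite lee_pmul2l//; last by rewrite lte_fin divr_gt0 ?pi_gt0.
  by apply: lee_pmul => //; rewrite /I; apply: le_trans (leb_itv_le _) _;
    rewrite ?lee_fin; have := r0 k; lra.
by rewrite -!EFinM lee_fin; lra.
Qed.

End patches.

(** * Integration of bounded functions over the sphere *)

Section bounded_measurable.
Context {R : realType}.
Local Notation S := (sphere R : set (space3 R)).
Implicit Types F G : 'cV[R]_3 -> R.

(** On a sphere of finite measure this class is an algebra of integrable functions, so that
    integrability conditions reduce to closure properties. *)
Definition bmeas F : Prop := measurable_fun S (F : space3 R -> R) /\
  exists C, forall p, sphere R p -> `|F p| <= C.

Definition sint F : R := \int[H2 R]_(p in sphere R) F p.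

Lemma H2_sphere_lty : (H2 R (sphere R) < +oo)%E.
Proof. exact: hausdorff2_sphere. Qed.

Definition sarea : R := fine (H2 R (sphere R)).

Lemma sarea_ge0 : 0 <= sarea.
Proof. by rewrite fine_ge0// measure_ge0. Qed.

Lemma bmeas_integrable F : bmeas F -> (H2 R).-integrable S (EFin \o F).
Proof.
move=> [mF [C FC]]; apply: measurable_bounded_integrable => //.
- exact: measurable_sphere.
- exact: H2_sphere_lty.
- exists C; split; first exact: num_real.
  by move=> x Cx p Sp /=; rewrite (le_trans (FC p Sp))// ltW.
Qed.

Lemma bmeas_cst c : bmeas (fun=> c).
Proof. by split; [exact: measurable_cst|exists `|c|]. Qed.

Lemma bmeasD F G : bmeas F -> bmeas G -> bmeas (fun p => F p + G p).
Proof.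
move=> [mF [C FC]] [mG [D GD]]; split; first exact: measurable_funD.
exists (C + D) => p Sp; rewrite (le_trans (ler_normD _ _))// lerD ?FC ?GD//.
Qed.

Lemma bmeasN F : bmeas F -> bmeas (fun p => - F p).
Proof.
move=> [mF [C FC]]; split; first exact: measurableT_comp.
by exists C => p Sp; rewrite normrN FC.
Qed.

Lemma bmeasB F G : bmeas F -> bmeas G -> bmeas (fun p => F p - G p).
Proof. by move=> bF bG; exact: (bmeasD bF (bmeasN bG)). Qed.

Lemma bmeasM F G : bmeas F -> bmeas G -> bmeas (fun p => F p * G p).
Proof.
move=> [mF [C FC]] [mG [D GD]]; split; first exact: measurable_funM.
by exists (C * D) => p Sp; rewrite normrM ler_pM ?FC ?GD.
Qed.

Lemma bmeasZ c F : bmeas F -> bmeas (fun p => c * F p).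
Proof. by move=> bF; exact: (bmeasM (bmeas_cst c) bF). Qed.

Lemma bmeasX n F : bmeas F -> bmeas (fun p => F p ^+ n).
Proof.
move=> [mF [C FC]]; split; first exact: measurable_funX.
exists (C ^+ n) => p Sp; have C0 := le_trans (normr_ge0 _) (FC p Sp).
by rewrite normrX lerXn2r ?nnegrE ?FC.
Qed.

Lemma bmeas_expR F : bmeas F -> bmeas (fun p => expR (F p)).
Proof.
move=> [mF [C FC]]; split.
  exact: measurableT_comp mF.
exists (expR C) => p Sp; rewrite ger0_norm ?expR_ge0// ler_expR.
by rewrite (le_trans (ler_norm _))// FC.
Qed.

Lemma bmeas_max F G : bmeas F -> bmeas G -> bmeas (fun p => Num.max (F p) (G p)).
Proof.
move=> [mF [C FC]] [mG [D GD]]; split; first exact: measurable_maxr.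
exists (C + D) => p Sp; have := FC p Sp; have := GD p Sp.
by case: (leP (F p) (G p)) => _ h1 h2; have := normr_ge0 (F p); have := normr_ge0 (G p); lra.
Qed.

Lemma bmeas_bool (P : 'cV[R]_3 -> bool) :
  measurable_fun S (P : space3 R -> bool) -> bmeas (fun p => (P p)%:R).
Proof.
move=> mP; split.
  rewrite (_ : (fun p => _) = fun p => if P p then 1 else 0 : R); last first.
    by apply/funext => p; case: (P p).
  by apply: measurable_fun_if => //; exact: measurable_sphere.
by exists 1 => p Sp; case: (P p); rewrite ?normr1 ?normr0.
Qed.

Lemma bmeas_lt F G : bmeas F -> bmeas G -> bmeas (fun p => (F p < G p)%R%:R).
Proof. by move=> [mF _] [mG _]; apply: bmeas_bool; exact: measurable_fun_ltr. Qed.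

Lemma bmeas_le F G : bmeas F -> bmeas G -> bmeas (fun p => (F p <= G p)%R%:R).
Proof. by move=> [mF _] [mG _]; apply: bmeas_bool; exact: measurable_fun_ler. Qed.

Lemma bmeas_norm F : bmeas F -> bmeas (fun p => `|F p|).
Proof.
move=> [mF [C FC]]; split; first exact: measurableT_comp.
by exists C => p Sp; rewrite normr_id FC.
Qed.

Lemma bmeas_entry i : bmeas (fun p => p i 0).
Proof.
split; last by exists 1 => p Sp; rewrite -(_ : enorm p = 1)// norm_coord_le.
apply: continuous_measurable_fun3; first exact: measurable_sphere.
exact: continuous_entry.
Qed.

Lemma eq_bmeas F G : (forall p, F p = G p) -> bmeas F -> bmeas G.
Proof. by move=> /funext ->. Qed.

Lemma eq_sint F G : (forall p, sphere R p -> F p = G p) -> sint F = sint G.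
Proof. by move=> FG; apply: eq_Rintegral => p; rewrite inE => /FG. Qed.

Lemma sintD F G : bmeas F -> bmeas G ->
  sint (fun p => F p + G p) = sint F + sint G.
Proof.
by move=> bF bG; apply: RintegralD;
  [exact: measurable_sphere|exact: bmeas_integrable bF|exact: bmeas_integrable bG].
Qed.

Lemma sintB F G : bmeas F -> bmeas G ->
  sint (fun p => F p - G p) = sint F - sint G.
Proof.
by move=> bF bG; apply: RintegralB;
  [exact: measurable_sphere|exact: bmeas_integrable bF|exact: bmeas_integrable bG].
Qed.

Lemma sintZ c F : bmeas F -> sint (fun p => c * F p) = c * sint F.
Proof.
by move=> bF; apply: RintegralZl; [exact: measurable_sphere|exact: bmeas_integrable].
Qed.

Lemma sintN F : bmeas F -> sint (fun p => - F p) = - sint F.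
Proof.
by move=> bF; rewrite -mulN1r -(sintZ _ bF); apply: eq_sint => p _; rewrite mulN1r.
Qed.

Lemma sint_cst c : sint (fun=> c) = c * sarea.
Proof. by rewrite /sint Rintegral_cst//; exact: measurable_sphere. Qed.

Lemma sint0 : sint (fun=> 0) = 0.
Proof. by rewrite sint_cst mul0r. Qed.

Lemma sint_le F G : bmeas F -> bmeas G ->
  (forall p, sphere R p -> F p <= G p) -> sint F <= sint G.
Proof.
by move=> bF bG FG; apply: le_Rintegral;
  [exact: measurable_sphere|exact: bmeas_integrable bF|exact: bmeas_integrable bG|].
Qed.

Lemma sint_ge0 F : (forall p, sphere R p -> 0 <= F p) -> 0 <= sint F.
Proof. by move=> F0; apply: Rintegral_ge0 => p; exact: F0. Qed.

Lemma sint_norm_le F c : bmeas F -> (forall p, sphere R p -> `|F p| <= c) ->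
  `|sint F| <= c * sarea.
Proof.
move=> bF Fc; rewrite -sint_cst.
apply: (le_trans (le_normr_Rintegral _ (bmeas_integrable bF))).
  exact: measurable_sphere.
exact: (sint_le (bmeas_norm bF) (bmeas_cst c) Fc).
Qed.

Lemma integral_sint F : bmeas F ->
  (\int[H2 R]_(p in sphere R) (F p)%:E)%E = (sint F)%:E.
Proof.
move=> bF; rewrite /sint /Rintegral fineK//.
by apply: integrable_fin_num (bmeas_integrable bF); exact: measurable_sphere.
Qed.

(** A nonnegative function of integral zero vanishes almost everywhere, so the set where it is
    positive would be null. *)
Lemma sint_gt0 F : bmeas F -> (forall p, sphere R p -> 0 <= F p) ->
  (0 < hausdorff2 (sphere R `&` [set p | (0 < F p)%R]))%E -> 0 < sint F.
Proof.
move=> bF F0 pos; rewrite lt_neqAle sint_ge0// andbT; apply/eqP => I0.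
have mF : measurable_fun S ((EFin \o F) : space3 R -> \bar R).
  by apply/measurable_EFinP; exact: bF.1.
have /(ae_eq_integral_abs _ measurable_sphere mF)[N [mN N0 subN]] :
    (\int[H2 R]_(p in sphere R) `|(EFin \o F) p| = 0)%E.
  rewrite -[RHS]/(0%:E) I0; rewrite -(integral_sint bF); apply: eq_integral => p.
  by rewrite inE => Sp /=; rewrite ger0_norm// F0.
move: pos; rewrite ltNge => /negP; apply.
rewrite -N0; apply: le_hausdorff2 => p [Sp /= Fp]; apply: subN => /= h.
by have [] := h Sp => h'; rewrite h' ltxx in Fp.
Qed.

Lemma sint_isometry (f : 'cV[R]_3 -> 'cV[R]_3) F :
  (forall p q, enorm (f p - f q) = enorm (p - q)) -> involutive f ->
  f @^-1` sphere R = sphere R -> bmeas F -> sint (fun p => F (f p)) = sint F.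
Proof.
move=> isof fK fS bF; rewrite /sint /Rintegral; congr fine.
have mF : measurable_fun S ((EFin \o F) : space3 R -> \bar R).
  by apply/measurable_EFinP; exact: bF.1.
by have := integral_isometry isof fK fK measurable_sphere mF; rewrite fS.
Qed.

Lemma sint_flip k F : bmeas F -> sint (fun p => F (flip k p)) = sint F.
Proof.
apply: sint_isometry; [exact: flip_isometry|exact: flipK|exact: sphere_flip].
Qed.

Lemma sint_swap k l F : bmeas F -> sint (fun p => F (swap k l p)) = sint F.
Proof.
apply: sint_isometry; [exact: swap_isometry|exact: swapK|exact: sphere_swap].
Qed.

Lemma sint_odd k F : bmeas F ->
  (forall p, sphere R p -> F (flip k p) = - F p) -> sint F = 0.
Proof.
move=> bF oF; have := sint_flip k bF.
by rewrite (eq_sint oF) (sintN bF); lra.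
Qed.

Lemma sint_cvg (F_ : nat -> 'cV[R]_3 -> R) F (N : set 'cV[R]_3) C :
  (forall n, bmeas (F_ n)) -> bmeas F -> hausdorff2 N = 0 ->
  (forall n p, sphere R p -> `|F_ n p| <= C) ->
  (forall p, sphere R p -> ~ N p -> F_ n p @[n --> \oo] --> F p) ->
  sint (F_ n) @[n --> \oo] --> sint F.
Proof.
move=> bF_ bF N0 FC Fcvg.
have mE G : bmeas G -> measurable_fun S ((EFin \o G) : space3 R -> \bar R).
  by move=> bG; apply/measurable_EFinP; exact: bG.1.
have /= [] := @dominated_convergence _ _ _ (H2 R) S measurable_sphere
  (fun n => EFin \o F_ n) (EFin \o F) (EFin \o cst C)
  (fun n => mE _ (bF_ n)) (mE _ bF).
(* [N] is an arbitrary set; being null for the outer measure makes it Caratheodory measurable. *)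
- have mN : measurable (N : set (space3 R)).
    apply: (@le_caratheodory_measurable R _ (@hausdorff2 R)) => X.
    have N0' : (hausdorff2 (X `&` N) = 0)%E.
      apply/eqP; rewrite eq_le hausdorff2_ge0 andbT -N0.
      by apply: le_hausdorff2 => ? [].
    change (hausdorff2 (X `&` N) + hausdorff2 (X `&` ~` N) <= hausdorff2 X)%E.
    by rewrite N0' add0e; apply: le_hausdorff2 => ? [].
  exists N; split => // p /= h; apply: contrapT => Np; apply: h => Sp.
  by apply: cvg_EFin; [exact: nearW|exact: Fcvg].
- by apply: bmeas_integrable; exact: bmeas_cst.
- exists set0; split; [exact: measurable0|exact: hausdorff2_0|].
  by move=> p /= h; exfalso; apply: h => n Sp; rewrite lee_fin FC.
move=> _ _ h; apply: fine_cvg.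
have <- : (\int[H2 R]_(p in sphere R) (F p)%:E = (sint F)%:E)%E by exact: integral_sint.
exact: h.
Qed.

End bounded_measurable.

(** * The critical-point equations of a prolate matrix *)

Section polar_height.
Context {R : realType}.
Implicit Types (p : 'cV[R]_3) (t l : R).

(* The quadratic form of [e3 (x) e3 - I / 3], up to [|p| = 1]. *)
Definition uz p : R := p 2%:R 0 ^+ 2 - 3^-1.

Lemma uz_itv p : sphere R p -> - 3^-1 <= uz p <= 2 / 3.
Proof.
move=> Sp; have := sphere_sqr Sp; rewrite /uz.
have := sqr_ge0 (p 0 0); have := sqr_ge0 (p 1 0); have := sqr_ge0 (p 2%:R 0).
by move=> *; apply/andP; split; lra.
Qed.

Lemma bmeas_uz : bmeas uz.
Proof. by apply: bmeasB; [apply: bmeasX; exact: bmeas_entry|exact: bmeas_cst]. Qed.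

(** A level set of [uz] lies in two horizontal circles. This nullity is what makes the discontinuous
    indicators of [t < uz p] harmless under the integral. *)
Lemma hausdorff2_uz_eq t : hausdorff2 (sphere R `&` [set p | uz p = t]) = 0%E.
Proof.
pose c := Num.sqrt (t + 3^-1).
apply/eqP; rewrite eq_le hausdorff2_ge0 andbT.
have U2 (A B : set 'cV[R]_3) :
  (hausdorff2 (A `|` B) <= hausdorff2 A + hausdorff2 B)%E := outer_measureU2 _ A B.
have := U2 (sphere R `&` [set p | p 2%:R 0 = c]) (sphere R `&` [set p | p 2%:R 0 = - c]).
rewrite !hausdorff2_circle adde0; apply: le_trans.
apply: le_hausdorff2 => p [Sp /= pt].
have pc : p 2%:R 0 ^+ 2 = c ^+ 2.
  by rewrite /c sqr_sqrtr; move: pt; rewrite /uz; [|have := sqr_ge0 (p 2%:R 0)]; lra.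
by move/eqP: pc; rewrite eqf_sqr => /orP[] /eqP ->; [left|right].
Qed.

Lemma sphere_patch_gt0 (a b c d : R) (P : set 'cV[R]_3) :
  0 <= a < b -> 0 <= c < d -> b ^+ 2 + d ^+ 2 <= 1 ->
  (forall p, sphere R p -> a <= p 0 0 <= b -> c <= p 1 0 <= d -> P p) ->
  (0 < hausdorff2 (sphere R `&` P))%E.
Proof.
move=> /andP[a0 ab] /andP[c0 cd] bd abcd.
apply: (hausdorff2_patch_gt0 ab cd) => x y xab ycd.
have xy : 0 <= 1 - x ^+ 2 - y ^+ 2.
  by move: xab ycd => /andP[? ?] /andP[? ?]; nra.
pose p : 'cV[R]_3 := \col_i
  (if i == 0 then x else if i == 1 then y else Num.sqrt (1 - x ^+ 2 - y ^+ 2)).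
have p0 : p 0 0 = x by rewrite mxE.
have p1 : p 1 0 = y by rewrite mxE.
have Sp : sphere R p.
  by rewrite sphereE /= p0 p1 mxE /= sqr_sqrtr//; lra.
by exists p; rewrite ?p0 ?p1//; split => //; apply: abcd; rewrite ?p0 ?p1.
Qed.

(** On the sphere [uz p] is 2/3 minus the squares of the first two coordinates. Taking both in
    [[a / 2, a]] keeps away from the pole, where 2/3 is attained, and [a <= 1 / 2] gives
    [2 a ^ 2 <= a < 2 / 3 - t]. *)
Lemma hausdorff2_uz_itv_gt0 t : t < 2 / 3 ->
  (0 < hausdorff2 (sphere R `&` [set p | (t < uz p < 2 / 3)%R]))%E.
Proof.
move=> t23; pose a := Num.min (2^-1) ((2 / 3 - t) / 2).
have a0 : 0 < a by rewrite lt_min invr_gt0 ltr0n/= divr_gt0// subr_gt0.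
have a1 : a <= 2^-1 by rewrite ge_min lexx.
have a2 : a <= (2 / 3 - t) / 2 by rewrite ge_min lexx orbT.
apply: (@sphere_patch_gt0 (a / 2) a (a / 2) a).
- by apply/andP; split; lra.
- by apply/andP; split; lra.
- by nra.
- move=> p Sp /andP[x1 x2] /andP[y1 y2] /=.
  by rewrite /uz; have := sphere_sqr Sp; move=> e; apply/andP; split; nra.
Qed.

Lemma hausdorff2_uz_gt_gt0 t : t < 2 / 3 ->
  (0 < hausdorff2 (sphere R `&` [set p | (t < uz p)%R]))%E.
Proof.
move=> /hausdorff2_uz_itv_gt0/lt_le_trans; apply.
by apply: le_hausdorff2 => p [Sp /= /andP[]].
Qed.

End polar_height.

Section scalar_equation.
Context {R : realType}.
Implicit Types (p : 'cV[R]_3) (t l x y : R).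

(** The integral of [y e^y] from 0 to [x], hence zero at 0 and strictly increasing for [x >= 0]. *)
Definition psi x : R := expR x * (x - 1) + 1.

Lemma psi0 : psi 0 = 0. Proof. by rewrite /psi expR0; lra. Qed.

Lemma psi_lt x y : 0 <= x < y -> psi x < psi y.
Proof.
move=> /andP[x0 xy]; rewrite /psi ltrD2r.
rewrite (_ : y = x + (y - x)); last by lra.
move: (y - x) (subr_gt0 x y) => d; rewrite xy => /idP d0.
rewrite expRD -mulrA ltr_pM2l ?expR_gt0//.
have h1 : 1 + d < expR d by apply: expR_gt1Dx; rewrite gt_eqF.
have [x1|x1] := leP 1 (x + d); first by nra.
have h2 : 1 - d < expR (- d) by apply: expR_gt1Dx; rewrite oppr_eq0 gt_eqF.
have h3 : expR d * expR (- d) = 1 by rewrite -expRD subrr expR0.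
have := expR_gt0 d; nra.
Qed.

Lemma psi_le x y : 0 <= x <= y -> psi x <= psi y.
Proof.
by move=> /andP[x0]; rewrite le_eqVlt => /orP[/eqP->//|xy]; rewrite ltW// psi_lt// x0.
Qed.

Lemma psi_ge0 x : 0 <= x -> 0 <= psi x.
Proof. by move=> x0; rewrite -psi0 psi_le// lexx. Qed.

Lemma le_psi x : 2 <= x -> x <= psi x.
Proof. by move=> x2; rewrite /psi; have := expR_ge1Dx x; nra. Qed.

Lemma continuous_psi : continuous psi.
Proof.
move=> x; apply: (@continuousD R R^o R (fun x => expR x * (x - 1)) (cst 1)).
  apply: continuousM; first exact: continuous_expR.
  by apply: (@continuousB R R^o R id (cst 1)) => //; exact: cvg_cst.
exact: cvg_cst.
Qed.

Definition excess t p : R := Num.max (uz p - t) 0.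

Lemma excess_ge0 t p : 0 <= excess t p.
Proof. by rewrite le_max lexx orbT. Qed.

Lemma bmeas_excess t : bmeas (excess t).
Proof.
apply: bmeas_max; last exact: bmeas_cst.
by apply: bmeasB; [exact: bmeas_uz|exact: bmeas_cst].
Qed.

Lemma excess_gt0 t p : (0 < excess t p) = (t < uz p).
Proof. by rewrite lt_max ltxx orbF subr_gt0. Qed.

Lemma excessE t p : excess t p = (t < uz p)%R%:R * (uz p - t).
Proof.
rewrite /excess; case: ltP => h; rewrite ?mul1r ?mul0r; first by rewrite max_l//; lra.
by rewrite max_r//; lra.
Qed.

Lemma excess_le1 t p : 0 <= t -> sphere R p -> excess t p <= 1.
Proof.
move=> t0 Sp; have /andP[h1 h2] := uz_itv Sp.
by rewrite /excess ge_max ler01 andbT; lra.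
Qed.

Lemma norm_uz_le1 p : sphere R p -> `|uz p| <= 1.
Proof.
by move=> Sp; have /andP[h1 h2] := uz_itv Sp; rewrite ler_norml; apply/andP; split; lra.
Qed.

Definition psi_int l t := sint (fun p => uz p * psi (l * excess t p)).

Definition uz_tail t := sint (fun p => uz p * (t < uz p)%R%:R).

(* With [t = eta / s], eliminating [s] from the two critical-point equations for
   [s (e3 (x) e3 - I / 3)] and its Lagrange multiplier [l] leaves
   [l * \int u (u - t)^+ e^(l (u - t)) = \int_(u > t) u e^(l (u - t))], that is,
   [balance l t = 0]; [psi] isolates the part discontinuous in [t]. *)
Definition balance l t := psi_int l t - uz_tail t.

Lemma bmeas_psi F : bmeas F -> bmeas (fun p => psi (F p)).
Proof.
move=> bF; apply: bmeasD; last exact: bmeas_cst.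
apply: bmeasM; first exact: bmeas_expR.
by apply: bmeasB => //; exact: bmeas_cst.
Qed.

Lemma bmeas_psi_int l t : bmeas (fun p => uz p * psi (l * excess t p)).
Proof.
apply: bmeasM; first exact: bmeas_uz.
by apply: bmeas_psi; apply: bmeasZ; exact: bmeas_excess.
Qed.

Lemma bmeas_uz_gt t : bmeas (fun p => (t < uz p)%R%:R).
Proof. by apply: bmeas_lt; [exact: bmeas_cst|exact: bmeas_uz]. Qed.

Lemma bmeas_uz_tail t : bmeas (fun p => uz p * (t < uz p)%R%:R).
Proof. by apply: bmeasM; [exact: bmeas_uz|exact: bmeas_uz_gt]. Qed.

(** Only [psi_int] depends on [l]. As [t >= 0], the factor [uz p] is positive wherever the excess
    is, so the integrand increases pointwise with [l], strictly on a cap of positive measure. *)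
Lemma balance_lt l l' t : 0 <= l < l' -> 0 <= t < 2 / 3 ->
  balance l t < balance l' t.
Proof.
move=> /andP[l0 ll'] /andP[t0 t1]; rewrite /balance ltrD2r -subr_gt0 /psi_int.
rewrite -sintB; [|exact: bmeas_psi_int|exact: bmeas_psi_int].
have lt p : t < uz p -> psi (l * excess t p) < psi (l' * excess t p).
  move=> tp; apply: psi_lt; rewrite mulr_ge0 ?excess_ge0//=.
  by rewrite ltr_pM2r// excess_gt0.
apply: sint_gt0.
- by apply: bmeasB; exact: bmeas_psi_int.
- move=> p Sp; rewrite -mulrBr; have [tp|tp] := ltP t (uz p).
    by rewrite mulr_ge0//; [lra|rewrite subr_ge0 ltW// lt].
  have -> : excess t p = 0 by rewrite excessE ltNge tp mul0r.
  by rewrite !mulr0 subrr mulr0.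
- apply: lt_le_trans (hausdorff2_uz_gt_gt0 t1) _; apply: le_hausdorff2 => p [Sp /= tp].
  by split => //=; rewrite -mulrBr mulr_gt0//; [lra|rewrite subr_gt0 lt].
Qed.

Lemma balance0_lt0 t : 0 <= t < 2 / 3 -> balance 0 t < 0.
Proof.
move=> /andP[t0 t1].
have -> : balance 0 t = - uz_tail t.
  rewrite /balance /psi_int (_ : sint _ = 0) ?sub0r// -[RHS]sint0.
  by apply: eq_sint => p _; rewrite mul0r psi0 mulr0.
rewrite oppr_lt0; apply: sint_gt0; first exact: bmeas_uz_tail.
  by move=> p Sp; case: ltP => tp; rewrite ?mulr1 ?mulr0//; lra.
apply: lt_le_trans (hausdorff2_uz_gt_gt0 t1) _; apply: le_hausdorff2 => p [Sp /= tp].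
by split => //=; rewrite tp mulr1; lra.
Qed.

Lemma balance_pos t : 0 <= t < 2 / 3 -> exists2 l, 0 <= l & 0 < balance l t.
Proof.
move=> /andP[t0 t1]; pose e := (2 / 3 - t) / 2.
have e0 : 0 < e by rewrite divr_gt0// subr_gt0.
pose m := sint (fun p => (t + e < uz p)%R%:R : R).
have m0 : 0 < m.
  apply: sint_gt0; [exact: bmeas_uz_gt|by move=> p _; exact: ler0n|].
  have te : t + e < 2 / 3 by rewrite /e; lra.
  apply: lt_le_trans (hausdorff2_uz_gt_gt0 te) _; apply: le_hausdorff2 => p [Sp /= tp].
  by split => //=; rewrite tp.
(* On the cap [t + e < uz p] the first bound makes the argument of [psi] at least 2, where [psi]
   dominates the identity; the integral is then at least [l * e ^ 2 * m], which the second bound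
   lifts above the tail, itself at most [sarea]. *)
pose l := Num.max (2 / e) ((sarea + 1) / (e ^+ 2 * m)).
have em : 0 < e ^+ 2 * m by rewrite mulr_gt0// exprn_gt0.
have le2 : 2 <= l * e by rewrite -ler_pdivrMr// le_max lexx.
have lem : sarea + 1 <= l * (e ^+ 2 * m) by rewrite -ler_pdivrMr// le_max lexx orbT.
have l0 : 0 <= l by rewrite le_max divr_ge0// ltW.
exists l => //; rewrite /balance subr_gt0.
apply: (@le_lt_trans _ _ (1 * sarea)).
  rewrite -sint_cst; apply: sint_le; [exact: bmeas_uz_tail|exact: bmeas_cst|].
  move=> p Sp; have /andP[_ h] := uz_itv Sp.
  by case: ltP => tp; rewrite ?mulr1 ?mulr0//; lra.
rewrite mul1r; apply: (@lt_le_trans _ _ (l * (e ^+ 2 * m))); first by lra.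
rewrite mulrA -sintZ; last exact: bmeas_uz_gt.
apply: sint_le; [by apply: bmeasZ; exact: bmeas_uz_gt|exact: bmeas_psi_int|].
move=> p Sp; have [tp|tp] := ltP (t + e) (uz p).
  have ex : excess t p = uz p - t by rewrite excessE (_ : (t < uz p)%R)// ?mul1r//; lra.
  have le_s : l * e <= psi (l * excess t p).
    apply: le_trans (_ : l * excess t p <= _).
      by rewrite ler_wpM2l// ex; lra.
    by apply: le_psi; apply: le_trans le2 _; rewrite ler_wpM2l// ex; lra.
  rewrite mulr1 expr2 mulrCA ler_pM//; first exact: ltW.
    by rewrite mulr_ge0// ltW.
  by lra.
rewrite mulr0; have [tu|tu] := ltP t (uz p).
  by rewrite mulr_ge0//; [lra|apply: psi_ge0; rewrite mulr_ge0 ?excess_ge0].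
by rewrite excessE ltNge tu mul0r mulr0 psi0 mulr0.
Qed.

End scalar_equation.

Section equilibrium.
Context {R : realType}.
Implicit Types (p : 'cV[R]_3) (t l : R).

Lemma max0E (x : R) : Num.max x 0 = 2^-1 * (x + `|x|).
Proof. by case: (leP x 0) => x0; [rewrite ler0_norm|rewrite gtr0_norm]; lra. Qed.

Lemma cvg_max0 T (F : set_system T) (FF : Filter F) (f : T -> R) (a : R) :
  f x @[x --> F] --> a -> Num.max (f x) 0 @[x --> F] --> Num.max a 0.
Proof.
move=> fa; under eq_fun do rewrite max0E; rewrite max0E.
by apply: cvgM; [exact: cvg_cst|]; apply: cvgD => //; exact: cvg_norm.
Qed.

Lemma cvg_excess p (t_ : nat -> R) t : t_ n @[n --> \oo] --> t ->
  excess (t_ n) p @[n --> \oo] --> excess t p.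
Proof.
by move=> tt; apply: cvg_max0; apply: cvgB => //; exact: cvg_cst.
Qed.

Lemma cvg_uz_gt p (t_ : nat -> R) t : t_ n @[n --> \oo] --> t -> uz p <> t ->
  ((t_ n < uz p)%R%:R : R) @[n --> \oo] --> ((t < uz p)%R%:R : R).
Proof.
move=> tt /eqP; rewrite neq_lt => /orP[h|h].
  apply: cvg_near_cst; near=> n.
  have hn : uz p < t_ n by near: n; exact: cvgr_gt tt _ h.
  by rewrite !ltNge (ltW hn) (ltW h).
apply: cvg_near_cst; near=> n.
have hn : t_ n < uz p by near: n; exact: cvgr_lt tt _ h.
by rewrite hn h.
Unshelve. all: by end_near. Qed.

(** Dominated convergence: the indicators in the tail can fail to converge only on the level set
    [uz p = t], which is null. *)
Lemma balance_cvg (l_ t_ : nat -> R) l t L :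
  (forall n, 0 <= l_ n <= L) -> (forall n, 0 <= t_ n) ->
  l_ n @[n --> \oo] --> l -> t_ n @[n --> \oo] --> t ->
  balance (l_ n) (t_ n) @[n --> \oo] --> balance l t.
Proof.
move=> lL t0 ll tt; apply: cvgB.
- apply: (@sint_cvg _ _ _ set0 (psi L)).
  + by move=> n; exact: bmeas_psi_int.
  + exact: bmeas_psi_int.
  + exact: hausdorff2_0.
  + move=> n p Sp; have /andP[l0 l1] := lL n.
    have le0 : 0 <= l_ n * excess (t_ n) p by rewrite mulr_ge0 ?excess_ge0.
    have leL : l_ n * excess (t_ n) p <= L.
      by rewrite -[leRHS]mulr1 ler_pM ?excess_ge0 ?excess_le1.
    rewrite normrM -[leRHS]mul1r ler_pM ?norm_uz_le1// ger0_norm ?psi_ge0//.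
    by apply: psi_le; rewrite le0.
  + move=> p Sp _; apply: cvgM; first exact: cvg_cst.
    apply: (continuous_cvg _ (@continuous_psi R _)).
    by apply: cvgM => //; exact: cvg_excess.
- apply: (@sint_cvg _ _ _ [set p | sphere R p /\ uz p = t] 1).
  + by move=> n; exact: bmeas_uz_tail.
  + exact: bmeas_uz_tail.
  + exact: hausdorff2_uz_eq.
  + move=> n p Sp; rewrite normrM -[leRHS]mul1r ler_pM ?norm_uz_le1//.
    by case: (_ < _); rewrite ?normr1 ?normr0.
  + move=> p Sp pt; apply: cvgM; [exact: cvg_cst|]; apply: cvg_uz_gt => // h; exact: pt.
Qed.

Lemma balance_root t : 0 <= t < 2 / 3 -> exists l, 0 < l /\ balance l t = 0.
Proof.
move=> t01; have /andP[t0 t1] := t01.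
have [L L0 Lpos] := balance_pos t01; have neg := balance0_lt0 t01.
(* The projection of the line onto [[0, L]] keeps the multipliers within the bounds required by
   [balance_cvg] and gives a function continuous on the whole line. *)
pose clamp (x : R) := Num.max (x - Num.max (x - L) 0) 0.
have cl x : 0 <= clamp x <= L.
  rewrite /clamp le_max lexx orbT/= ge_max L0 andbT.
  by case: (leP (x - L) 0) => h; lra.
have clc : continuous clamp.
  move=> x; apply: cvg_max0; apply: cvgB => //.
  by apply: cvg_max0; apply: cvgB => //; exact: cvg_cst.
have fc : continuous (fun x => balance (clamp x) t).
  move=> x; apply/(@cvg_nbhsP R R^o) => u ux.
  apply: (@balance_cvg _ (fun=> t) _ _ L) => //; last exact: cvg_cst.
  by apply: (continuous_cvg _ (clc _)).
have cl0 : clamp 0 = 0 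
  by rewrite /clamp (max_r (_ : 0 - L <= 0)) ?subr0 ?maxxx// sub0r oppr_le0.
have clL : clamp L = L by rewrite /clamp subrr maxxx subr0 max_l.
have [|c c0L bc] := @IVT R (fun x => balance (clamp x) t) 0 L 0 L0
  (continuous_subspaceT fc).
  by rewrite cl0 clL ge_min le_max (ltW neg) (ltW Lpos) orbT.
exists (clamp c); split => //.
have /andP[c0 _] := cl c; rewrite lt_neqAle c0 andbT; apply/eqP => h.
by move: bc neg; rewrite /= -h => ->; rewrite ltxx.
Qed.

(** By strict monotonicity in the multiplier, [balance] has opposite signs at two values close to
    [lam t] on either side. With these values fixed, the signs persist at [t_ n] for large [n] and
    enclose its root. *)
Lemma balance_root_continuous (lam : R -> R) :
  (forall t, 0 <= t < 2 / 3 -> 0 < lam t /\ balance (lam t) t = 0) ->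
  forall (t_ : nat -> R) t, (forall n, 0 <= t_ n < 2 / 3) -> 0 <= t < 2 / 3 ->
  t_ n @[n --> \oo] --> t -> lam (t_ n) @[n --> \oo] --> lam t.
Proof.
move=> lamP t_ t t_01 t01 tt; apply/cvgrPdist_lt => e e0.
have [l0 bl] := lamP t t01.
(* The second term keeps [a] positive, within the range where [balance] is monotone. *)
pose a := Num.max (lam t - e) (lam t / 2).
have alt : a < lam t by rewrite gt_max; apply/andP; split; lra.
have a0 : 0 < a by rewrite lt_max; apply/orP; right; lra.
have ae : lam t - e <= a by rewrite le_max lexx.
pose b := lam t + e.
have cvgc c : 0 < c -> balance c (t_ n) @[n --> \oo] --> balance c t.
  move=> c0; apply: (@balance_cvg (fun=> c) _ _ _ c) => //;
    [|by move=> n; have /andP[] := t_01 n|exact: cvg_cst].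
  by move=> n; rewrite lexx ltW.
have b0 : 0 < b by rewrite addr_gt0.
have na : balance a t < 0 by rewrite -bl balance_lt// ltW.
have nb : 0 < balance b t by rewrite -bl balance_lt// ltW//= ltrDl.
have mono c n : 0 < c -> (balance c (t_ n) < 0 -> c < lam (t_ n)) /\
    (0 < balance c (t_ n) -> lam (t_ n) < c).
  move=> c0; have [h1 h2] := lamP _ (t_01 n).
  split => h; rewrite ltNge; apply/negP; rewrite le_eqVlt => /orP[/eqP h3|h3].
  - by move: h; rewrite -h3 h2 ltxx.
  - have := balance_lt (_ : 0 <= lam (t_ n) < c) (t_01 n).
    by rewrite (ltW h1) h3 h2 => /(_ isT); lra.
  - by move: h; rewrite h3 h2 ltxx.
  - have := balance_lt (_ : 0 <= c < lam (t_ n)) (t_01 n).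
    by rewrite (ltW c0) h3 h2 => /(_ isT); lra.
have Ha : \forall n \near \oo, balance a (t_ n) < 0 by exact: cvgr_lt (cvgc a a0) _ na.
have Hb : \forall n \near \oo, 0 < balance b (t_ n) by exact: cvgr_gt (cvgc b b0) _ nb.
near=> n.
have h1 : a < lam (t_ n).
  by apply: (mono a n a0).1; near: n.
have h2 : lam (t_ n) < b.
  by apply: (mono b n b0).2; near: n.
by rewrite ltr_distlC; rewrite /b in h2; apply/andP; split; lra.
Unshelve. all: by end_near. Qed.

End equilibrium.

Section equilibrium_existence.
Context {R : realType}.
Implicit Types (p : 'cV[R]_3) (t l s eta : R).

Lemma bmeas_expuz l : bmeas (fun p => expR (l * uz p)).
Proof. by apply: bmeas_expR; apply: bmeasZ; exact: bmeas_uz. Qed.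

Let den l t := sint (fun p => excess t p * expR (l * uz p)).

Let num l t := sint (fun p => uz p * (excess t p * expR (l * uz p))).

Let bden l t : bmeas (fun p => excess t p * expR (l * uz p)).
Proof. by apply: bmeasM; [exact: bmeas_excess|exact: bmeas_expuz]. Qed.

Let bnum l t : bmeas (fun p => uz p * (excess t p * expR (l * uz p))).
Proof. by apply: bmeasM; [exact: bmeas_uz|exact: bden]. Qed.

Let den_gt0 l t : t < 2 / 3 -> 0 < den l t.
Proof.
move=> t1; apply: sint_gt0; first exact: bden.
  by move=> p _; rewrite mulr_ge0 ?excess_ge0 ?expR_ge0.
apply: lt_le_trans (hausdorff2_uz_gt_gt0 t1) _; apply: le_hausdorff2 => p [Sp /= tp].
by split => //=; rewrite mulr_gt0 ?excess_gt0 ?expR_gt0.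
Qed.

Let num_gt l t : t < 2 / 3 -> t * den l t < num l t.
Proof.
move=> t1; rewrite /den /num -(sintZ _ (bden l t)) -subr_gt0.
rewrite -(sintB (bnum l t) (bmeasZ t (bden l t))).
apply: sint_gt0; first exact: (bmeasB (bnum l t) (bmeasZ t (bden l t))).
  move=> p _; rewrite -mulrBl; have [tp|tp] := ltP t (uz p).
    by rewrite mulr_ge0 ?mulr_ge0 ?excess_ge0 ?expR_ge0//; lra.
  by rewrite excessE ltNge tp !mul0r mulr0.
apply: lt_le_trans (hausdorff2_uz_gt_gt0 t1) _; apply: le_hausdorff2 => p [Sp /= tp].
by split => //=; rewrite -mulrBl mulr_gt0 ?mulr_gt0 ?excess_gt0 ?expR_gt0//; lra.
Qed.

Let num_lt l t : t < 2 / 3 -> num l t < 2 / 3 * den l t.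
Proof.
move=> t1; rewrite /den /num -(sintZ _ (bden l t)) -subr_gt0.
rewrite -(sintB (bmeasZ (2 / 3) (bden l t)) (bnum l t)).
apply: sint_gt0; first exact: (bmeasB (bmeasZ (2 / 3) (bden l t)) (bnum l t)).
  move=> p Sp; have /andP[_ h] := uz_itv Sp.
  by rewrite -mulrBl mulr_ge0 ?mulr_ge0 ?excess_ge0 ?expR_ge0//; lra.
apply: lt_le_trans (hausdorff2_uz_itv_gt0 t1) _.
apply: le_hausdorff2 => p [Sp /= /andP[tp pt]].
by split => //=; rewrite -mulrBl mulr_gt0 ?mulr_gt0 ?excess_gt0 ?expR_gt0//; lra.
Qed.

Let weight_cvg (l_ t_ : nat -> R) l t : (forall n, 0 <= t_ n) ->
  l_ n @[n --> \oo] --> l -> t_ n @[n --> \oo] --> t ->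
  den (l_ n) (t_ n) @[n --> \oo] --> den l t /\
  num (l_ n) (t_ n) @[n --> \oo] --> num l t.
Proof.
move=> t0 ll tt.
have /cvg_seq_bounded[M [_ Mb]] : cvgn l_ by apply/cvg_ex; exists l.
have {}Mb n : `|l_ n| <= M + 1 by apply: Mb => //; rewrite ltrDl.
have bd n p : sphere R p ->
    `|excess (t_ n) p * expR (l_ n * uz p)| <= expR (M + 1).
  move=> Sp; rewrite normrM (ger0_norm (excess_ge0 _ _)) (ger0_norm (expR_ge0 _)).
  rewrite -[leRHS]mul1r ler_pM ?excess_ge0 ?expR_ge0 ?excess_le1//.
  rewrite ler_expR (le_trans (ler_norm _))// normrM -[leRHS]mulr1.
  by rewrite ler_pM ?norm_uz_le1.
have pt p : excess (t_ n) p * expR (l_ n * uz p) @[n --> \oo] -->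
    excess t p * expR (l * uz p).
  apply: cvgM; first exact: cvg_excess.
  apply: (continuous_cvg _ (@continuous_expR R _)).
  by apply: cvgM => //; exact: cvg_cst.
split; apply: (@sint_cvg _ _ _ set0 (expR (M + 1))).
- by move=> n; exact: bden.
- exact: bden.
- exact: hausdorff2_0.
- exact: bd.
- by move=> p _ _; exact: pt.
- by move=> n; exact: bnum.
- exact: bnum.
- exact: hausdorff2_0.
- move=> n p Sp; rewrite normrM -[leRHS]mul1r ler_pM ?norm_uz_le1//.
  exact: bd.
- by move=> p _ _; apply: cvgM; [exact: cvg_cst|exact: pt].
Qed.

Let equilibrium_t eta : 0 <= eta < 2 / 3 -> exists t l,
  [/\ 0 <= t < 2 / 3, 0 < l, balance l t = 0 &
      t * (3 / 2 * (num l t / den l t)) = eta].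
Proof.
move=> /andP[eta0 eta1].
have /choice[lam lamP] : forall t, exists l,
    0 <= t < 2 / 3 -> 0 < l /\ balance l t = 0.
  move=> t; have [h|h] := boolP (0 <= t < 2 / 3); last by exists 0.
  by have [l lP] := balance_root h; exists l.
(* The weighted mean [num / den] exceeds [t1], so [f t1 >= 3 / 2 * t1 ^ 2], and this is at least
   [eta] because the arithmetic mean of [eta] and 2/3 dominates the geometric one. *)
pose t1 := (eta + 2 / 3) / 2.
have t10 : 0 <= t1 by rewrite /t1; lra.
have t1lt : t1 < 2 / 3 by rewrite /t1; lra.
pose clamp (x : R) := Num.max (x - Num.max (x - t1) 0) 0.
have cl x : 0 <= clamp x <= t1.
  rewrite /clamp le_max lexx orbT/= ge_max t10 andbT.
  by case: (leP (x - t1) 0) => h; lra.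
have cl' x : 0 <= clamp x < 2 / 3.
  by have /andP[-> h] := cl x; exact: le_lt_trans t1lt.
have clc : continuous clamp.
  move=> x; apply: cvg_max0; apply: cvgB => //.
  by apply: cvg_max0; apply: cvgB => //; exact: cvg_cst.
pose f t := t * (3 / 2 * (num (lam t) t / den (lam t) t)).
have fc : continuous (fun x => f (clamp x)).
  move=> x; apply/(@cvg_nbhsP R R^o) => u ux.
  have cu : clamp (u n) @[n --> \oo] --> clamp x by apply: (continuous_cvg _ (clc _)).
  have lu : lam (clamp (u n)) @[n --> \oo] --> lam (clamp x).
    by apply: (balance_root_continuous lamP) => // n; exact: cl'.
  have [dc nc] := weight_cvg (fun n => proj1 (andP (cl (u n)))) lu cu.
  apply: cvgM => //; apply: cvgM; first exact: cvg_cst.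
  apply: cvgM => //; apply: cvgV => //.
  by rewrite gt_eqF// den_gt0//; have /andP[] := cl' x.
have cl0 : clamp 0 = 0.
  by rewrite /clamp (max_r (_ : 0 - t1 <= 0)) ?subr0 ?maxxx// sub0r oppr_le0.
have clt1 : clamp t1 = t1 by rewrite /clamp subrr maxxx subr0 max_l.
have ft1 : eta <= f t1.
  have h : t1 < num (lam t1) t1 / den (lam t1) t1.
    by rewrite ltr_pdivlMr ?den_gt0// num_gt.
  apply: (@le_trans _ _ (t1 * (3 / 2 * t1))); first by rewrite /t1; nra.
  by rewrite /f ler_wpM2l// ler_wpM2l// ltW.
have f0 : f 0 = 0 by rewrite /f mul0r.
have [|c _ fcE] := @IVT R (fun x => f (clamp x)) 0 t1 eta t10
  (continuous_subspaceT fc).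
  by rewrite cl0 clt1 f0 ge_min eta0 le_max ft1 orbT.
exists (clamp c), (lam (clamp c)).
by have [h1 h2] := lamP _ (cl' c).
Qed.

(** The first integral identity says that the normalised Gibbs density has the second moments of its
    own matrix; the second one, that the dual bound with multiplier [l] is stationary there. *)
Lemma equilibrium eta : 0 <= eta < 2 / 3 -> exists s l,
  let w p := Num.max (s * uz p - eta) 0 in
  [/\ 0 < s < 1, eta < 2 / 3 * s,
      sint (fun p => uz p * (w p * expR (l * uz p))) =
        2 / 3 * s * sint (fun p => w p * expR (l * uz p)) &
      2 / 3 * l * sint (fun p => w p * expR (l * uz p)) =
        sint (fun p => uz p * ((eta < s * uz p)%R%:R * expR (l * uz p)))].
Proof.
move=> etaP; have [t [l [/andP[t0 t1] l0 bl etaE]]] := equilibrium_t etaP.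
have /andP[eta0 eta1] := etaP.
have D0 := den_gt0 l t1.
pose m := num l t / den l t.
have mlt : m < 2 / 3 by rewrite ltr_pdivrMr// num_lt.
have mgt : t < m by rewrite ltr_pdivlMr// num_gt.
have numE : num l t = m * den l t by rewrite /m -mulrA mulVf ?mulr1// gt_eqF.
pose s := 3 / 2 * m; have s0 : 0 < s by rewrite /s; lra.
have etaE' : eta = s * t by rewrite -etaE mulrC.
exists s, l => w.
have wE p : w p = s * excess t p.
  rewrite /w etaE' /excess -mulrBr; case: (leP (uz p - t) 0) => h.
    by rewrite mulr0 max_r// pmulr_rle0.
  by rewrite max_l// pmulr_rge0// ltW.
have wden : sint (fun p => w p * expR (l * uz p)) = s * den l t.
  by rewrite -(sintZ _ (bden l t)); apply: eq_sint => p _; rewrite wE mulrA.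
have wnum : sint (fun p => uz p * (w p * expR (l * uz p))) = s * num l t.
  by rewrite -(sintZ _ (bnum l t)); apply: eq_sint => p _; rewrite wE -mulrA mulrCA.
split.
- by rewrite s0 /s; lra.
- by rewrite etaE' mulrC ltr_pM2r// /s; lra.
- by rewrite wden wnum numE /s; lra.
rewrite wden.
have -> : 2 / 3 * l * (s * den l t) = l * num l t by rewrite numE /s; lra.
have E : sint (fun p => expR (l * t) * (uz p * psi (l * excess t p))) =
    sint (fun p => expR (l * t) * (uz p * (t < uz p)%R%:R)).
  rewrite (sintZ _ (bmeas_psi_int l t)) (sintZ _ (bmeas_uz_tail t)).
  by congr (_ * _); apply/eqP; rewrite -subr_eq0; apply/eqP.
rewrite -(sintZ _ (bnum l t)); apply/eqP; rewrite -subr_eq0.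
have b1 : bmeas (fun p => expR (l * t) * (uz p * psi (l * excess t p))).
  by apply: bmeasZ; exact: bmeas_psi_int.
have b2 : bmeas (fun p => expR (l * t) * (uz p * (t < uz p)%R%:R)).
  by apply: bmeasZ; exact: bmeas_uz_tail.
have b3 : bmeas (fun p => uz p * ((eta < s * uz p)%R%:R * expR (l * uz p))).
  apply: bmeasM; first exact: bmeas_uz.
  apply: bmeasM; last exact: bmeas_expuz.
  by apply: bmeas_lt; [exact: bmeas_cst|apply: bmeasZ; exact: bmeas_uz].
rewrite -(sintB (bmeasZ l (bnum l t)) b3).
(* With [v = l (u - t)] both integrands equal [e^(l t) u e^v (v - 1)] on [u > t]: the constant 1 in
   [psi] cancels against the tail. *)
suff -> : sint (fun p => l * (uz p * (excess t p * expR (l * uz p))) -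
      uz p * ((eta < s * uz p)%R%:R * expR (l * uz p))) =
    sint (fun p => expR (l * t) * (uz p * psi (l * excess t p)) -
      expR (l * t) * (uz p * (t < uz p)%R%:R)).
  by rewrite (sintB b1 b2) E subrr.
apply: eq_sint => p Sp; rewrite etaE' ltr_pM2l//.
rewrite excessE; case: ltP => tp; last first.
  by rewrite /= !mul0r !mulr0 psi0 !mulr0 subrr.
rewrite /= !mul1r mulr1 /psi.
have -> : expR (l * uz p) = expR (l * t) * expR (l * (uz p - t)).
  by rewrite -expRD (mulrBr l (uz p) t) addrC subrK.
move: (expR (l * t)) (expR _) => x y; lra.
Qed.

End equilibrium_existence.

Section polar_symmetry.
Context {R : realType}.
Implicit Types (p : 'cV[R]_3) (F M : 'cV[R]_3 -> R).

(** These finitely many symmetries of the axis already force the matrix of second moments to be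
    diagonal with equal first two entries. *)
Definition polar F : Prop := [/\ bmeas F,
  forall k p, F (flip k p) = F p & forall p, F (swap 0 1 p) = F p].

Lemma flipE k p i : flip k p i 0 = if i == k then - p i 0 else p i 0.
Proof. by rewrite mxE. Qed.

Lemma swap01E p : [/\ swap 0 1 p 0 0 = p 1 0, swap 0 1 p 1 0 = p 0 0 &
  swap 0 1 p 2%:R 0 = p 2%:R 0].
Proof. by rewrite !mxE tpermL tpermR tpermD. Qed.

Lemma uz_flip k p : uz (flip k p) = uz p.
Proof. by rewrite /uz flipE; case: ifP => _; rewrite ?sqrrN. Qed.

Lemma uz_swap p : uz (swap 0 1 p) = uz p.
Proof. by rewrite /uz; have [_ _ ->] := swap01E p. Qed.

Lemma polar_uz (phi : R -> R) : bmeas (fun p => phi (uz p)) ->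
  polar (fun p => phi (uz p)).
Proof. by move=> b; split => // [k p|p]; rewrite ?uz_flip ?uz_swap. Qed.

Lemma bmeas_quadratic i j : bmeas (fun p => p i 0 * p j 0).
Proof. exact: (bmeasM (bmeas_entry i) (bmeas_entry j)). Qed.

Lemma sint_polar_offdiag F i j : polar F -> i != j ->
  sint (fun p => p i 0 * p j 0 * F p) = 0.
Proof.
move=> [bF Ff _] ij; apply: (@sint_odd _ i).
  exact: (bmeasM (bmeas_quadratic i j) bF).
by move=> p _; rewrite Ff !flipE eqxx eq_sym (negbTE ij) !mulNr.
Qed.

Lemma sint_polar_xx_yy F : polar F ->
  sint (fun p => p 0 0 * p 0 0 * F p) = sint (fun p => p 1 0 * p 1 0 * F p).
Proof.
move=> [bF _ Fs]; rewrite -(sint_swap 0 1 (bmeasM (bmeas_quadratic 0 0) bF)).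
by apply: eq_sint => p _; have [-> _ _] := swap01E p; rewrite Fs.
Qed.

Lemma sphere_mul p : sphere R p ->
  p 0 0 * p 0 0 + p 1 0 * p 1 0 + p 2%:R 0 * p 2%:R 0 = 1.
Proof. by move/sphere_sqr; rewrite !expr2. Qed.

Lemma sint_quadratic_trace F : bmeas F ->
  sint (fun p => p 0 0 * p 0 0 * F p) + sint (fun p => p 1 0 * p 1 0 * F p) +
  sint (fun p => p 2%:R 0 * p 2%:R 0 * F p) = sint F.
Proof.
move=> bF; have b i := bmeasM (bmeas_quadratic i i) bF.
rewrite -(sintD (b 0) (b 1)) -(sintD (bmeasD (b 0) (b 1)) (b 2%:R)).
by apply: eq_sint => p /sphere_mul e; rewrite -!mulrDl e mul1r.
Qed.

End polar_symmetry.

(** * Functions on a polar cap with prescribed second moments *)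

Section moment_corrector.
Context {R : realType}.
Variable k : R.
Hypotheses (k0 : 0 <= k) (k1 : k < 2 / 3).
Implicit Types (p : 'cV[R]_3) (B : 'M[R]_3).

Let chi p : R := (k < uz p)%R%:R.

Let bchi : bmeas chi. Proof. exact: bmeas_uz_gt. Qed.

Let pchi : polar chi.
Proof. exact: (@polar_uz _ (fun u => (k < u)%R%:R) bchi). Qed.

Let chif j p : chi (flip j p) = chi p. Proof. by have [_ ->] := pchi. Qed.

Let chis p : chi (swap 0 1 p) = chi p. Proof. by have [_ _ ->] := pchi. Qed.


Let bx : bmeas (fun p => p 0 0). Proof. exact: bmeas_entry. Qed.
Let by' : bmeas (fun p => p 1 0). Proof. exact: bmeas_entry. Qed.
Let bz : bmeas (fun p => p 2%:R 0). Proof. exact: bmeas_entry. Qed.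

(** Subtracting the mean over the cap gives the fifth quadratic zero mass there, as the other four
    have by symmetry. *)
Let mean := sint (fun p => p 2%:R 0 * p 2%:R 0 * chi p) / sint chi.

Let phi (i : 'I_5) p : R :=
  match val i with
  | 0%N => p 0 0 * p 1 0 | 1%N => p 0 0 * p 2%:R 0 | 2%N => p 1 0 * p 2%:R 0
  | 3%N => p 0 0 * p 0 0 - p 1 0 * p 1 0 | _ => p 2%:R 0 * p 2%:R 0 - mean
  end.

Let bphi i : bmeas (phi i).
Proof.
case: i => [[|[|[|[|i]]]] ?]; rewrite /phi /=.
- exact: (bmeasM bx by').
- exact: (bmeasM bx bz).
- exact: (bmeasM by' bz).
- exact: (bmeasB (bmeasM bx bx) (bmeasM by' by')).
- exact: (bmeasB (bmeasM bz bz) (bmeas_cst _)).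
Qed.

Let bMphi i j n : bmeas (fun p => p i 0 * p j 0 * (phi n p * chi p)).
Proof. exact: (bmeasM (bmeas_quadratic i j) (bmeasM (bphi n) bchi)). Qed.

Let patch (a b c d : R) (P : set 'cV[R]_3) : 0 <= a < b -> 0 <= c < d ->
  b <= 2^-1 -> d <= 2^-1 -> b ^+ 2 + d ^+ 2 < 2 / 3 - k ->
  (forall p, sphere R p -> a <= p 0 0 <= b -> c <= p 1 0 <= d -> k < uz p -> P p) ->
  (0 < hausdorff2 (sphere R `&` P))%E.
Proof.
move=> ab cd b2 d2 bd H; apply: (sphere_patch_gt0 ab cd).
  by move/andP: ab => [? ?]; move/andP: cd => [? ?]; nra.
move=> p Sp px py; apply: H => //.
move/andP: px => [xa xb]; move/andP: py => [ya yb]; move/andP: ab => [a0 _].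
move/andP: cd => [c0 _].
have hx : p 0 0 ^+ 2 <= b ^+ 2 by rewrite lerXn2r ?nnegrE//; lra.
have hy : p 1 0 ^+ 2 <= d ^+ 2 by rewrite lerXn2r ?nnegrE//; lra.
by rewrite /uz; have := sphere_sqr Sp; lra.
Qed.

Let exists_side : exists a : R, [/\ 0 < a, a <= 2^-1 & a ^+ 2 + a ^+ 2 < 2 / 3 - k].
Proof.
exists (Num.min (2^-1) ((2 / 3 - k) / 2)).
set a := Num.min _ _.
have a0 : 0 < a by rewrite lt_min invr_gt0 ltr0n/= divr_gt0// subr_gt0.
have a1 : a <= 2^-1 by rewrite ge_min lexx.
have a2 : a <= (2 / 3 - k) / 2 by rewrite ge_min lexx orbT.
by split => //; nra.
Qed.

Let chi1 p : k < uz p -> chi p = 1. Proof. by rewrite /chi => ->. Qed.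

Let chi_ge0 p : 0 <= chi p. Proof. exact: ler0n. Qed.

Let alpha := sint (fun p => p 0 0 * p 1 0 * (phi (@Ordinal 5 0 isT) p * chi p)).
Let beta := sint (fun p => p 0 0 * p 2%:R 0 * (phi (@Ordinal 5 1 isT) p * chi p)).
Let gamma := sint (fun p => p 0 0 * p 0 0 * (phi (@Ordinal 5 3 isT) p * chi p)).
Let delta := sint (fun p => p 2%:R 0 * p 2%:R 0 * (phi (@Ordinal 5 4 isT) p * chi p)).

Let alpha_gt0 : 0 < alpha.
Proof.
apply: sint_gt0; first exact: bMphi.
  by move=> p _; rewrite /phi /= mulrA mulr_ge0// -expr2 sqr_ge0.
have [a [a0 a1 a2]] := exists_side.
apply: (@patch (a / 2) a (a / 2) a) => //; try by apply/andP; split; lra.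
move=> p Sp /andP[xa _] /andP[ya _] kp /=.
by rewrite chi1// /phi /= mulr1 !mulr_gt0//; lra.
Qed.

Let beta_gt0 : 0 < beta.
Proof.
apply: sint_gt0; first exact: bMphi.
  by move=> p _; rewrite /phi /= mulrA mulr_ge0// -expr2 sqr_ge0.
have [a [a0 a1 a2]] := exists_side.
apply: (@patch (a / 2) a (a / 2) a) => //; try by apply/andP; split; lra.
move=> p Sp /andP[xa _] /andP[ya _] kp /=.
rewrite chi1// /phi /= mulr1.
have x0 : 0 < p 0 0 by lra.
have z0 : 0 < p 2%:R 0 ^+ 2 by move: kp k0; rewrite /uz => h1 h2; lra.
by rewrite mulrACA -expr2 mulr_gt0//; rewrite ?exprn_gt0.
Qed.

Let gammaE : sint (fun p => p 1 0 * p 1 0 * (phi (@Ordinal 5 3 isT) p * chi p)) = - gamma.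
Proof.
rewrite -(sint_swap 0 1 (bMphi 1 1 _)) /gamma -(sintN (bMphi 0 0 _)).
apply: eq_sint => p _; have [e1 e2 _] := swap01E p.
by rewrite /phi /= e1 e2 chis; move: (p 0 0) (p 1 0) (chi p) => a b c; lra.
Qed.

(** Exchanging the first two axes turns [gamma] into half the integral of [(x ^ 2 - y ^ 2) ^ 2] over
    the cap. *)
Let gamma_gt0 : 0 < gamma.
Proof.
have -> : gamma = 2^-1 * sint (fun p => p 0 0 * p 0 0 * (phi (@Ordinal 5 3 isT) p * chi p)
    - p 1 0 * p 1 0 * (phi (@Ordinal 5 3 isT) p * chi p)).
  rewrite (sintB (bMphi 0 0 _) (bMphi 1 1 _)) gammaE -/gamma.
  by move: (gamma) => g; lra.
rewrite mulr_gt0// ?invr_gt0//; apply: sint_gt0.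
- exact: (bmeasB (bMphi 0 0 _) (bMphi 1 1 _)).
- move=> p _; rewrite /phi /= -mulrBl mulrA mulr_ge0// -expr2; exact: sqr_ge0.
have [a [a0 a1 a2]] := exists_side.
(* On this rectangle [y < x], so the square does not vanish. *)
apply: (@patch (a / 2) a 0 (a / 4)) => //; try by [apply/andP; split; lra|lra|nra].
move=> p Sp /andP[xa _] /andP[ya yb] kp /=.
rewrite chi1// /phi /= !mulr1 -mulrBl.
by rewrite mulr_gt0//; nra.
Qed.

Let sint_chi_gt0 : 0 < sint chi.
Proof.
apply: sint_gt0 => //.
apply: lt_le_trans (hausdorff2_uz_gt_gt0 k1) _; apply: le_hausdorff2 => p [Sp /= kp].
by split => //=; rewrite chi1.
Qed.

Let sint_phi4 : sint (fun p => phi (@Ordinal 5 4 isT) p * chi p) = 0.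
Proof.
have bzz : bmeas (fun p => p 2%:R 0 * p 2%:R 0 * chi p) by exact: (bmeasM (bmeasM bz bz) bchi).
rewrite (eq_sint (G := fun p => p 2%:R 0 * p 2%:R 0 * chi p - mean * chi p)); last first.
  by move=> p _; rewrite /phi /= mulrBl.
rewrite (sintB bzz (bmeasZ mean bchi)) (sintZ _ bchi) /mean.
by rewrite -mulrA mulVf ?mulr1 ?subrr// gt_eqF.
Qed.

(** As the fifth quadratic has zero mass, [delta] is an unnormalised variance of [z ^ 2] over the
    cap; its integrand vanishes there only on a null level set. *)
Let delta_gt0 : 0 < delta.
Proof.
have b4 : bmeas (fun p => phi (@Ordinal 5 4 isT) p * chi p) by exact: (bmeasM (bphi _) bchi).
have -> : delta = sint (fun p =>
    (p 2%:R 0 * p 2%:R 0 - mean) * (p 2%:R 0 * p 2%:R 0 - mean) * chi p).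
  have -> : delta = delta - mean * sint (fun p => phi (@Ordinal 5 4 isT) p * chi p).
    by rewrite sint_phi4 mulr0 subr0.
  rewrite -(sintZ _ b4) /delta -(sintB (bMphi _ _ _) (bmeasZ mean b4)).
  by apply: eq_sint => p _; rewrite /phi /=; move: (p 2%:R 0) (chi p) (mean) => a b c; lra.
apply: sint_gt0.
- exact: (bmeasM (bmeasM (bphi (@Ordinal 5 4 isT)) (bphi (@Ordinal 5 4 isT))) bchi).
- by move=> p _; rewrite mulr_ge0// -expr2 sqr_ge0.
set P := [set p | _].
have U2 (A A' : set 'cV[R]_3) :
  (hausdorff2 (A `|` A') <= hausdorff2 A + hausdorff2 A')%E := outer_measureU2 _ A A'.
have := U2 (sphere R `&` P) (sphere R `&` [set p | uz p = mean - 3^-1]).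
rewrite hausdorff2_uz_eq adde0; apply: lt_le_trans.
apply: lt_le_trans (hausdorff2_uz_gt_gt0 k1) _; apply: le_hausdorff2 => p [Sp /= kp].
have [e|e] := eqVneq (p 2%:R 0 * p 2%:R 0) mean; [right|left]; split => //=.
  by rewrite /uz expr2 e.
rewrite /P /= chi1// mulr1 -expr2 lt_neqAle sqr_ge0 andbT eq_sym sqrf_eq0.
by rewrite subr_eq0.
Qed.

(* Supported in the polar cap [k < uz p], with second moments [B]. The five
   quadratics have a diagonal Gram matrix by the reflection and exchange
   symmetries, so that it is inverted explicitly. *)
Definition corrector B p : R :=
  (B 0 1 / alpha * (p 0 0 * p 1 0) + B 0 2%:R / beta * (p 0 0 * p 2%:R 0) +
   B 1 2%:R / beta * (p 1 0 * p 2%:R 0) +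
   (B 0 0 - B 1 1) / 2 / gamma * (p 0 0 * p 0 0 - p 1 0 * p 1 0) +
   B 2%:R 2%:R / delta * (p 2%:R 0 * p 2%:R 0 - mean)) * (k < uz p)%R%:R.

Let coef B (i : 'I_5) : R :=
  match val i with
  | 0%N => B 0 1 / alpha | 1%N => B 0 2%:R / beta | 2%N => B 1 2%:R / beta
  | 3%N => (B 0 0 - B 1 1) / 2 / gamma | _ => B 2%:R 2%:R / delta
  end.

Let T i j n := sint (fun p => p i 0 * p j 0 * (phi n p * chi p)).

Let sint_corrector B i j : sint (fun p => p i 0 * p j 0 * corrector B p) =
  coef B (@Ordinal 5 0 isT) * T i j (@Ordinal 5 0 isT) +
  coef B (@Ordinal 5 1 isT) * T i j (@Ordinal 5 1 isT) +
  coef B (@Ordinal 5 2 isT) * T i j (@Ordinal 5 2 isT) +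
  coef B (@Ordinal 5 3 isT) * T i j (@Ordinal 5 3 isT) +
  coef B (@Ordinal 5 4 isT) * T i j (@Ordinal 5 4 isT).
Proof.
have b n := bmeasZ (coef B n) (bMphi i j n).
rewrite /T -!(sintZ _ (bMphi i j _)).
rewrite -(sintD (b _) (b _)) -(sintD (bmeasD (b _) (b _)) (b _)).
rewrite -(sintD (bmeasD (bmeasD (b _) (b _)) (b _)) (b _)).
rewrite -(sintD (bmeasD (bmeasD (bmeasD (b _) (b _)) (b _)) (b _)) (b _)).
apply: eq_sint => p _; rewrite /corrector /phi /coef /= -/(chi p).
move: (B 0 1 / alpha) (B 0 2%:R / beta) (B 1 2%:R / beta) (_ / gamma) (_ / delta).
move: (p i 0) (p j 0) (chi p) (p 0 0) (p 1 0) (p 2%:R 0) mean.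
move=> a1 a2 a3 a4 a5 a6 a7 a8 a9 a10 a11 a12; lra.
Qed.

Let T_odd i j n f : (forall p, phi n (flip f p) * (flip f p i 0 * flip f p j 0) =
  - (phi n p * (p i 0 * p j 0))) -> T i j n = 0.
Proof.
move=> H; apply: (sint_odd (k := f)); first exact: bMphi.
move=> p _; rewrite chif mulrA (mulrC (flip f p i 0 * _)) H mulNr.
by move: (phi n p) (chi p) => a b; rewrite -!mulrA; congr (- _); lra.
Qed.

Let T_zz3 : T 2%:R 2%:R (@Ordinal 5 3 isT) = 0.
Proof.
suff : T 2%:R 2%:R (@Ordinal 5 3 isT) = - T 2%:R 2%:R (@Ordinal 5 3 isT) by lra.
rewrite {1}/T -(sint_swap 0 1 (bMphi 2%:R 2%:R _)) /T -(sintN (bMphi 2%:R 2%:R _)).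
apply: eq_sint => p _; have [e1 e2 e3] := swap01E p.
rewrite /phi /= e1 e2 e3 chis.
by move: (p 0 0) (p 1 0) (p 2%:R 0) (chi p) => a b c d; lra.
Qed.

Let T_yz2 : T 1 2%:R (@Ordinal 5 2 isT) = beta.
Proof.
rewrite {1}/T -(sint_swap 0 1 (bMphi 1 2%:R _)) /beta.
apply: eq_sint => p _; have [e1 e2 e3] := swap01E p.
by rewrite /phi /= e2 e3 chis.
Qed.

Let T_xx4 : T 0 0 (@Ordinal 5 4 isT) = - delta / 2 /\ T 1 1 (@Ordinal 5 4 isT) = - delta / 2.
Proof.
have b4 : bmeas (fun p => phi (@Ordinal 5 4 isT) p * chi p) by exact: (bmeasM (bphi _) bchi).
have p4 : polar (fun p => phi (@Ordinal 5 4 isT) p * chi p).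
  split=> // [j p|p]; rewrite ?chif ?chis; congr (_ * _); rewrite /phi /=.
    by rewrite flipE; case: ifP => _; rewrite ?mulrNN.
  by have [_ _ ->] := swap01E p.
have e1 := sint_polar_xx_yy p4.
have := sint_quadratic_trace b4; rewrite sint_phi4.
rewrite -/(T 0 0 (@Ordinal 5 4 isT)) -/(T 1 1 (@Ordinal 5 4 isT)) -/delta in e1 *.
by rewrite e1 => h; split; lra.
Qed.

Ltac odd f := apply: (@T_odd _ _ _ f) => p; rewrite /phi /= !flipE /=; lra.

(** Off the diagonal a single quadratic survives the reflections. On it, the fifth one contributes
    [B 2 2] to the last entry and [- B 2 2 / 2] to the other two; the fourth adds half of
    [B 0 0 - B 1 1] with opposite signs, and the zero trace gives [B 0 0] and [B 1 1]. *)
Lemma corrector_moment B i j : B^T = B -> \tr B = 0 ->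
  sint (fun p => p i 0 * p j 0 * corrector B p) = B i j.
Proof.
move=> symB trB.
have sB a b : B a b = B b a by rewrite -{1}symB mxE.
wlog : i j / (i <= j)%N.
  move=> H; have [/H//|/ltnW/H e] := leqP i j.
  by rewrite sB -e; apply: eq_sint => p _; rewrite (mulrC (p i 0)).
rewrite /mxtrace sum_ord3 in trB.
have a0 := lt0r_neq0 alpha_gt0; have b0 := lt0r_neq0 beta_gt0.
have g0 := lt0r_neq0 gamma_gt0; have d0 := lt0r_neq0 delta_gt0.
have [xx4 yy4] := T_xx4.
rewrite sint_corrector; elim/ord3_ind: i; elim/ord3_ind: j => // _.
- have -> : T 0 0 (@Ordinal 5 0 isT) = 0 by odd (0 : 'I_3).
  have -> : T 0 0 (@Ordinal 5 1 isT) = 0 by odd (0 : 'I_3).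
  have -> : T 0 0 (@Ordinal 5 2 isT) = 0 by odd (1 : 'I_3).
  rewrite xx4 -[T 0 0 _]/gamma /coef /= mulfVK// mulrA mulrN mulfVK//; lra.
- have -> : T 0 1 (@Ordinal 5 1 isT) = 0 by odd (2%:R : 'I_3).
  have -> : T 0 1 (@Ordinal 5 2 isT) = 0 by odd (2%:R : 'I_3).
  have -> : T 0 1 (@Ordinal 5 3 isT) = 0 by odd (0 : 'I_3).
  have -> : T 0 1 (@Ordinal 5 4 isT) = 0 by odd (0 : 'I_3).
  by rewrite -[T 0 1 _]/alpha /coef /= mulfVK// !mulr0 !addr0.
- have -> : T 0 2%:R (@Ordinal 5 0 isT) = 0 by odd (1 : 'I_3).
  have -> : T 0 2%:R (@Ordinal 5 2 isT) = 0 by odd (0 : 'I_3).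
  have -> : T 0 2%:R (@Ordinal 5 3 isT) = 0 by odd (0 : 'I_3).
  have -> : T 0 2%:R (@Ordinal 5 4 isT) = 0 by odd (0 : 'I_3).
  by rewrite -[T 0 2%:R _]/beta /coef /= mulfVK// !mulr0 !addr0 add0r.
- have -> : T 1 1 (@Ordinal 5 0 isT) = 0 by odd (0 : 'I_3).
  have -> : T 1 1 (@Ordinal 5 1 isT) = 0 by odd (0 : 'I_3).
  have -> : T 1 1 (@Ordinal 5 2 isT) = 0 by odd (1 : 'I_3).
  rewrite yy4 [T 1 1 _]gammaE /coef /= mulrN mulfVK// mulrA mulrN mulfVK//; lra.
- have -> : T 1 2%:R (@Ordinal 5 0 isT) = 0 by odd (0 : 'I_3).
  have -> : T 1 2%:R (@Ordinal 5 1 isT) = 0 by odd (0 : 'I_3).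
  have -> : T 1 2%:R (@Ordinal 5 3 isT) = 0 by odd (1 : 'I_3).
  have -> : T 1 2%:R (@Ordinal 5 4 isT) = 0 by odd (1 : 'I_3).
  by rewrite T_yz2 /coef /= mulfVK// !mulr0 !addr0 add0r.
- have -> : T 2%:R 2%:R (@Ordinal 5 0 isT) = 0 by odd (0 : 'I_3).
  have -> : T 2%:R 2%:R (@Ordinal 5 1 isT) = 0 by odd (0 : 'I_3).
  have -> : T 2%:R 2%:R (@Ordinal 5 2 isT) = 0 by odd (1 : 'I_3).
  by rewrite T_zz3 -[T 2%:R 2%:R _]/delta /coef /= mulfVK// !mulr0 !add0r.
Qed.

Lemma bmeas_corrector B : bmeas (corrector B).
Proof.
apply: bmeasM; last exact: bmeas_uz_gt.
have q i j c := bmeasZ c (bmeas_quadratic i j).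
apply: bmeasD; last first.
  by apply: bmeasZ; exact: (bmeasB (bmeas_quadratic _ _) (bmeas_cst _)).
apply: bmeasD; last first.
  by apply: bmeasZ; exact: (bmeasB (bmeas_quadratic _ _) (bmeas_quadratic _ _)).
by apply: bmeasD; first apply: bmeasD; exact: q.
Qed.

Lemma corrector_out B p : uz p <= k -> corrector B p = 0.
Proof. by rewrite /corrector ltNge => ->; rewrite mulr0. Qed.

Lemma corrector_le : exists2 C, 0 < C & forall B b p, sphere R p ->
  (forall i j, `|B i j| <= b) -> `|corrector B p| <= C * b.
Proof.
have pos := (alpha_gt0, beta_gt0, gamma_gt0, delta_gt0).
exists (alpha^-1 * 1 + beta^-1 * 1 + beta^-1 * 1 + gamma^-1 * 2 +
    delta^-1 * (1 + `|mean|)).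
  rewrite !mulr1.
  by rewrite !addr_gt0// ?mulr_gt0// ?invr_gt0 ?pos// ltr_pwDl.
move=> B b p Sp Bb; have b0 : 0 <= b by exact: le_trans (Bb 0 0).
have q i j : `|p i 0 * p j 0| <= 1.
  by rewrite normrM -[leRHS]mul1r ler_pM// -(_ : enorm p = 1) ?norm_coord_le.
rewrite normrM -[leRHS]mulr1 ler_pM//; last by case: (k < uz p); rewrite ?normr1 ?normr0.
have t c d v M : 0 < d -> `|c| <= b -> `|v| <= M -> `|c / d * v| <= d^-1 * M * b.
  move=> d0 cb vM; rewrite !normrM normfV (gtr0_norm d0) -mulrA [leRHS]mulrC.
  apply: ler_pM => //; last by rewrite ler_pM2l// invr_gt0.
  by rewrite mulr_ge0// invr_ge0 ltW.
have tri (u v s r : R) : `|u| <= s * b -> `|v| <= r * b -> `|u + v| <= (s + r) * b.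
  by move=> us vr; rewrite (le_trans (ler_normD _ _))// mulrDl lerD.
do 4?apply: (tri _ _ _ _); apply: (t _ _ _ _) => //; rewrite ?pos//.
- rewrite normrM (gtr0_norm (_ : 0 < 2^-1)) ?invr_gt0// ler_pdivrMr//.
  apply: (le_trans (ler_normB _ _)).
  by have := Bb 0 0; have := Bb 1 1; lra.
- apply: (le_trans (ler_normB _ _)).
  by have := q 0 0; have := q 1 1; lra.
- apply: (le_trans (ler_normB _ _)).
  by have := q 2%:R 2%:R; lra.
Qed.

End moment_corrector.

(** * The energy near a prolate matrix *)

Lemma measurable_lne_EFin (R : realType) :
  measurable_fun setT (fun x : R => lne x%:E).
Proof.
have -> : (fun x : R => lne x%:E) = fun x => if 0 < x then (ln x)%:E else -oo%E.
  apply/funext => x; case: ifPn => x0; first by rewrite lne_EFin.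
  by rewrite le0_lneNy// lee_fin leNgt.
apply: measurable_fun_if => //; first exact: measurable_fun_ltr.
by apply/measurable_EFinP; apply: measurable_funS (@measurable_ln R).
Qed.

(** The energy density may take the value [+oo] and have an infinite integral, so positive and
    negative parts are compared separately. *)
Lemma ae_le_integral d (T : measurableType d) (R : realType)
    (mu : {measure set T -> \bar R}) (D : set T) (F G : T -> \bar R) :
  measurable D -> measurable_fun D F -> measurable_fun D G ->
  {ae mu, forall x, D x -> (F x <= G x)%E} ->
  (\int[mu]_(x in D) F x <= \int[mu]_(x in D) G x)%E.
Proof.
move=> mD mF mG [N [mN N0 FG]].
rewrite integralE [leRHS]integralE leeB//; apply: ae_ge0_le_integral => //.
- exact: measurable_funepos.
- exact: measurable_funepos.
- exists N; split => // x /= h; apply: FG => /= h'; apply: h => Dx.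
  by rewrite !funeposE; apply: le_max2 => //; exact: h'.
- exact: measurable_funeneg.
- exact: measurable_funeneg.
- exists N; split => // x /= h; apply: FG => /= h'; apply: h => Dx.
  by rewrite !funenegE; apply: le_max2 => //; rewrite leeN2; exact: h'.
Qed.

Section quadratic_forms.
Context {R : realType}.
Implicit Types (P D : 'M[R]_3) (p : 'cV[R]_3).

Lemma quad_sum P p : quad P p = \sum_i \sum_j P i j * (p i 0 * p j 0).
Proof.
rewrite /quad mxE exchange_big; apply: eq_bigr => j _ /=.
rewrite mxE mulr_suml; apply: eq_bigr => i _; rewrite mxE.
by rewrite mulrA (mulrC (p i 0)).
Qed.

Lemma quadD P D p : quad (P + D) p = quad P p + quad D p.
Proof. by rewrite /quad mulmxDr mulmxDl mxE. Qed.

Lemma bmeas_quad P : bmeas (quad P).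
Proof.
rewrite (_ : quad P = fun p => \sum_i \sum_j P i j * (p i 0 * p j 0)); last first.
  by apply/funext => p; rewrite quad_sum.
have -> : (fun p => \sum_i \sum_j P i j * (p i 0 * p j 0)) = fun p =>
    \sum_j P 0 j * (p 0 0 * p j 0) + \sum_j P 1 j * (p 1 0 * p j 0) +
    \sum_j P 2%:R j * (p 2%:R 0 * p j 0).
  by apply/funext => p; rewrite sum_ord3.
have b i : bmeas (fun p => \sum_j P i j * (p i 0 * p j 0)).
  have -> : (fun p => \sum_j P i j * (p i 0 * p j 0)) = fun p =>
    P i 0 * (p i 0 * p 0 0) + P i 1 * (p i 0 * p 1 0) + P i 2%:R * (p i 0 * p 2%:R 0).
    by apply/funext => p; rewrite sum_ord3.
  have q j := bmeasZ (P i j) (bmeas_quadratic i j).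
  exact: (bmeasD (bmeasD (q _) (q _)) (q _)).
exact: (bmeasD (bmeasD (b _) (b _)) (b _)).
Qed.

Lemma norm_coord_le1 p i : sphere R p -> `|p i 0| <= 1.
Proof. by move=> Sp; rewrite -(_ : enorm p = 1)// norm_coord_le. Qed.

Lemma norm_quad_le D p : sphere R p -> `|quad D p| <= 9 * `|D|.
Proof.
move=> Sp; rewrite quad_sum !sum_ord3.
have h i j : `|D i j * (p i 0 * p j 0)| <= `|D|.
  rewrite normrM -[leRHS]mulr1 ler_pM ?norm_entry_le//.
  by rewrite normrM -[leRHS]mulr1 ler_pM ?norm_coord_le1.
have t (a b c e : R) : `|a| <= e -> `|b| <= e -> `|c| <= e -> `|a + b + c| <= 3 * e.
  by rewrite !ler_norml => /andP[? ?] /andP[? ?] /andP[? ?]; apply/andP; split; lra.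
have -> : 9 * `|D| = 3 * (3 * `|D|) by lra.
by apply: (t _ _ _ _); apply: (t _ _ _ _); exact: h.
Qed.

End quadratic_forms.

Section gibbs.
Context {R : realType}.
Local Notation S := (sphere R : set (space3 R)).
Variables (l eta : R).
Implicit Types (P : Sym0 R) (p : 'cV[R]_3) (f : 'cV[R]_3 -> R).

Definition wt (P : 'M[R]_3) p : R := Num.max (quad P p - eta) 0.

Definition gibbs (P : 'M[R]_3) p : R := wt P p * expR (l * uz p).

Definition partition_fun (P : 'M[R]_3) : R := sint (gibbs P).

(* The dual bound for the fixed multiplier [l (e3 (x) e3 - I / 3)]. *)
Definition dual_value (P : 'M[R]_3) : R := l * P 2%:R 2%:R - ln (partition_fun P).

Lemma bmeas_wt (P : 'M[R]_3) : bmeas (wt P).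
Proof.
by apply: bmeas_max; [apply: bmeasB; [exact: bmeas_quad|]|]; exact: bmeas_cst.
Qed.

Lemma bmeas_gibbs (P : 'M[R]_3) : bmeas (gibbs P).
Proof. exact: (bmeasM (bmeas_wt P) (bmeas_expuz l)). Qed.

Lemma wt_ge0 (P : 'M[R]_3) p : 0 <= wt P p.
Proof. by rewrite le_max lexx orbT. Qed.

Lemma gibbs_ge0 (P : 'M[R]_3) p : 0 <= gibbs P p.
Proof. by rewrite mulr_ge0 ?wt_ge0 ?expR_ge0. Qed.

Definition energy_density (P : 'M[R]_3) f p : \bar R :=
  ((f p * ln (f p))%:E - (f p)%:E * lne (quad P p - eta)%:E)%E.

Lemma measurable_energy_density (P : 'M[R]_3) f :
  measurable_fun S (f : space3 R -> R) ->
  measurable_fun S (energy_density P f : space3 R -> \bar R).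
Proof.
move=> mf; apply: emeasurable_funB.
  apply/measurable_EFinP.
  exact: (measurable_funM mf (measurableT_comp (@measurable_ln R) mf)).
apply: emeasurable_funM; first exact/measurable_EFinP.
have [mq _] := bmeasB (bmeas_quad P) (bmeas_cst eta).
exact: (measurableT_comp (@measurable_lne_EFin R) mq).
Qed.

Lemma ln_le_sub1 (x : R) : 0 < x -> ln x <= x - 1.
Proof.
by move=> x0; have := expR_ge1Dx (ln x); rewrite lnK ?posrE//; lra.
Qed.

(** Pointwise Gibbs inequality: [ln y <= y - 1] at the quotient of the normalised Gibbs density by
    [f p]. Where the weight vanishes and [f p > 0], the right-hand side is [+oo]. *)
Lemma energy_density_ge (P : 'M[R]_3) f p : 0 < partition_fun P -> 0 <= f p ->
  (((l * uz p - ln (partition_fun P) + 1) * f p -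
     gibbs P p / partition_fun P)%:E <= energy_density P f p)%E.
Proof.
move=> Z0; set Z := partition_fun P; rewrite le_eqVlt => /orP[/eqP fp0|f0].
  rewrite /energy_density -fp0 mul0r mul0e sube0 mulr0 sub0r lee_fin.
  by rewrite oppr_le0 divr_ge0 ?gibbs_ge0// ltW.
rewrite /energy_density /gibbs /wt; have [w0|w0] := leP (quad P p - eta) 0.
  rewrite le0_lneNy ?lee_fin//.
  by rewrite gt0_muleNy ?lte_fin// leey.
rewrite lne_EFin// -EFinM -EFinB lee_fin.
set w := quad P p - eta in w0 *.
have g0 : 0 < w * expR (l * uz p) / Z / f p by rewrite !divr_gt0// mulr_gt0 ?expR_gt0.
have := ln_le_sub1 g0.
rewrite ln_div ?posrE ?divr_gt0 ?mulr_gt0 ?expR_gt0//.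
rewrite ln_div ?posrE ?mulr_gt0 ?expR_gt0// lnM ?posrE ?expR_gt0// expRK => h.
have : f p * (ln w + l * uz p - ln Z - ln (f p)) <=
    f p * (w * expR (l * uz p) / Z / f p - 1) by rewrite ler_pM2l.
have -> : f p * (w * expR (l * uz p) / Z / f p - 1) = w * expR (l * uz p) / Z - f p.
  by rewrite mulrBr mulr1 mulrCA mulfV ?mulr1// gt_eqF.
move: (w * expR (l * uz p) / Z) (ln w) (ln Z) (ln (f p)) (uz p) (f p).
by move=> a b c d e x; lra.
Qed.

Lemma densities_measurable f : densities R f ->
  measurable_fun S (f : space3 R -> R).
Proof. by move=> [/integrableP[mf _] _ _]; apply/measurable_EFinP. Qed.

Lemma bmeas_mul_integrable F f : bmeas F ->
  (H2 R).-integrable S (EFin \o f) ->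
  (H2 R).-integrable S (EFin \o (fun p => F p * f p)).
Proof.
move=> [mF [C FC]] fi.
have mf : measurable_fun S (f : space3 R -> R).
  by apply/measurable_EFinP; case/integrableP: fi.
apply: (@le_integrable _ _ _ (H2 R) S measurable_sphere _ (EFin \o (fun p => C * f p))).
- by apply/measurable_EFinP; exact: (measurable_funM mF mf).
- move=> p Sp /=; rewrite lee_fin !normrM ler_wpM2r// (le_trans (FC p Sp))//.
  exact: ler_norm.
- exact: (integrableZl measurable_sphere C fi).
Qed.

Lemma admissible_uz P f : admissible P f ->
  \int[H2 R]_(p in sphere R) (uz p * f p) = (P : 'M[R]_3) 2%:R 2%:R.
Proof.
move=> [_ <-]; rewrite mxE; apply: eq_Rintegral => p _.
by rewrite /uz !mxE big_ord1 !mxE /= expr2.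
Qed.

Lemma admissible_fin P f : admissible P f -> \int[H2 R]_(p in sphere R) f p = 1.
Proof. by move=> [[_ _ f1] _]; rewrite /Rintegral f1. Qed.

(** The integral of the pointwise bound depends on [f] only through its mass and its moment against
    [uz], which admissibility fixes; the two unit masses cancel. *)
Lemma dual_value_le_energy P f : 0 < partition_fun P -> admissible P f ->
  ((dual_value P)%:E <= energy P eta f)%E.
Proof.
move=> Z0 Pf; have [[fi f0 f1] _] := Pf.
have mf := densities_measurable Pf.1.
pose Z := partition_fun P.
pose k p := (l * uz p - ln Z + 1) * f p - gibbs P p / Z.
have bu : bmeas (fun p => l * uz p - ln Z + 1).
  by apply: bmeasD; [apply: bmeasB; [apply: bmeasZ; exact: bmeas_uz|]|]; exact: bmeas_cst.
have bg : bmeas (fun p => gibbs P p / Z) by exact: (bmeasM (bmeas_gibbs P) (bmeas_cst _)).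
have i1 := bmeas_mul_integrable bu fi.
have ki : (H2 R).-integrable S (EFin \o k).
  exact: (integrableB measurable_sphere i1 (bmeas_integrable bg)).
have -> : (dual_value P)%:E = (\int[H2 R]_(p in sphere R) (k p)%:E)%E.
  rewrite -[RHS]fineK; last exact: (integrable_fin_num measurable_sphere ki).
  congr EFin; rewrite -[RHS]/(\int[H2 R]_(p in sphere R) k p) /k.
  rewrite (RintegralB measurable_sphere i1 (bmeas_integrable bg)).
  have -> : \int[H2 R]_(p in sphere R) (gibbs P p / Z) = 1.
    rewrite -/(sint _) (eq_sint (G := fun p => Z^-1 * gibbs P p)); last first.
      by move=> p _; rewrite mulrC.
    by rewrite (sintZ _ (bmeas_gibbs P)) mulVf// gt_eqF.
  have -> : \int[H2 R]_(p in sphere R) ((l * uz p - ln Z + 1) * f p) =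
      \int[H2 R]_(p in sphere R) (l * (uz p * f p) + (1 - ln Z) * f p).
    by apply: eq_Rintegral => p _; lra.
  have i2 := bmeas_mul_integrable (@bmeas_uz R) fi.
  rewrite RintegralD//; [|exact: measurable_sphere
    |exact: (integrableZl measurable_sphere l i2)
    |exact: (integrableZl measurable_sphere (1 - ln Z) fi)].
  rewrite (RintegralZl _ measurable_sphere i2).
  rewrite (RintegralZl _ measurable_sphere fi).
  by rewrite (admissible_uz Pf) (admissible_fin Pf) /dual_value -/Z; lra.
apply: ae_le_integral; first exact: measurable_sphere.
- by case/integrableP: ki.
- exact: measurable_energy_density.
- case: f0 => N [mN N0 fN]; exists N; split => // p /= h; apply: fN => /= h'.
  by apply: h => Sp; apply: energy_density_ge => //; exact: h'.
Qed.

End gibbs.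

Section uniaxial_matrix.
Context {R : realType}.
Implicit Types (s : R) (p : 'cV[R]_3).

Definition e3 : 'cV[R]_3 := delta_mx 2%:R 0.

Definition uniaxial_mx s : 'M[R]_3 := s *: (outer_square e3 - 3^-1%:M).

Lemma uniaxial_mxE s i j : uniaxial_mx s i j =
  s * (((i == 2%:R) && (j == 2%:R))%:R - 3^-1 * (i == j)%:R).
Proof.
rewrite !mxE big_ord1 !mxE !eqxx !andbT; congr (_ * (_ - _)).
  by case: (i == _); case: (j == _); rewrite ?mulr1 ?mulr0 ?mul0r.
by case: (i == j); rewrite ?mulr1 ?mulr0 ?mulr1n ?mulr0n.
Qed.

Lemma uniaxial_sym0 s : uniaxial_mx s \in @sym0 R.
Proof.
rewrite unfold_in; apply/andP; split; apply/eqP.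
  by apply/matrixP => i j; rewrite mxE !uniaxial_mxE andbC (eq_sym i j).
rewrite /mxtrace sum_ord3 !uniaxial_mxE /=; lra.
Qed.

Definition uniaxial s : Sym0 R := MkSym0 (uniaxial_sym0 s).

Lemma sphere_e3 : sphere R e3.
Proof. by rewrite sphereE /= !mxE /= !expr0n /= expr1n !add0r. Qed.

Lemma quad_uniaxial s p : sphere R p -> quad (uniaxial_mx s) p = s * uz p.
Proof.
move=> /sphere_mul; rewrite quad_sum !sum_ord3 !uniaxial_mxE /= /uz expr2.
move: (p 0 0) (p 1 0) (p 2%:R 0) => a b c abc.
have -> : s * (c * c - 3^-1) = s * (c * c - 3^-1 * (a * a + b * b + c * c)).
  by rewrite abc mulr1.
lra.
Qed.

Lemma uniaxial_eigenvalue s a : eigenvalue (uniaxial_mx s) a ->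
  a = 2 / 3 * s \/ a = - (s / 3).
Proof.
case/eigenvalueP => v va v0.
have [j vj] : exists j, v 0 j != 0.
  apply/existsP; apply: contraNT v0 => /existsPn h.
  by apply/eqP/rowP => j; rewrite mxE; apply/eqP; have := h j; rewrite negbK.
have : (v *m uniaxial_mx s) 0 j = (a *: v) 0 j by rewrite va.
rewrite mxE [RHS]mxE (bigD1 j)//= big1 ?addr0; last first.
  move=> i ij; rewrite uniaxial_mxE (negbTE ij) mulr0 subr0.
  case: eqP => [i2|]; case: eqP => [j2|]; rewrite ?mulr0//=.
  by move: ij; rewrite i2 j2 eqxx.
rewrite mulrC => /(mulIf vj) <-; rewrite uniaxial_mxE eqxx mulr1.
by case: (j == 2%:R) => /=; [left|right]; lra.
Qed.

Lemma uniaxial_Qset s : 0 < s < 1 -> Qset R (uniaxial s).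
Proof.
move=> /andP[s0 s1]; rewrite /Qset /=.
apply: (@lt_le_trans _ _ (- (s / 3))); first by lra.
apply: lb_le_inf.
  exists (2 / 3 * s); apply/eigenvalueP; exists (delta_mx 0 2%:R); last first.
    apply/eqP => /matrixP/(_ 0 2%:R); rewrite !mxE !eqxx /= => /eqP.
    by rewrite oner_eq0.
  rewrite -rowE; apply/rowP => j; rewrite [LHS]mxE uniaxial_mxE !mxE /=.
  rewrite [2%:R == _]eq_sym.
  by case: (j == 2%:R) => /=; lra.
by move=> a /uniaxial_eigenvalue[] ->; lra.
Qed.

Lemma uniaxial_prolate s : 0 < s < 1 -> prolate_uniaxial (uniaxial s).
Proof. by move=> s01; exists e3, s; split => //; exact: sphere_e3. Qed.

End uniaxial_matrix.

Lemma scale_shift_entry (R : realType) (z : R) (P : 'M[R]_3) i j :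
  (z *: (P + 3^-1%:M)) i j = z * (P i j + 3^-1 * (i == j)%:R).
Proof. by rewrite !mxE mulr_natr. Qed.

(** * Quadratic upper bound for J by corrected Gibbs densities *)

Section expansion.
Context {R : realType}.
Variables (s l eta : R).
Hypothesis s01 : 0 < s < 1.
Hypothesis eta0 : 0 <= eta.
Hypothesis etas : eta < 2 / 3 * s.
Implicit Types (P D : 'M[R]_3) (p : 'cV[R]_3) (i j : 'I_3).

Local Notation Q0 := (uniaxial_mx s).
Local Notation E p := (expR (l * uz p)).
Local Notation w p := (Num.max (s * uz p - eta) 0).
Local Notation Z := (partition_fun l eta).
Local Notation g := (gibbs l eta).

Hypothesis E1 : sint (fun p => uz p * (w p * E p)) =
  2 / 3 * s * sint (fun p => w p * E p).
Hypothesis E2 : 2 / 3 * l * sint (fun p => w p * E p) =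
  sint (fun p => uz p * ((eta < s * uz p)%R%:R * E p)).

Let s0 : 0 < s. Proof. by case/andP: s01. Qed.
Let s1 : s < 1. Proof. by case/andP: s01. Qed.

Lemma gibbs_uniaxial p : sphere R p -> g Q0 p = w p * E p.
Proof. by move=> Sp; rewrite /gibbs /wt quad_uniaxial. Qed.

Lemma partition_fun_uniaxial : Z Q0 = sint (fun p => w p * E p).
Proof. by apply: eq_sint => p Sp; rewrite gibbs_uniaxial. Qed.

Let bw : bmeas (fun p => w p).
Proof.
apply: bmeas_max; last exact: bmeas_cst.
by apply: bmeasB; [apply: bmeasZ; exact: bmeas_uz|exact: bmeas_cst].
Qed.

Let bE : bmeas (fun p => E p). Proof. exact: bmeas_expuz. Qed.

Let bwE : bmeas (fun p => w p * E p). Proof. exact: (bmeasM bw bE). Qed.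

Lemma partition_fun_uniaxial_gt0 : 0 < Z Q0.
Proof.
rewrite partition_fun_uniaxial; apply: sint_gt0 => //.
  by move=> p Sp; rewrite mulr_ge0 ?expR_ge0// le_max lexx orbT.
have h : eta / s < 2 / 3 by rewrite ltr_pdivrMr.
apply: lt_le_trans (hausdorff2_uz_gt_gt0 h) _; apply: le_hausdorff2 => p [Sp /=].
rewrite ltr_pdivrMr// => tp; split => //=.
by rewrite mulr_gt0 ?expR_gt0// lt_max; apply/orP; left; lra.
Qed.

Let Z0_gt0 : 0 < Z Q0 := partition_fun_uniaxial_gt0.

Definition moment_mx P : 'M[R]_3 :=
  \matrix_(i, j) sint (fun p => p i 0 * p j 0 * g P p).

Let bmom P i j : bmeas (fun p => p i 0 * p j 0 * g P p).
Proof. exact: (bmeasM (bmeas_quadratic i j) (bmeas_gibbs l eta P)). Qed.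

Lemma moment_mx_sym P : (moment_mx P)^T = moment_mx P.
Proof.
by apply/matrixP => i j; rewrite !mxE; apply: eq_sint => p _; rewrite (mulrC (p j 0)).
Qed.

Lemma trace_moment_mx P : \tr (moment_mx P) = Z P.
Proof.
rewrite /mxtrace sum_ord3 !mxE.
exact: (sint_quadratic_trace (bmeas_gibbs l eta P)).
Qed.

Let polar_wE : polar (fun p => w p * E p).
Proof. exact: (@polar_uz _ (fun u => Num.max (s * u - eta) 0 * expR (l * u)) bwE). Qed.

(** [E1] gives the last diagonal entry; the axial symmetries and the trace determine the others. *)
Lemma moment_mx_uniaxial : moment_mx Q0 = Z Q0 *: (Q0 + 3^-1%:M).
Proof.
have mE i j : moment_mx Q0 i j = sint (fun p => p i 0 * p j 0 * (w p * E p)).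
  by rewrite mxE; apply: eq_sint => p Sp; rewrite gibbs_uniaxial.
have b i := bmeasM (bmeas_quadratic i i) bwE.
have m22 : moment_mx Q0 2%:R 2%:R = (2 / 3 * s + 3^-1) * Z Q0.
  rewrite mE mulrDl partition_fun_uniaxial -E1 -(sintZ _ bwE).
  rewrite -(sintD (bmeasM (@bmeas_uz R) bwE) (bmeasZ _ bwE)).
  by apply: eq_sint => p _; rewrite -mulrDl /uz subrK expr2.
have tr := trace_moment_mx Q0; rewrite /mxtrace sum_ord3 m22 in tr.
have m01 : moment_mx Q0 0 0 = moment_mx Q0 1 1.
  by rewrite !mE; exact: sint_polar_xx_yy polar_wE.
apply/matrixP => i j.
rewrite scale_shift_entry uniaxial_mxE.
have [<-|ij] := eqVneq i j; last first.
  rewrite mE (sint_polar_offdiag polar_wE ij).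
  rewrite (_ : (i == 2%:R) && (j == 2%:R) = false) ?mulr0 ?subr0 ?addr0 ?mulr0//.
  by apply/negP => /andP[/eqP i2 /eqP j2]; move: ij; rewrite i2 j2 eqxx.
by elim/ord3_ind: i => /=; move: m22 tr m01; move: (moment_mx Q0) (Z Q0) => m z;
  move=> m22 tr m01; rewrite ?m22; lra.
Qed.

Let Emax := expR `|l|.

Lemma expR_uz_le p : sphere R p -> E p <= expR `|l|.
Proof.
move=> Sp; rewrite ler_expR (le_trans (ler_norm _))// normrM -[leRHS]mulr1.
by rewrite ler_wpM2l// norm_uz_le1.
Qed.

Let E_ge p : sphere R p -> expR (- `|l|) <= E p.
Proof.
move=> Sp; rewrite ler_expR lerNl (le_trans (ler_norm _))// normrN normrM.
by rewrite -[leRHS]mulr1 ler_wpM2l// norm_uz_le1.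
Qed.

Let max0_lip (a b : R) : `|Num.max a 0 - Num.max b 0| <= `|a - b|.
Proof.
case: (leP a 0) => a0; case: (leP b 0) => b0; rewrite ?subrr ?normr0//.
- by rewrite sub0r normrN gtr0_norm// ltr0_norm; lra.
- by rewrite subr0 gtr0_norm// gtr0_norm; lra.
Qed.

Let c := 9 * Emax * sarea.

Let c_ge0 : 0 <= c.
Proof. by rewrite !mulr_ge0 ?sarea_ge0 ?expR_ge0. Qed.

Let gibbs_lip D p : sphere R p -> `|g (Q0 + D) p - g Q0 p| <= 9 * Emax * `|D|.
Proof.
move=> Sp; rewrite /gibbs -mulrBl normrM mulrAC.
rewrite ler_pM//; last by rewrite ger0_norm ?expR_ge0// expR_uz_le.
apply: le_trans (max0_lip _ _) _; rewrite quadD.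
have -> : quad Q0 p + quad D p - eta - (quad Q0 p - eta) = quad D p by lra.
exact: norm_quad_le.
Qed.

Let Z_lip D : `|Z (Q0 + D) - Z Q0| <= c * `|D|.
Proof.
rewrite -(sintB (bmeas_gibbs l eta (Q0 + D)) (bmeas_gibbs l eta Q0)) /c mulrAC.
apply: sint_norm_le; last exact: gibbs_lip.
exact: (bmeasB (bmeas_gibbs l eta (Q0 + D)) (bmeas_gibbs l eta Q0)).
Qed.

Let moment_lip D i j : `|moment_mx (Q0 + D) i j - moment_mx Q0 i j| <= c * `|D|.
Proof.
rewrite !mxE -(sintB (bmom (Q0 + D) i j) (bmom Q0 i j)) /c mulrAC.
apply: sint_norm_le; first exact: (bmeasB (bmom (Q0 + D) i j) (bmom Q0 i j)).
move=> p Sp; rewrite -mulrBr normrM -[leRHS]mul1r ler_pM//; last exact: gibbs_lip.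
by rewrite normrM -[leRHS]mulr1 ler_pM ?norm_coord_le1.
Qed.

Lemma partition_fun_near : exists2 d, 0 < d & forall D, `|D| <= d ->
  Z Q0 / 2 <= Z (Q0 + D).
Proof.
exists (Z Q0 / 2 / (c + 1)); first by rewrite !divr_gt0// ltr_pwDr.
move=> D; rewrite ler_pdivlMr ?ltr_pwDr// => h.
have := Z_lip D; rewrite ler_norml => /andP[h1 _].
have := normr_ge0 D; move: h h1; move: (`|D|) (Z Q0) (Z _) (c) => d z z' k.
by move=> *; lra.
Qed.

(** The moments that the unnormalised Gibbs density lacks for [P]; it vanishes at [Q0] by
    [moment_mx_uniaxial] and is therefore O(|D|) nearby. *)
Definition moment_defect P : 'M[R]_3 := Z P *: (P + 3^-1%:M) - moment_mx P.

(** The variation of [Z] multiplies an entry bounded by 3, which gives [3 c]; the moments add [c],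
    and the change of the matrix itself adds [Z Q0]. *)
Let K := 4 * c + Z Q0.

Let moment_defect_le D i j : `|D| <= 1 ->
  `|moment_defect (Q0 + D) i j| <= K * `|D|.
Proof.
move=> D1.
have Q1 : `|Q0 i j| <= 1.
  rewrite uniaxial_mxE normrM -[leRHS]mulr1 ler_pM// ?(gtr0_norm s0) ?(ltW s1)//.
  by case: (_ && _); case: (i == j) => /=; rewrite ler_norml; apply/andP; split; lra.
have e : moment_mx Q0 i j = Z Q0 * (Q0 i j + 3^-1 * (i == j)%:R).
  by rewrite moment_mx_uniaxial scale_shift_entry.
have -> : moment_defect (Q0 + D) i j =
    (Z (Q0 + D) - Z Q0) * (Q0 i j + D i j + 3^-1 * (i == j)%:R) + Z Q0 * D i j -
    (moment_mx (Q0 + D) i j - moment_mx Q0 i j).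
  rewrite e; have -> : moment_defect (Q0 + D) i j = Z (Q0 + D) *
      (Q0 i j + D i j + 3^-1 * (i == j)%:R) - moment_mx (Q0 + D) i j.
    rewrite /moment_defect [LHS]mxE scale_shift_entry [X in _ + X]mxE.
    by rewrite [X in _ * (X + _)]mxE.
  move: (Z (Q0 + D)) (Z Q0) (moment_mx (Q0 + D) i j) (Q0 i j) (D i j) (3^-1 * _).
  by move=> *; lra.
have d := norm_entry_le D i j.
have h1 := Z_lip D; have h2 := moment_lip D i j.
apply: (le_trans (ler_normB _ _)).
have -> : K * `|D| = (c * `|D|) * 3 + Z Q0 * `|D| + c * `|D|.
  by rewrite /K; move: (c) (`|D|) (Z Q0) => *; lra.
apply: lerD => //; apply: (le_trans (ler_normD _ _)); apply: lerD.
  rewrite normrM ler_pM//.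
  have n3 : `|3^-1 * (i == j)%:R| <= 1 :> R.
    by case: (i == j) => /=; rewrite ler_norml; apply/andP; split; lra.
  have d1 := le_trans d D1; move: d1 Q1 n3.
  move: (Q0 i j) (D i j) (3^-1 * _) => a b e'; rewrite !ler_norml.
  by move=> /andP[? ?] /andP[? ?] /andP[? ?]; apply/andP; split; lra.
by rewrite normrM (gtr0_norm Z0_gt0) ler_wpM2l// ltW.
Qed.

(** The midpoint between the edge [eta / s] of the support and the pole: on the cap [k < uz p] the
    weight stays bounded below under small perturbations of [Q0]. *)
Let k := (eta / s + 2 / 3) / 2.

Let etas' : eta / s < 2 / 3. Proof. by rewrite ltr_pdivrMr. Qed.

Let k0 : 0 <= k.
Proof. by move: (divr_ge0 eta0 (ltW s0)); rewrite /k; move: (eta / s) => *; lra. Qed.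

Let k1 : k < 2 / 3.
Proof. by move: etas'; rewrite /k; move: (eta / s) => *; lra. Qed.

Let c1 := s * k - eta.

Let c1_gt0 : 0 < c1.
Proof.
rewrite /c1 subr_gt0 mulrC -ltr_pdivrMr//.
by move: etas'; rewrite /k; move: (eta / s) => *; lra.
Qed.

Let cg := c1 / 2 * expR (- `|l|).

Let cg_gt0 : 0 < cg. Proof. by rewrite mulr_gt0 ?expR_gt0// divr_gt0. Qed.

Let gibbs_cap D p : sphere R p -> 9 * `|D| <= c1 / 2 -> k < uz p ->
  cg <= g (Q0 + D) p.
Proof.
move=> Sp Dc kp; rewrite /cg /gibbs ler_pM ?E_ge ?expR_ge0//.
  by rewrite divr_ge0// ltW.
rewrite /wt le_max quadD quad_uniaxial//; apply/orP; left.
have := norm_quad_le D Sp; rewrite ler_norml => /andP[h _].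
have : s * k < s * uz p by rewrite ltr_pM2l.
by move: Dc h; rewrite /c1; move: (s * k) (s * uz p) (`|D|) (quad D p) => *; lra.
Qed.

Let h P := corrector k (moment_defect P).

Let bh P : bmeas (h P). Proof. exact: bmeas_corrector. Qed.

(* The Gibbs density of [P], corrected so as to be admissible for [P]. Its entropy
   relative to the Gibbs density is quadratic in the moment defect, so no optimal
   multiplier (hence no implicit function theorem) is needed for [P <> Q0]. *)
Definition competitor P p : R := (g P p + h P p) / Z P.

Let bcomp P : bmeas (competitor P).
Proof.
by apply: bmeasM; [exact: (bmeasD (bmeas_gibbs l eta P) (bh P))|exact: bmeas_cst].
Qed.

Let defect_sym (P : Sym0 R) : (moment_defect P)^T = moment_defect P.
Proof.
have /andP[/eqP Pt _] := valP P.
by rewrite /moment_defect linearB /= linearZ /= linearD /= tr_scalar_mx Pt moment_mx_sym.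
Qed.

Let defect_tr (P : Sym0 R) : \tr (moment_defect P) = 0.
Proof.
have /andP[_ /eqP Pt] := valP P.
rewrite /moment_defect linearB /= linearZ /= linearD /= mxtrace_scalar Pt trace_moment_mx.
have -> : 3^-1 *+ 3 = 1 :> R by rewrite -[LHS]mulr_natl mulfV.
by rewrite add0r mulr1 subrr.
Qed.

Let moment_competitor (P : Sym0 R) i j : 0 < Z P ->
  sint (fun p => p i 0 * p j 0 * competitor P p) =
    (P : 'M[R]_3) i j + 3^-1 * (i == j)%:R.
Proof.
move=> ZP; have bij := @bmeas_quadratic R i j.
have b1 := bmeasM bij (bmeas_gibbs l eta P); have b2 := bmeasM bij (bh P).
rewrite (eq_sint (G := fun p => (Z P)^-1 *
  (p i 0 * p j 0 * g P p + p i 0 * p j 0 * h P p))); last first.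
  by move=> p _; rewrite /competitor; move: (_^-1) (g P p) (h P p) => *; lra.
rewrite (sintZ _ (bmeasD b1 b2)) (sintD b1 b2).
rewrite (corrector_moment k0 k1 i j (defect_sym P) (defect_tr P)).
have -> : moment_defect P i j =
    Z P * ((P : 'M[R]_3) i j + 3^-1 * (i == j)%:R) - moment_mx P i j.
  by rewrite /moment_defect [LHS]mxE scale_shift_entry [X in _ + X]mxE.
rewrite [moment_mx P i j]mxE addrC subrK mulrA mulVf ?mul1r//.
by rewrite gt_eqF.
Qed.

Let mass_competitor (P : Sym0 R) : 0 < Z P -> sint (competitor P) = 1.
Proof.
move=> ZP; rewrite -(sint_quadratic_trace (bcomp P)) !moment_competitor//=.
have /andP[_ /eqP Pt] := valP P; move: Pt; rewrite /mxtrace sum_ord3.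
by move: ((P : 'M[R]_3) 0 0) ((P : 'M[R]_3) 1 1) ((P : 'M[R]_3) 2%:R 2%:R) => *; lra.
Qed.

(** The mass is the trace of the second moments, that is, of the traceless defect. It removes the
    first-order term from the energy of the competitor. *)
Let mass_h (P : Sym0 R) : sint (h P) = 0.
Proof.
rewrite -(sint_quadratic_trace (bh P)).
rewrite !(corrector_moment k0 k1 _ _ (defect_sym P) (defect_tr P)).
by have := defect_tr P; rewrite /mxtrace sum_ord3.
Qed.

Lemma competitor_admissible (P : Sym0 R) : 0 < Z P ->
  (forall p, sphere R p -> 0 <= competitor P p) -> admissible P (competitor P).
Proof.
move=> ZP f0; split; first split.
- exact: bmeas_integrable (bcomp P).
- by exists set0; split; [exact: measurable0|exact: hausdorff2_0|
    move=> p /= H; exfalso; apply: H => Sp; exact: f0].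
- by rewrite (integral_sint (bcomp P)) mass_competitor.
apply/matrixP => i j; rewrite mxE.
have b1 := bmeasM (@bmeas_quadratic R i j) (bcomp P).
have b2 := bmeasZ (3^-1 * (i == j)%:R) (bcomp P).
transitivity (sint (fun p => p i 0 * p j 0 * competitor P p -
    3^-1 * (i == j)%:R * competitor P p)).
  apply: eq_sint => p _; rewrite -mulrBl; congr (_ * _).
  by rewrite !mxE big_ord1 !mxE mulr_natr.
rewrite (sintB b1 b2) (sintZ _ (bcomp P)) moment_competitor// mass_competitor//.
by rewrite mulr1 addrK.
Qed.

(** From [ln (1 + h / g) <= h / g], the correction costs at most [(g + h) / Z * (h / g) = (h + h ^ 2
    / g) / Z], and [h ^ 2 / g <= q] since [g >= cg] wherever [h] is nonzero. *)
Let energy_density_competitor (P : 'M[R]_3) q p : 0 < Z P -> sphere R p -> 0 <= q ->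
  (quad P p - eta <= 0 -> h P p = 0) ->
  (h P p != 0 -> [/\ cg <= g P p, `|h P p| <= g P p / 2 & h P p ^+ 2 <= q * cg]) ->
  (energy_density eta P (competitor P) p <=
    ((l * uz p - ln (Z P)) * competitor P p + (h P p + q) / Z P)%:E)%E.
Proof.
move=> ZP Sp q0 hout hcap; rewrite /energy_density.
have [w0|w0] := leP (quad P p - eta) 0.
  have g0 : g P p = 0 by rewrite /gibbs /wt max_r// mul0r.
  have f0 : competitor P p = 0 by rewrite /competitor g0 hout// addr0 mul0r.
  rewrite f0 mul0r mul0e sube0 lee_fin mulr0 add0r hout// add0r.
  by rewrite divr_ge0// ltW.
have gE : g P p = (quad P p - eta) * E p by rewrite /gibbs /wt max_l// ltW.
have g0 : 0 < g P p by rewrite gE mulr_gt0 ?expR_gt0.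
rewrite lne_EFin// -EFinM -EFinB lee_fin.
have gh0 : 0 < g P p + h P p.
  have [->|hn] := eqVneq (h P p) 0; first by rewrite addr0.
  have [_ + _] := hcap hn; rewrite ler_norml => /andP[h1 _].
  by move: g0 h1; move: (g P p) (h P p) => *; lra.
have lnf : ln (competitor P p) <= ln (quad P p - eta) + l * uz p - ln (Z P) + h P p / g P p.
  rewrite /competitor ln_div ?posrE//.
  set r := (g P p + h P p) / g P p.
  have r0 : 0 < r by rewrite divr_gt0.
  have rE : r = 1 + h P p / g P p by rewrite /r mulrDl mulfV// gt_eqF.
  have -> : g P p + h P p = g P p * r by rewrite /r mulrCA mulfV ?mulr1// gt_eqF.
  rewrite lnM ?posrE// {1}gE lnM ?posrE ?expR_gt0// expRK.
  have := ln_le_sub1 r0; rewrite {2}rE.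
  by move: (ln r) (ln (Z P)) (ln (quad P p - eta)) (h P p / g P p) (l * uz p) => *; lra.
have f0 : 0 <= competitor P p by rewrite divr_ge0// ltW.
have := ler_wpM2l f0 lnf.
have fh : competitor P p * (h P p / g P p) <= (h P p + q) / Z P.
  have -> : competitor P p * (h P p / g P p) = (h P p + h P p ^+ 2 / g P p) / Z P.
    rewrite /competitor mulrAC; congr (_ / _).
    by rewrite mulrDl mulrCA mulfV ?mulr1 ?gt_eqF// expr2 mulrA.
  rewrite ler_pM2r ?invr_gt0// lerD2l.
  have [->|hn] := eqVneq (h P p) 0; first by rewrite expr0n mul0r.
  have [cgg _ hq] := hcap hn.
  rewrite ler_pdivrMr// (le_trans hq)// ler_wpM2l//.
move: fh.
move: ((h P p + q) / Z P) (competitor P p) (h P p / g P p) (ln (Z P)) (l * uz p).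
by move: (ln (competitor P p)) (ln (quad P p - eta)) => *; lra.
Qed.

Lemma energy_competitor_le (P : Sym0 R) q : 0 < Z P -> 0 <= q ->
  (forall p, sphere R p -> quad P p - eta <= 0 -> h P p = 0) ->
  (forall p, sphere R p -> h P p != 0 ->
     [/\ cg <= g P p, `|h P p| <= g P p / 2 & h P p ^+ 2 <= q * cg]) ->
  (J P eta <= (dual_value l eta P + q * sarea / Z P)%:E)%E.
Proof.
move=> ZP q0 hout hcap.
have f0 p : sphere R p -> 0 <= competitor P p.
  move=> Sp; rewrite divr_ge0 ?(ltW ZP)//.
  have [->|hn] := eqVneq (h P p) 0; first by rewrite addr0 gibbs_ge0.
  have [_ + _] := hcap p Sp hn; rewrite ler_norml => /andP[h1 _].
  by have := gibbs_ge0 l eta P p; move: h1; move: (g P p) (h P p) => *; lra.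
have fP := competitor_admissible ZP f0.
apply: (@le_trans _ _ (energy P eta (competitor P))).
  by apply: ereal_inf_lbound; exists (competitor P).
pose kk p := (l * uz p - ln (Z P)) * competitor P p + (h P p + q) / Z P.
have b1 := bmeasM (@bmeas_uz R) (bcomp P).
have b2 := bmeasZ (ln (Z P)) (bcomp P).
have b3 := bmeasZ (Z P)^-1 (bmeasD (bh P) (bmeas_cst q)).
have bk' := bmeasD (bmeasB (bmeasZ l b1) b2) b3.
have kE p : l * (uz p * competitor P p) - ln (Z P) * competitor P p +
    (Z P)^-1 * (h P p + q) = kk p.
  by rewrite /kk; move: (uz p) (competitor P p) (ln _) (_^-1) (h P p) => *; lra.
have bk := eq_bmeas kE bk'.
have -> : dual_value l eta P + q * sarea / Z P = sint kk.
  rewrite -(eq_sint (fun p _ => kE p)).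
  rewrite (sintD (bmeasB (bmeasZ l b1) b2) b3) (sintB (bmeasZ l b1) b2).
  rewrite (sintZ _ b1) (sintZ _ (bcomp P)) (sintZ _ (bmeasD (bh P) (bmeas_cst q))).
  rewrite (sintD (bh P) (bmeas_cst q)) mass_h sint_cst mass_competitor//.
  rewrite /sint (admissible_uz fP) add0r mulr1 /dual_value.
  by rewrite [_^-1 * _]mulrC.
rewrite -(integral_sint bk); apply: ae_le_integral.
- exact: measurable_sphere.
- by apply: measurable_energy_density; exact: (bcomp P).1.
- by apply/measurable_EFinP; exact: bk.1.
- exists set0; split; [exact: measurable0|exact: hausdorff2_0|].
  move=> p /= H; exfalso; apply: H => Sp.
  by apply: energy_density_competitor => //; [exact: hout|exact: hcap].
Qed.

Lemma J_upper : exists2 C, 0 <= C & exists2 d, 0 < d & forall P : Sym0 R,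
  `|(P : 'M[R]_3) - Q0| <= d ->
  (J P eta <= (dual_value l eta P + C * `|(P : 'M[R]_3) - Q0| ^+ 2)%:E)%E.
Proof.
have [Ch Ch0 hle] := corrector_le k0 k1.
have [d0 d00 Zd] := partition_fun_near.
have K0 : 0 < K by rewrite ltr_pwDr// mulr_ge0.
(* In order: [Z P] stays above half of [Z Q0], the defect is Lipschitz, the Gibbs density stays
   above [cg] on the cap, and the correction is at most half of it there. *)
pose d := Num.min (Num.min d0 1) (Num.min (c1 / 18) (cg / 2 / (Ch * K))).
have dP : 0 < d.
  rewrite !lt_min d00 ltr01 (divr_gt0 c1_gt0)//=.
  by rewrite !divr_gt0// mulr_gt0.
exists (2 * (Ch * K) ^+ 2 / cg * sarea / Z Q0).
  rewrite !mulr_ge0 ?sarea_ge0 ?invr_ge0 ?sqr_ge0//; exact: ltW.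
exists d => // P; set D := (P : 'M[R]_3) - Q0.
have PE : (P : 'M[R]_3) = Q0 + D by rewrite /D addrC subrK.
rewrite !le_min => /andP[/andP[Dd0 D1] /andP[Dc Dg]].
have ZP : Z Q0 / 2 <= Z P by rewrite PE; exact: Zd.
have ZP0 : 0 < Z P by apply: lt_le_trans ZP; rewrite divr_gt0.
have D18 : 9 * `|D| <= c1 / 2 by move: Dc; move: (`|D|) (c1) => *; lra.
have hP p : sphere R p -> `|h P p| <= Ch * (K * `|D|).
  by move=> Sp; apply: hle => // i j; rewrite PE; exact: moment_defect_le.
have hcg p : sphere R p -> `|h P p| <= cg / 2.
  move=> Sp; apply: (le_trans (hP p Sp)).
  by move: Dg; rewrite ler_pdivlMr ?mulr_gt0// mulrC mulrA.
have capP p : sphere R p -> h P p != 0 -> cg <= g P p.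
  move=> Sp hn; rewrite PE; apply: gibbs_cap => //.
  by rewrite ltNge; apply: contra hn => ?; rewrite /h corrector_out.
pose q := (Ch * (K * `|D|)) ^+ 2 / cg.
have q0 : 0 <= q by rewrite divr_ge0 ?sqr_ge0// ltW.
apply: (le_trans (energy_competitor_le ZP0 q0 _ _)).
- move=> p Sp w0; apply/eqP; apply: contraTT w0 => hn; rewrite -ltNge.
  have := lt_le_trans cg_gt0 (capP p Sp hn).
  by rewrite /gibbs pmulr_lgt0 ?expR_gt0// lt_max ltxx orbF.
- move=> p Sp hn; split; first exact: capP.
    apply: (le_trans (hcg p Sp)); rewrite ler_pM2r ?invr_gt0//.
    exact: capP.
  rewrite /q mulfVK ?gt_eqF// -real_normK ?num_real//.
  by rewrite lerXn2r ?nnegrE// ?hP// (le_trans _ (hP p Sp)).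
rewrite lee_fin lerD2l.
have -> : 2 * (Ch * K) ^+ 2 / cg * sarea / Z Q0 * `|D| ^+ 2 = q * sarea / (Z Q0 / 2).
  rewrite /q invf_div !exprMn.
  by move: (cg^-1) ((Z Q0)^-1) (sarea) (Ch ^+ 2) (K ^+ 2) (`|D| ^+ 2) => *; lra.
apply: ler_wpM2l; first by rewrite mulr_ge0 ?sarea_ge0.
by rewrite lef_pV2// posrE// divr_gt0.
Qed.

End expansion.

(** * Stationarity of the dual bound at the uniaxial matrix *)

Section derivative.
Context {R : realType}.
Variables (s l eta : R).
Hypothesis s01 : 0 < s < 1.
Hypothesis etas : eta < 2 / 3 * s.
Implicit Types (P D : 'M[R]_3) (p : 'cV[R]_3) (i j : 'I_3).

Local Notation Q0 := (uniaxial_mx s).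
Local Notation E p := (expR (l * uz p)).
Local Notation w p := (Num.max (s * uz p - eta) 0).
Local Notation Z := (partition_fun l eta).
Local Notation g := (gibbs l eta).

Hypothesis E2 : 2 / 3 * l * sint (fun p => w p * E p) =
  sint (fun p => uz p * ((eta < s * uz p)%R%:R * E p)).

Let s0 : 0 < s. Proof. by case/andP: s01. Qed.

Let Z0_gt0 : 0 < Z Q0. Proof. exact: partition_fun_uniaxial_gt0. Qed.

Let Emax := expR `|l|.

Let band (e : R) := sint (fun p => (`|s * uz p - eta| <= e)%R%:R).

Let bsuz : bmeas (fun p => s * uz p - eta).
Proof. by apply: bmeasB; [apply: bmeasZ; exact: bmeas_uz|exact: bmeas_cst]. Qed.

Let bband (e : R) : bmeas (fun p => (`|s * uz p - eta| <= e)%R%:R).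
Proof. by apply: bmeas_le; [exact: bmeas_norm bsuz|exact: bmeas_cst]. Qed.

Let band_small (e : R) : 0 < e -> exists2 d, 0 < d & band d <= e.
Proof.
move=> e0.
have lim : band n.+1%:R^-1 @[n --> \oo] --> 0.
  rewrite -sint0; apply: (@sint_cvg _ _ _ (sphere R `&` [set p | uz p = eta / s]) 1).
  - by move=> n; exact: bband.
  - exact: bmeas_cst.
  - exact: hausdorff2_uz_eq.
  - by move=> n p _; case: (`|s * uz p - eta| <= _); rewrite ?normr1 ?normr0.
  move=> p Sp pN; apply: cvg_near_cst.
  have pos : 0 < `|s * uz p - eta|.
    rewrite normr_gt0; apply/eqP => e1; apply: pN; split => //=.
    have -> : eta = s * uz p by lra.
    by rewrite [RHS]mulrC mulKf// gt_eqF.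
  near=> n.
  have : n.+1%:R^-1 < `|s * uz p - eta|.
    rewrite invf_plt ?posrE//; near: n.
    exists (Num.truncn (`|s * uz p - eta|^-1)) => // n /= hn.
    apply: lt_le_trans (truncnS_gt _) _.
    by rewrite ler_nat ltnS.
  by rewrite ltNge => /negbTE ->.
have /cvgrPdist_le/(_ _ e0)[n _ H] := lim.
exists n.+1%:R^-1; first by rewrite invr_gt0.
by have := H n (leqnn n); rewrite sub0r normrN; apply: le_trans; exact: ler_norm.
Unshelve. all: by end_near. Qed.

(** The positive part is affine between [a] and [a + q] unless the sign changes, which forces
    [|a| <= |q|]; the error is then at most [|q|]. *)
Let max0_diff (a q : R) :
  `|Num.max (a + q) 0 - Num.max a 0 - (0 < a)%R%:R * q| <=
  `|q| * (`|a| <= `|q|)%R%:R.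
Proof.
have q1 := ler_norm q; have q2 := ler_norm (- q); rewrite normrN in q2.
have := normr_ge0 q; move: q1 q2; move: (`|q|) => n q1 q2 n0.
case: (leP `|a| n) => h3; rewrite /= ?mulr1 ?mulr0.
  by case: (leP (a + q) 0) => h1; case: (leP a 0) => h2; rewrite /= ler_norml;
    apply/andP; split; lra.
case: (leP a 0) h3 => h2; [rewrite (ler0_norm h2)|rewrite (gtr0_norm h2)] => h3;
  by case: (leP (a + q) 0) => h1 /=; rewrite normr_le0; apply/eqP; lra.
Qed.

Let F p := (eta < s * uz p)%R%:R * E p.

Let bF : bmeas F.
Proof.
apply: bmeasM; last exact: bmeas_expuz.
by apply: bmeas_lt; [exact: bmeas_cst|apply: bmeasZ; exact: bmeas_uz].
Qed.

Let polarF : polar F.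
Proof. exact: (@polar_uz _ (fun u => (eta < s * u)%R%:R * expR (l * u)) bF). Qed.

(** The symmetries kill the off-diagonal terms and equate the first two moments; as [D] is
    traceless, the integral is 3/2 times its last entry times the integral of [uz p * F p], which
    [E2] evaluates. *)
Let sint_quad_F (D : Sym0 R) :
  sint (fun p => quad D p * F p) = l * (D : 'M[R]_3) 2%:R 2%:R * Z Q0.
Proof.
have /andP[_ /eqP Dt] := valP D; move: Dt; rewrite /mxtrace sum_ord3.
set d := (D : 'M[R]_3) => Dt.
have b i j := bmeasM (@bmeas_quadratic R i j) bF.
have bz i j := bmeasZ (d i j) (b i j).
have row i : sint (fun p => (\sum_j d i j * (p i 0 * p j 0)) * F p) =
    d i i * sint (fun p => p i 0 * p i 0 * F p).
  rewrite (eq_sint (G := fun p => d i 0 * (p i 0 * p 0 0 * F p) +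
    d i 1 * (p i 0 * p 1 0 * F p) + d i 2%:R * (p i 0 * p 2%:R 0 * F p))); last first.
    by move=> p _; rewrite sum_ord3 !mulrDl !mulrA.
  rewrite (sintD (bmeasD (bz _ _) (bz _ _)) (bz _ _)) (sintD (bz _ _) (bz _ _)).
  rewrite !(sintZ _ (b _ _)).
  have off i' j' : i' != j' -> d i' j' * sint (fun p => p i' 0 * p j' 0 * F p) = 0.
    by move=> ij; rewrite (sint_polar_offdiag polarF ij) mulr0.
  elim/ord3_ind: i.
  - by rewrite (off 0 1)// (off 0 2%:R)// !addr0.
  - by rewrite (off 1 0)// (off 1 2%:R)// addr0 add0r.
  - by rewrite (off 2%:R 0)// (off 2%:R 1)// !add0r.
have brow i : bmeas (fun p => (\sum_j d i j * (p i 0 * p j 0)) * F p).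
  apply: bmeasM; last exact: bF.
  have H : forall p : 'cV[R]_3, d i 0 * (p i 0 * p 0 0) + d i 1 * (p i 0 * p 1 0) +
      d i 2%:R * (p i 0 * p 2%:R 0) = \sum_j d i j * (p i 0 * p j 0).
    by move=> p; rewrite sum_ord3.
  have q j := bmeasZ (d i j) (@bmeas_quadratic R i j).
  exact: (eq_bmeas H (bmeasD (bmeasD (q _) (q _)) (q _))).
rewrite (eq_sint (G := fun p => (\sum_j d 0 j * (p 0 0 * p j 0)) * F p +
    (\sum_j d 1 j * (p 1 0 * p j 0)) * F p +
    (\sum_j d 2%:R j * (p 2%:R 0 * p j 0)) * F p)); last first.
  by move=> p _; rewrite quad_sum sum_ord3 !mulrDl.
rewrite (sintD (bmeasD (brow _) (brow _)) (brow _)) (sintD (brow _) (brow _)) !row.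
have xy := sint_polar_xx_yy polarF.
have tr := sint_quadratic_trace bF.
have E2' : 2 / 3 * l * Z Q0 = sint (fun p => p 2%:R 0 * p 2%:R 0 * F p) - 3^-1 * sint F.
  rewrite (partition_fun_uniaxial s l eta) E2 -(sintZ _ bF) -(sintB (b _ _) (bmeasZ _ bF)).
  by apply: eq_sint => p _; rewrite -mulrBl /uz expr2.
move: Dt xy tr E2'.
move: (sint (fun p => p 0 0 * p 0 0 * F p)) (sint (fun p => p 1 0 * p 1 0 * F p)).
move: (sint (fun p => p 2%:R 0 * p 2%:R 0 * F p)) (sint F) (Z Q0).
move: (d 0 0) (d 1 1) (d 2%:R 2%:R) => a b' e V W z X Y Dt xy tr E2'.
have -> : l * e * z = (2 / 3 * l * z) * (3 / 2 * e) by lra.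
rewrite E2'; have -> : a = - b' - e by lra.
have -> : V = W - 2 * X by lra.
by rewrite -xy; lra.
Qed.

(** The linear term is the integral of [quad D p * F p]. The remainder lives in a band about the
    kink [s * uz p = eta], whose measure tends to zero with [D], and is linear in [D] there. *)
Lemma partition_fun_diff (e : R) : 0 < e -> exists2 d, 0 < d & forall D : Sym0 R,
  `|(D : 'M[R]_3)| <= d ->
  `|Z (Q0 + D) - Z Q0 - l * (D : 'M[R]_3) 2%:R 2%:R * Z Q0| <= e * `|(D : 'M[R]_3)|.
Proof.
move=> e0.
have M0 : 0 < 9 * Emax by rewrite mulr_gt0 ?expR_gt0.
have e1 : 0 < e / (9 * Emax) by rewrite divr_gt0.
have [d0 d00 bd] := band_small e1.
exists (d0 / 9); first by rewrite divr_gt0.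
move=> D Dd; set d := (D : 'M[R]_3) in Dd *.
have bG := bmeas_gibbs l eta.
have bq := bmeasM (bmeas_quad d) bF.
have b1 := bmeasB (bmeasB (bG (Q0 + d)) (bG Q0)) bq.
have -> : Z (Q0 + d) - Z Q0 - l * d 2%:R 2%:R * Z Q0 =
    sint (fun p => g (Q0 + d) p - g Q0 p - quad d p * F p).
  rewrite (sintB (bmeasB (bG (Q0 + d)) (bG Q0)) bq) (sintB (bG (Q0 + d)) (bG Q0)).
  by rewrite sint_quad_F.
have b2 := bmeasZ (9 * Emax * `|d|) (bband d0).
apply: (le_trans (le_normr_Rintegral measurable_sphere (bmeas_integrable b1))).
apply: (@le_trans _ _ (sint (fun p => 9 * Emax * `|d| * (`|s * uz p - eta| <= d0)%R%:R))).
  apply: (sint_le (bmeas_norm b1) b2) => p Sp.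
  have qd := norm_quad_le d Sp.
  have -> : g (Q0 + d) p - g Q0 p - quad d p * F p =
     (Num.max ((s * uz p - eta) + quad d p) 0 - Num.max (s * uz p - eta) 0 -
      (0 < s * uz p - eta)%R%:R * quad d p) * E p.
    have e' : s * uz p + quad d p - eta = s * uz p - eta + quad d p by lra.
    rewrite /gibbs /wt quadD quad_uniaxial// e' /F subr_gt0.
    move: (Num.max (s * uz p - eta + quad d p) 0) (Num.max (s * uz p - eta) 0).
    move: ((eta < s * uz p)%R%:R : R) (E p) (quad d p) => *; lra.
  rewrite normrM (ger0_norm (expR_ge0 _)).
  have -> : 9 * Emax * `|d| * (`|s * uz p - eta| <= d0)%R%:R =
      9 * `|d| * (`|s * uz p - eta| <= d0)%R%:R * Emax.
    by move: (_%:R) (`|d|) (Emax) => *; lra.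
  apply: ler_pM; rewrite ?normr_ge0 ?expR_ge0//; last exact: expR_uz_le.
  apply: (le_trans (max0_diff _ _)); apply: ler_pM => //.
  rewrite ler_nat; case: (leP _ `|quad d p|) => h2 //=.
  rewrite (le_trans h2)// (le_trans qd)//.
  by move: Dd; move: (`|d|) => *; lra.
rewrite (sintZ _ (bband d0)) -/(band d0).
have -> : e * `|d| = 9 * Emax * `|d| * (e / (9 * Emax)).
  by rewrite [RHS]mulrAC; congr (_ * _); rewrite mulrCA mulfV ?mulr1 ?gt_eqF.
by rewrite ler_wpM2l// mulr_ge0// ltW.
Qed.

Let ln1D_bound (x : R) : `|x| <= 2^-1 -> `|ln (1 + x) - x| <= 2 * x ^+ 2.
Proof.
rewrite ler_norml => /andP[x1 x2].
have x0 : 0 < 1 + x by lra.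
have h1 : ln (1 + x) <= x by have := ln_le_sub1 x0; lra.
have x0' : 0 < (1 + x)^-1 by rewrite invr_gt0.
have := ln_le_sub1 x0'; rewrite lnV ?posrE// => h2.
have h3 : (1 + x)^-1 - 1 <= - x + 2 * x ^+ 2.
  rewrite lerBlDr -[leLHS]mul1r ler_pdivrMr//; have := sqr_ge0 x; nra.
by rewrite ler_norml; apply/andP; split; have := sqr_ge0 x; lra.
Qed.

(** The logarithmic derivative of [Z] is [l] times the last diagonal entry of [D], which cancels the
    linear term of the dual value. *)
Lemma dual_value_diff (e : R) : 0 < e -> exists2 d, 0 < d & forall D : Sym0 R,
  `|(D : 'M[R]_3)| <= d ->
  `|dual_value l eta (Q0 + D) - dual_value l eta Q0| <= e * `|(D : 'M[R]_3)|.
Proof.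
move=> e0; have ez : 0 < e * Z Q0 / 2 by rewrite divr_gt0// mulr_gt0.
have [d1 d10 H1] := partition_fun_diff ez.
have [d2 d20 H2] := partition_fun_near l s01 etas.
pose L := `|l| + e / 2.
have L0 : 0 < L by rewrite ltr_wpDl// divr_gt0.
(* As [|x| <= L * |D|], the third bound brings [x] into the range of [ln1D_bound] and the fourth
   makes its error [2 x ^ 2] at most [e / 2 * |D|]. *)
pose d := Num.min (Num.min d1 d2) (Num.min (2^-1 / L) (e / 4 / L ^+ 2)).
exists d.
  by rewrite !lt_min d10 d20 !divr_gt0// ?invr_gt0// exprn_gt0.
move=> D; set M := (D : 'M[R]_3); rewrite !le_min => /andP[/andP[D1 D2] /andP[D3 D4]].
have ZP : 0 < Z (Q0 + M) by apply: lt_le_trans (H2 M D2); rewrite divr_gt0.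
pose x := (Z (Q0 + M) - Z Q0) / Z Q0.
have xE : 1 + x = Z (Q0 + M) / Z Q0.
  by rewrite /x mulrBl (mulfV (lt0r_neq0 Z0_gt0)) addrC subrK.
have xl : `|x - l * M 2%:R 2%:R| <= e / 2 * `|M|.
  have -> : x - l * M 2%:R 2%:R = (Z (Q0 + M) - Z Q0 - l * M 2%:R 2%:R * Z Q0) / Z Q0.
    by rewrite [RHS]mulrBl (mulfK (lt0r_neq0 Z0_gt0)).
  rewrite normrM normfV (gtr0_norm Z0_gt0) ler_pdivrMr// (le_trans (H1 D D1))//.
  by rewrite -/M; move: (Z Q0) (`|M|) => *; lra.
have xL : `|x| <= L * `|M|.
  have -> : x = (x - l * M 2%:R 2%:R) + l * M 2%:R 2%:R by lra.
  rewrite (le_trans (ler_normD _ _))// /L mulrDl addrC lerD// normrM.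
  by rewrite ler_wpM2l// norm_entry_le.
have x12 : `|x| <= 2^-1.
  by rewrite (le_trans xL)// mulrC -ler_pdivlMr.
have lnx := ln1D_bound x12.
have x2 : 2 * x ^+ 2 <= e / 2 * `|M|.
  have h : x ^+ 2 <= (L * `|M|) ^+ 2.
    by rewrite -(real_normK (num_real x)) lerXn2r ?nnegrE// mulr_ge0// ltW.
  have h' : L ^+ 2 * `|M| <= e / 4 by rewrite mulrC -ler_pdivlMr ?exprn_gt0.
  have : (L * `|M|) ^+ 2 <= e / 4 * `|M|.
    by rewrite exprMn (expr2 `|M|) mulrA ler_wpM2r.
  by move: h; move: (x ^+ 2) ((L * `|M|) ^+ 2) (`|M|) => *; lra.
have -> : dual_value l eta (Q0 + M) - dual_value l eta Q0 =
    - (ln (1 + x) - x) - (x - l * M 2%:R 2%:R).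
  rewrite xE ln_div ?posrE// /dual_value [(Q0 + M) _ _]mxE.
  move: (ln (Z (Q0 + M))) (ln (Z Q0)) (Q0 2%:R 2%:R) (M 2%:R 2%:R) (x) => *; lra.
rewrite (le_trans (ler_normB _ _))// normrN.
move: lnx x2 xl; move: (`|ln (1 + x) - x|) (x ^+ 2) (`|x - _|) (`|M|) => *; lra.
Qed.

End derivative.

Section critical_point_existence.
Context {R : realType}.

Lemma differentiable_zero (V : normedModType R) (g : V -> R) (x : V) :
  (forall e : R, 0 < e -> exists2 d, 0 < d & forall h : V, `|h| <= d ->
     `|g (h + x) - g x| <= e * `|h|) ->
  differentiable g x /\ 'd g x = 0 :> (V -> R).
Proof.
move=> H.
pose z : {linear V -> R^o} := \0.
have zc : continuous z by move=> y; exact: cvg_cst.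
have E : g \o shift x = cst (g x) + z +o_ (0 : V) id.
  apply/eqaddoP => e e0; have [d d0 Hd] := H e e0.
  apply/nbhs_ballP; exists d => // h; rewrite -ball_normE /= sub0r normrN => hd.
  have := Hd h (ltW hd); congr (`|_| <= _).
  by rewrite /= !fctE /= addr0.
have dE := diff_unique zc E.
split; last by rewrite dE.
by apply/diff_locallyP; rewrite dE.
Qed.

Variables (s l eta : R).
Hypothesis s01 : 0 < s < 1.
Hypothesis eta0 : 0 <= eta.
Hypothesis etas : eta < 2 / 3 * s.
Hypothesis E1 :
  sint (fun p => uz p * (Num.max (s * uz p - eta) 0 * expR (l * uz p))) =
  2 / 3 * s * sint (fun p => Num.max (s * uz p - eta) 0 * expR (l * uz p)).
Hypothesis E2 :
  2 / 3 * l * sint (fun p => Num.max (s * uz p - eta) 0 * expR (l * uz p)) =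
  sint (fun p => uz p * ((eta < s * uz p)%R%:R * expR (l * uz p))).

Lemma uniaxial_critical : critical_point eta (uniaxial s).
Proof.
have [C C0 [d1 d10 up]] := J_upper s01 eta0 etas E1.
have [d2 d20 Zd] := partition_fun_near l s01 etas.
have bounds (D : Sym0 R) : `|D| <= Num.min d1 d2 -> exists2 r : R,
    J (uniaxial s + D) eta = r%:E &
    dual_value l eta (uniaxial_mx s + (D : 'M[R]_3)) <= r <=
    dual_value l eta (uniaxial_mx s + (D : 'M[R]_3)) + C * `|D| ^+ 2.
  rewrite le_min => /andP[D1 D2]; set P := uniaxial s + D.
  have PD : (P : 'M[R]_3) - uniaxial_mx s = D.
    by rewrite (_ : (P : 'M[R]_3) = uniaxial_mx s + D)// addrAC subrr add0r.
  have ZP : 0 < partition_fun l eta P.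
    apply: lt_le_trans (Zd _ D2); rewrite divr_gt0//.
    exact: partition_fun_uniaxial_gt0.
  have lo : ((dual_value l eta P)%:E <= J P eta)%E.
    by apply: le_ereal_inf_tmp => _ [f fP <-]; exact: dual_value_le_energy.
  have hi := up P; rewrite PD in hi; have {}hi := hi D1.
  have fin : J P eta \is a fin_num.
    rewrite fin_numE -ltNye -ltey (lt_le_trans _ lo) ?ltNyr//.
    by rewrite (le_lt_trans hi) ?ltry.
  exists (fine (J P eta)); first by rewrite fineK.
  by rewrite -!lee_fin fineK// lo hi.
(* At [D = 0] the quadratic error vanishes and the two bounds meet, so J equals the dual value at
   the uniaxial matrix. *)
have [r0 J0 r0E] : exists2 r : R, J (uniaxial s) eta = r%:E &
    r = dual_value l eta (uniaxial_mx s).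
  have [|r Jr] := bounds 0; first by rewrite normr0 le_min !ltW.
  rewrite addr0 in Jr; rewrite normr0 expr0n mulr0 !addr0 -eq_le => /eqP rE.
  by exists r.
have [diff0 d0] : differentiable (fun P : Sym0 R => fine (J P eta)) (uniaxial s) /\
    'd (fun P : Sym0 R => fine (J P eta)) (uniaxial s) = 0 :> (Sym0 R -> R).
  apply: differentiable_zero => e e0.
  have e20 : 0 < e / 2 by rewrite divr_gt0.
  have [d3 d30 dv] := dual_value_diff s01 etas E2 e20.
  pose d := Num.min (Num.min d1 d2) (Num.min d3 (e / 2 / (C + 1))).
  have C10 : 0 < C + 1 by rewrite ltr_pwDr.
  exists d; first by rewrite !lt_min d10 d20 d30 divr_gt0.
  move=> D; rewrite le_min => /andP[D12]; rewrite le_min => /andP[D3 D4].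
  have [r Jr /andP[r1 r2]] := bounds D D12.
  rewrite (addrC D) Jr J0 /= r0E.
  have := dv D D3; rewrite -[`|(D : 'M[R]_3)|]/(`|D|).
  have h : C * `|D| ^+ 2 <= e / 2 * `|D|.
    rewrite expr2 mulrA ler_wpM2r//; move: D4; rewrite ler_pdivlMr//.
    by have := normr_ge0 D; move: (`|D|) => *; lra.
  move: r1 r2 h; move: (dual_value _ _ _) (dual_value _ _ _) (C * _) => a b k.
  rewrite !ler_norml => h1 h2 h3 /andP[h4 h5]; apply/andP.
  by move: h3 h4 h5; move: (`|D|) => n *; split; lra.
split => //; split; first exact: uniaxial_Qset.
by rewrite J0 ltry.
Qed.

End critical_point_existence.

Lemma prolate_critical_point_exists (R : realType) (eta : R) : 0 <= eta < 2 / 3 ->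
  exists Q : Sym0 R, prolate_uniaxial Q /\ critical_point eta Q.
Proof.
move=> etaP; have /andP[eta0 _] := etaP.
have [s [l [s01 etas E1 E2]]] := equilibrium etaP.
exists (uniaxial s); split; first exact: uniaxial_prolate.
exact: (uniaxial_critical s01 eta0 etas E1 E2).
Qed.

(** * Evenness and concentration of optimal distributions *)

Section entropy.
Context {R : realType}.
Implicit Types x y m : R.

(** The left-hand side is the tangent at [m] of the convex function [x ln x]. *)
Lemma entropy_ge x m : 0 <= x -> 0 < m -> x * ln m + x - m <= x * ln x.
Proof.
rewrite le_eqVlt => /orP[/eqP<-|x0] m0; first by rewrite !mul0r add0r sub0r oppr_le0 ltW.
have := ln_le_sub1 (divr_gt0 m0 x0); rewrite ln_div ?posrE// => h.
have := ler_wpM2l (ltW x0) h; rewrite !mulrBr mulr1 [x * (m / x)]mulrCA mulfV ?gt_eqF//.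
by rewrite mulr1; move: (x * ln m) (x * ln x) => *; lra.
Qed.

Lemma entropy_gt x m : 0 <= x -> 0 < m -> x != m -> x * ln m + x - m < x * ln x.
Proof.
rewrite le_eqVlt => /orP[/eqP<-|x0] m0 xm; first by rewrite !mul0r add0r sub0r oppr_lt0.
have mx0 := divr_gt0 m0 x0.
have h : ln m - ln x < m / x - 1.
  rewrite -ln_div ?posrE//; have nz : ln (m / x) != 0.
    rewrite ln_eq0//; apply: contra xm => /eqP mx1.
    by rewrite eq_sym -[m](mulfVK (lt0r_neq0 x0)) mx1 mul1r.
  by have := expR_gt1Dx nz; rewrite lnK ?posrE//; lra.
have : x * (ln m - ln x) < x * (m / x - 1) by rewrite ltr_pM2l.
rewrite !mulrBr mulr1 [x * (m / x)]mulrCA mulfV ?gt_eqF// mulr1.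
by move: (x * ln m) (x * ln x) => *; lra.
Qed.

Definition entropy_gap x y : R :=
  2^-1 * (x * ln x + y * ln y) - (2^-1 * (x + y)) * ln (2^-1 * (x + y)).

Lemma entropy_gap_ge0 x y : 0 <= x -> 0 <= y -> 0 <= entropy_gap x y.
Proof.
move=> x0 y0; rewrite /entropy_gap; set m := 2^-1 * (x + y).
have m0 : 0 <= m by rewrite mulr_ge0// addr_ge0.
move: m0; rewrite le_eqVlt => /orP[/eqP mE|m0].
  have -> : x = 0 by rewrite /m in mE; lra.
  have -> : y = 0 by rewrite /m in mE; lra.
  by rewrite -mE !mul0r addr0 mulr0 subr0.
have := entropy_ge x0 m0; have := entropy_ge y0 m0.
have -> : m * ln m = 2^-1 * (x * ln m + y * ln m) by rewrite /m; lra.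
have : x + y = m + m by rewrite /m; lra.
by move: (x * ln m) (y * ln m) (x * ln x) (y * ln y) => *; lra.
Qed.

Lemma entropy_gap_eq0 x y : 0 <= x -> 0 <= y -> entropy_gap x y = 0 -> x = y.
Proof.
move=> x0 y0; rewrite /entropy_gap; set m := 2^-1 * (x + y).
have m0 : 0 <= m by rewrite mulr_ge0// addr_ge0.
move: m0; rewrite le_eqVlt => /orP[/eqP mE _|m0].
  by rewrite /m in mE; lra.
have [xm|xm] := eqVneq x m; first by move=> _; move: xm; rewrite /m; lra.
have := entropy_gt x0 m0 xm; have := entropy_ge y0 m0.
have -> : m * ln m = 2^-1 * (x * ln m + y * ln m) by rewrite /m; lra.
have : x + y = m + m by rewrite /m; lra.
by move: (x * ln m) (y * ln m) (x * ln x) (y * ln y) => *; lra.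
Qed.

End entropy.

Section finite_energy.
Context {R : realType}.
Local Notation S := (sphere R : set (space3 R)).
Variables (Q : Sym0 R) (eta : R).
Implicit Types (p : 'cV[R]_3) (f : 'cV[R]_3 -> R).

Local Notation F := (energy_density eta Q).

Let M : R := 9 * `|(Q : 'M[R]_3)| + `|eta| + 1.

(** [x ln x >= x - 1] and the logarithm of the weight is at most [M]; this integrable minorant
    controls the negative part of the energy density. *)
Let energy_density_ge_minorant f p : sphere R p -> 0 <= f p ->
  ((f p - 1 - M * f p)%:E <= F f p)%E.
Proof.
move=> Sp f0; rewrite /energy_density.
have ent : f p - 1 <= f p * ln (f p).
  by have := entropy_ge f0 ltr01; rewrite ln1 mulr0 add0r.
have M0 : 0 <= M by rewrite !addr_ge0// mulr_ge0.
have [w0|w0] := leP (quad Q p - eta) 0.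
  rewrite le0_lneNy ?lee_fin//; move: f0; rewrite le_eqVlt => /orP[/eqP<-|f0].
    by rewrite mul0e sube0 lee_fin mul0r mulr0 subr0 sub0r oppr_le0 ler01.
  by rewrite gt0_muleNy ?lte_fin// leey.
rewrite lne_EFin// -EFinM -EFinB lee_fin lerB// mulrC ler_wpM2r//.
have := ln_le_sub1 w0; have := norm_quad_le Q Sp; rewrite ler_norml => /andP[_ h].
by have := ler_norm (- eta); rewrite normrN /M; lra.
Qed.

Lemma energy_density_integrable f : densities R f ->
  (energy Q eta f < +oo)%E -> (H2 R).-integrable S (F f).
Proof.
move=> df fin; have [fi [N [mN N0 fN]] _] := df.
have mF : measurable_fun S (F f : space3 R -> \bar R).
  by apply: measurable_energy_density; exact: densities_measurable.
pose k p := f p - 1 - M * f p.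
have ki : (H2 R).-integrable S (EFin \o k).
  have i1 := bmeas_mul_integrable (bmeas_cst (1 - M)) fi.
  have := integrableB measurable_sphere i1 (bmeas_integrable (bmeas_cst 1)).
  apply: eq_integrable; first exact: measurable_sphere.
  by move=> p _ /=; rewrite -EFinB; congr EFin; rewrite /k; lra.
have mk : measurable_fun S ((EFin \o k) : space3 R -> \bar R) by case/integrableP: ki.
have negfin : (\int[H2 R]_(p in sphere R) (F f)^\- p < +oo)%E.
  apply: (@le_lt_trans _ _ (\int[H2 R]_(p in sphere R) (EFin \o k)^\- p)%E).
    apply: ae_ge0_le_integral => //.
    - exact: measurable_sphere.
    - exact: measurable_funeneg.
    - exact: measurable_funeneg.
    - exists N; split => // p /= H; apply: fN => /= h; apply: H => Sp.
      rewrite !funenegE; apply: le_max2 => //; rewrite leeN2.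
      by apply: energy_density_ge_minorant => //; exact: h.
  exact: (integral_funeneg_lt_pinfty measurable_sphere ki).
have posfin : (\int[H2 R]_(p in sphere R) (F f)^\+ p < +oo)%E.
  move: fin; rewrite /energy -/(F f) integralE.
  have : (\int[H2 R]_(p in sphere R) (F f)^\- p \is a fin_num)%E.
    by rewrite ge0_fin_numE// integral_ge0.
  by move=> fn; rewrite lteBlDr// => /lt_le_trans; apply; exact: leey.
apply/integrableP; split => //.
under eq_integral do rewrite -/((abse \o F f) _) fune_abse.
rewrite ge0_integralD//; first exact: lte_add_pinfty.
- exact: measurable_sphere.
- exact: measurable_funepos.
- exact: measurable_funeneg.
Qed.

(** An integrable energy density is finite almost everywhere, whereas it is [+oo] where [f] is
    positive and the weight argument is not. *)
Lemma energy_support f : densities R f -> (energy Q eta f < +oo)%E ->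
  {ae H2 R, forall p, sphere R p -> f p = 0 \/ eta < quad Q p}.
Proof.
move=> df fin; have [_ fae _] := df.
have Fae := integrable_ae measurable_sphere (energy_density_integrable df fin).
apply: (@filterS2 _ _ (ae_filter_ringOfSetsType (H2 R)) _ _ _ _ fae Fae) => p fp Fp Sp.
have f0 := fp Sp; have Ff := Fp Sp.
have [w0|w0] := ltP eta (quad Q p); [by right|left].
move: f0; rewrite le_eqVlt => /orP[/eqP//|f0].
move: Ff; rewrite /energy_density le0_lneNy ?lee_fin ?subr_le0//.
by rewrite gt0_muleNy ?lte_fin.
Qed.

End finite_energy.

Section antipodal_symmetry.
Context {R : realType}.
Local Notation S := (sphere R : set (space3 R)).
Implicit Types (p : 'cV[R]_3) (f : 'cV[R]_3 -> R).

Let opp_isometry p q : enorm (- p - - q) = enorm (p - q).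
Proof. by rewrite -opprD enormN. Qed.

Lemma sphere_opp : (fun p => - p) @^-1` sphere R = sphere R.
Proof. by apply/seteqP; split => p; rewrite /sphere /= enormN. Qed.

Let measurable_opp : measurable_fun setT (-%R : space3 R -> space3 R).
Proof. exact: (measurable_fun_isometry opp_isometry (@opprK _) (@opprK _)). Qed.

Lemma integral_opp (G : 'cV[R]_3 -> \bar R) :
  measurable_fun S (G : space3 R -> \bar R) ->
  (\int[H2 R]_(p in sphere R) G (- p)%R = \int[H2 R]_(p in sphere R) G p)%E.
Proof.
move=> mG; have := integral_isometry opp_isometry (@opprK _) (@opprK _)
  measurable_sphere mG.
by rewrite sphere_opp.
Qed.

Let measurable_fun_opp d (T : measurableType d) (G : 'cV[R]_3 -> T) :
  measurable_fun S (G : space3 R -> T) ->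
  measurable_fun S ((fun p => G (- p)) : space3 R -> T).
Proof.
move=> mG; apply: (measurable_comp (F := S) _ _ mG).
- exact: measurable_sphere.
- by move=> _ [p Sp <-]; rewrite -sphere_opp in Sp.
- exact: measurable_funS measurable_opp.
Qed.

Lemma integrable_opp (G : 'cV[R]_3 -> \bar R) :
  (H2 R).-integrable S G -> (H2 R).-integrable S (fun p => G (- p)).
Proof.
case/integrableP => mG fG; apply/integrableP; split; first exact: measurable_fun_opp.
by rewrite (integral_opp (G := abse \o G)) //; exact: measurableT_comp.
Qed.

Lemma ae_opp (P : 'cV[R]_3 -> Prop) : {ae H2 R, forall p, P p} ->
  {ae H2 R, forall p, P (- p)}.
Proof.
move=> [N [mN N0 PN]]; exists (-%R @^-1` N); split.
- by have := measurable_opp measurableT mN; rewrite setTI.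
- by have := hausdorff2_isometry opp_isometry (@opprK _) N => /= ->.
- by move=> p /= nP; exact: PN.
Qed.

Lemma quad_opp (P : 'M[R]_3) p : quad P (- p) = quad P p.
Proof. by rewrite !quad_sum; do 2?apply: eq_bigr => ? _; rewrite !mxE mulrNN. Qed.

Lemma Rintegral_opp (G : 'cV[R]_3 -> R) :
  measurable_fun S (G : space3 R -> R) ->
  \int[H2 R]_(p in sphere R) G (- p) = \int[H2 R]_(p in sphere R) G p.
Proof.
by move=> mG; congr fine; apply: (integral_opp (G := EFin \o G)); exact/measurable_EFinP.
Qed.

Let symmetrized f p : R := 2^-1 * (f p + f (- p)).

Let sym_integrable f : (H2 R).-integrable S (EFin \o f) ->
  (H2 R).-integrable S (EFin \o symmetrized f).
Proof.
move=> fi; have fi' := integrable_opp fi.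
have := integrableZl measurable_sphere 2^-1 (integrableD measurable_sphere fi fi').
exact.
Qed.

Let Rintegral_symmetrized f (c : 'cV[R]_3 -> R) : bmeas c ->
  (forall p, c (- p) = c p) -> (H2 R).-integrable S (EFin \o f) ->
  \int[H2 R]_(p in sphere R) (c p * symmetrized f p) =
  \int[H2 R]_(p in sphere R) (c p * f p).
Proof.
move=> bc ce fi; have i1 := bmeas_mul_integrable bc fi.
have i2 : (H2 R).-integrable S (EFin \o (fun p => c p * f (- p))).
  exact: (bmeas_mul_integrable bc (integrable_opp fi)).
have -> : \int[H2 R]_(p in sphere R) (c p * symmetrized f p) =
    \int[H2 R]_(p in sphere R) (2^-1 * (c p * f p + c p * f (- p))).
  by apply: eq_Rintegral => p _; rewrite /symmetrized mulrCA mulrDr.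
rewrite (RintegralZl _ measurable_sphere (integrableD measurable_sphere i1 i2)).
rewrite (RintegralD measurable_sphere i1 i2).
have -> : \int[H2 R]_(p in sphere R) (c p * f (- p)) =
    \int[H2 R]_(p in sphere R) (c p * f p).
  rewrite -[RHS]Rintegral_opp; last by apply/measurable_EFinP; case/integrableP: i1.
  by apply: eq_Rintegral => p _; rewrite ce.
move: (\int[H2 R]_(p in _) _) => X; lra.
Qed.

Lemma symmetrized_admissible (Q : Sym0 R) f : admissible Q f ->
  admissible Q (symmetrized f).
Proof.
move=> Qf; have [[fi f0 f1] mom] := Qf; split; first split.
- exact: sym_integrable.
- apply: (@filterS2 _ _ (ae_filter_ringOfSetsType (H2 R)) _ _ _ _ f0 (ae_opp f0)).
  move=> p h1 h2 Sp; rewrite mulr_ge0// addr_ge0 ?h1// h2//.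
  by rewrite -sphere_opp in Sp.
- rewrite -[LHS]fineK; last first.
    exact: (integrable_fin_num measurable_sphere (sym_integrable fi)).
  congr EFin; rewrite -[1](admissible_fin Qf).
  have := Rintegral_symmetrized (bmeas_cst 1) (fun=> erefl) fi.
  by under eq_Rintegral do rewrite mul1r; under [RHS]eq_Rintegral do rewrite mul1r.
rewrite -mom; apply/matrixP => i j; rewrite !mxE.
have cE p : (outer_square p - 3^-1%:M) i j = p i 0 * p j 0 - (3^-1 *+ (i == j)).
  by rewrite !mxE big_ord1 !mxE.
under eq_Rintegral do rewrite cE; under [RHS]eq_Rintegral do rewrite cE.
apply: (Rintegral_symmetrized _ _ fi).
  exact: (bmeasB (bmeas_quadratic i j) (bmeas_cst _)).
by move=> p; rewrite !mxE mulrNN.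
Qed.

(** The logarithmic weight enters linearly and is even, so averaging leaves it unchanged and only
    the entropy gap remains. Finiteness excludes [oo - oo]; where the weight argument is not
    positive it forces both values of [f] to vanish. *)
Let energy_density_symmetrized (Q : Sym0 R) eta f p :
  0 <= f p -> 0 <= f (- p) ->
  energy_density eta Q f p \is a fin_num ->
  energy_density eta Q f (- p) \is a fin_num ->
  (2^-1%:E * (energy_density eta Q f p + energy_density eta Q f (- p)%R) -
    energy_density eta Q (symmetrized f) p)%E =
  (entropy_gap (f p) (f (- p)))%:E.
Proof.
rewrite /energy_density quad_opp /symmetrized.
have [w0|w0] := leP (quad Q p - eta) 0.
  rewrite le0_lneNy ?lee_fin//.
  have z (x : R) : 0 <= x -> ((x * ln x)%:E - x%:E * -oo)%E \is a fin_num -> x = 0.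
    rewrite le_eqVlt => /orP[/eqP//|x0].
    by rewrite gt0_muleNy ?lte_fin.
  move=> f0 f0' /(z _ f0) -> /(z _ f0') ->.
  by rewrite /entropy_gap
    !(mul0e, addr0, mulr0, mul0r, sube0, adde0, subr0, mule0).
move=> _ _ _ _; rewrite lne_EFin//.
set x := f p; set y := f (- p); set m := 2^-1 * (x + y); set w := ln (quad Q p - eta).
rewrite -[LHS]/(2^-1 * ((x * ln x - x * w) + (y * ln y - y * w)) -
  (m * ln m - m * w))%:E.
by congr EFin; rewrite /entropy_gap -/m; move: (ln x) (ln y) (ln m) (w) => *; rewrite /m; lra.
Qed.

(* Averaging with the antipodal image lowers the energy strictly unless [f] is
   even. *)
Lemma optimal_even (Q : Sym0 R) eta f : (J Q eta < +oo)%E ->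
  optimal_distribution Q eta f ->
  {ae H2 R, forall p, sphere R p -> f (- p) = f p}.
Proof.
move=> Joo [Qf fJ]; have [df mom] := Qf; have [fi f0 f1] := df.
set G := energy_density eta Q f.
have Gi : (H2 R).-integrable S G by apply: energy_density_integrable => //; rewrite fJ.
have Gi' := integrable_opp Gi.
have mG : measurable_fun S (G : space3 R -> \bar R) by case/integrableP: Gi.
pose h := symmetrized f.
have Qh : admissible Q h := symmetrized_admissible Qf.
set A := energy_density eta Q h.
pose B p := (2^-1%:E * (G p + G (- p)%R))%E.
have BI : (H2 R).-integrable S B.
  exact: (integrableZl measurable_sphere 2^-1 (integrableD measurable_sphere Gi Gi')).
have IG : (\int[H2 R]_(p in sphere R) G p)%E \is a fin_num.
  exact: (integrable_fin_num measurable_sphere Gi).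
have IB : (\int[H2 R]_(p in sphere R) B p = \int[H2 R]_(p in sphere R) G p)%E.
  rewrite (integralZl measurable_sphere (integrableD measurable_sphere Gi Gi')).
  rewrite (integralD measurable_sphere Gi Gi') (integral_opp mG) -(fineK IG).
  by rewrite -EFinD -EFinM; congr EFin; move: (fine _) => *; lra.
have Ffin := integrable_ae measurable_sphere Gi.
have good : {ae H2 R, forall p, sphere R p -> [/\ 0 <= f p, 0 <= f (- p) &
    (B p - A p)%E = (entropy_gap (f p) (f (- p)))%:E]}.
  have ff := @filterI _ _ (ae_filter_ringOfSetsType (H2 R)) _ _ f0 Ffin.
  apply: (@filterS2 _ _ (ae_filter_ringOfSetsType (H2 R)) _ _ _ _ ff (ae_opp ff)).
  move=> p [h1 h2] [h3 h4] Sp; have Sp' : sphere R (- p) by rewrite -sphere_opp in Sp.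
  split; [exact: h1|exact: h3|].
  by apply: energy_density_symmetrized; [exact: h1|exact: h3|exact: h2|exact: h4].
have mA : measurable_fun S (A : space3 R -> \bar R).
  by apply: measurable_energy_density; exact: densities_measurable Qh.1.
have mB : measurable_fun S (B : space3 R -> \bar R) by case/integrableP: BI.
have Jle : (J Q eta <= energy Q eta h)%E by apply: ereal_inf_lbound; exists h.
have Ah : energy Q eta h = (\int[H2 R]_(p in sphere R) A p)%E by [].
have Gf : energy Q eta f = (\int[H2 R]_(p in sphere R) G p)%E by [].
have AleB : (\int[H2 R]_(p in sphere R) A p <= \int[H2 R]_(p in sphere R) B p)%E.
  apply: ae_le_integral; [exact: measurable_sphere|exact: mA|exact: mB|].
  apply: (@filterS _ _ (ae_filter_ringOfSetsType (H2 R)) _ _ _ good) => p gp Sp.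
  have [p0 p0' E] := gp Sp; have : (B p - A p)%E \is a fin_num by rewrite E.
  rewrite fin_numB => /andP[Bfin Afin].
  by rewrite -sube_ge0 ?Afin// E lee_fin entropy_gap_ge0.
have AI : (H2 R).-integrable S A.
  apply: energy_density_integrable; first exact: Qh.1.
  by rewrite Ah (le_lt_trans AleB)// IB -Gf fJ.
have ID : (\int[H2 R]_(p in sphere R) (B p - A p) <= 0)%E.
  rewrite (integralB measurable_sphere BI AI) IB -Gf fJ -Ah sube_le0//.
have mD : measurable_fun S ((fun p => B p - A p)%E : space3 R -> \bar R).
  exact: emeasurable_funB.
(* The difference is the entropy gap, nonnegative almost everywhere, and by optimality of [f] its
   integral is at most 0. *)
have I0 : (\int[H2 R]_(p in sphere R) `|(fun p => B p - A p) p| = 0)%E.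
  apply/eqP; rewrite eq_le integral_ge0 ?andbT; last by move=> *; exact: abse_ge0.
  apply: le_trans ID.
  apply: ae_le_integral; [exact: measurable_sphere|exact: measurableT_comp|exact: mD|].
  apply: (@filterS _ _ (ae_filter_ringOfSetsType (H2 R)) _ _ _ good) => p gp Sp.
  have [p0 p0' E] := gp Sp; rewrite /= E /= lee_fin ger0_norm//.
  exact: entropy_gap_ge0.
have D0 := (ae_eq_integral_abs (H2 R) measurable_sphere mD).1 I0.
apply: (@filterS2 _ _ (ae_filter_ringOfSetsType (H2 R)) _ _ _ _ good D0) => p gp dp Sp.
have [p0 p0' E] := gp Sp; have := dp Sp; rewrite E => -[] /=.
by move/(entropy_gap_eq0 p0 p0').
Qed.

End antipodal_symmetry.

(** * Rotations taking one axis to another *)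

Section orthogonal_matrices.
Context {R : realType}.
Implicit Types (A : 'M[R]_3) (a b p q : 'cV[R]_3).

Definition dotmx p q : R := (p^T *m q) 0 0.

Lemma dotmxE p q : dotmx p q = p 0 0 * q 0 0 + p 1 0 * q 1 0 + p 2%:R 0 * q 2%:R 0.
Proof. by rewrite /dotmx mxE sum_ord3 !mxE. Qed.

Lemma dotmx_orthogonal A p q : A^T *m A = 1%:M -> dotmx (A *m p) (A *m q) = dotmx p q.
Proof. by move=> AA; rewrite /dotmx trmx_mul mulmxA -(mulmxA p^T) AA mulmx1. Qed.

Lemma enorm_dotmx p : enorm p ^+ 2 = dotmx p p.
Proof. exact: enorm_mxE. Qed.

Lemma enorm_orthogonal A p : A^T *m A = 1%:M -> enorm (A *m p) = enorm p.
Proof.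
move=> AA; apply/eqP; rewrite -(@eqrXn2 _ 2) ?enorm_ge0//.
by rewrite !enorm_dotmx dotmx_orthogonal.
Qed.

Lemma orthogonal_isometry A p q : A^T *m A = 1%:M ->
  enorm (A *m p - A *m q) = enorm (p - q).
Proof. by move=> AA; rewrite -mulmxBr enorm_orthogonal. Qed.

Lemma orthogonal_tr A : A^T *m A = 1%:M -> A^T^T *m A^T = 1%:M.
Proof. by move=> AA; rewrite trmxK; exact: mulmx1C. Qed.

Lemma orthogonal_opp A : A^T *m A = 1%:M -> (- A)^T *m (- A) = 1%:M.
Proof.
have -> : (- A)^T = - A^T by apply/matrixP => i j; rewrite !mxE.
by rewrite mulNmx mulmxN opprK.
Qed.

Lemma sphere_orthogonal A : A^T *m A = 1%:M -> mulmx A @^-1` sphere R = sphere R.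
Proof.
by move=> AA; apply/seteqP; split => p; rewrite /sphere /= enorm_orthogonal.
Qed.

Lemma dotmx_sphere p : sphere R p -> dotmx p p = 1.
Proof. by move=> Sp; rewrite -enorm_dotmx Sp expr1n. Qed.

Lemma mul_col_row_col a b p : a *m b^T *m p = dotmx b p *: a.
Proof. by rewrite -mulmxA (mx11_scalar (b^T *m p)) mul_mx_scalar. Qed.

(* The reflection in the plane orthogonal to a - b. *)
Lemma exists_reflection a b : sphere R a -> sphere R b ->
  exists A, A^T *m A = 1%:M /\ A *m a = b.
Proof.
move=> /dotmx_sphere Sa /dotmx_sphere Sb.
have [->|ab] := eqVneq a b; first by exists 1%:M; rewrite trmx1 !mul1mx.
pose v := a - b; pose n := dotmx v v.
have nE : n = 2 * dotmx v a.
  move: Sa Sb; rewrite /n /v !dotmxE !mxE.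
  by move: (a 0 0) (a 1 0) (a 2%:R 0) (b 0 0) (b 1 0) (b 2%:R 0) => *; lra.
have n0 : n != 0.
  rewrite /n -enorm_dotmx sqrf_eq0; apply: contra ab => /eqP v0.
  rewrite -subr_eq0 -/v; apply/eqP/colP => i; rewrite [RHS]mxE.
  by apply/eqP; rewrite -normr_le0 -v0 norm_coord_le.
pose A : 'M[R]_3 := 1%:M - (2 / n) *: (v *m v^T).
have At : A^T = A by rewrite /A linearB /= linearZ /= trmx_mul trmxK trmx1.
have Ap p : A *m p = p - (2 / n * dotmx v p) *: v.
  by rewrite /A mulmxBl mul1mx -scalemxAl mul_col_row_col scalerA.
exists A; split; last first.
  have -> : A *m a = a - v.
    rewrite Ap; have -> : 2 / n * dotmx v a = 1; last by rewrite scale1r.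
    by rewrite mulrAC -nE mulfV.
  by rewrite /v opprB addrC subrK.
have AAp p : A *m (A *m p) = p.
  rewrite !Ap; set k := 2 / n * dotmx v p.
  have -> : 2 / n * dotmx v (p - k *: v) = - k.
    have -> : dotmx v (p - k *: v) = dotmx v p - k * n.
      by rewrite /n !dotmxE !mxE; lra.
    rewrite mulrBr -/k (mulrC k) mulrA mulfVK//.
    by move: (k) => *; lra.
  by rewrite scaleNr opprK subrK.
rewrite At; apply/matrixP => i j.
transitivity (col j (A *m A) i 0); first by rewrite [RHS]mxE.
by rewrite colE -mulmxA AAp !mxE eqxx andbT.
Qed.

(* In odd dimension the sign of the matrix adjusts its determinant. *)
Lemma exists_rotation a b : sphere R a -> sphere R b ->
  exists A, SO3 R A /\ (A *m a = b \/ A *m a = - b).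
Proof.
move=> Sa Sb; have [A [AA Aab]] := exists_reflection Sa Sb.
have : \det A ^+ 2 = 1 by rewrite expr2 -{1}det_tr -det_mulmx AA det1.
move/eqP; rewrite sqrf_eq1 => /orP[/eqP dA|/eqP dA].
  by exists A; split => //; left.
exists (- A); split; last by right; rewrite mulNmx Aab.
split; first exact: orthogonal_opp.
by rewrite -scaleN1r detZ dA -exprSr -signr_odd expr0.
Qed.

End orthogonal_matrices.

(** * Weak-star convergence to the two poles *)

Section concentration.
Context {R : realType}.
Local Notation S := (sphere R : set (space3 R)).
Implicit Types (p q e : 'cV[R]_3) (f phi : 'cV[R]_3 -> R).

Lemma quad_prolate (s : R) e p : sphere R p ->
  quad (s *: (outer_square e - 3^-1%:M)) p = s * (dotmx e p ^+ 2 - 3^-1).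
Proof.
move=> /sphere_mul; rewrite quad_sum !sum_ord3 !mxE !big_ord1 !mxE /= dotmxE.
move: (p 0 0) (p 1 0) (p 2%:R 0) (e 0 0) (e 1 0) (e 2%:R 0) => x y z a b c h.
have -> : s * ((a * x + b * y + c * z) ^+ 2 - 3^-1) =
  s * ((a * x + b * y + c * z) ^+ 2 - 3^-1 * (x * x + y * y + z * z)) by rewrite h mulr1.
by rewrite ?mulr1n ?mulr0n; lra.
Qed.

Lemma bmeas_within_continuous phi : {within sphere R, continuous phi} -> bmeas phi.
Proof.
move=> phic; split.
  exact: within_continuous_measurable_fun measurable_sphere phic.
have /compact_bounded[M [_ HM]] := continuous_compact phic (@compact_sphere R).
by exists (M + 1) => p Sp; apply: (HM (M + 1)); rewrite ?ltrDl//; exists p.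
Qed.

Lemma within_sphere_continuous phi e (eps : R) : {within sphere R, continuous phi} ->
  sphere R e -> 0 < eps -> exists2 r, 0 < r &
  forall q, sphere R q -> enorm (q - e) < r -> `|phi q - phi e| <= eps.
Proof.
move=> phic Se e0.
have /cvgrPdist_le/(_ _ e0) := phic e.
rewrite /prop_near1 -[nbhs _]/(nbhs_subspace e) -(nbhs_subspace_in Se) /within /=.
move=> /nbhs_ballP[r r0 H].
exists r => // q Sq qr; rewrite distrC; apply: H => //.
rewrite -ball_normE /=; apply: le_lt_trans (norm_le_enorm _) _.
by rewrite enormB.
Qed.

(** Even densities see only the even part of a test function, and this part takes the same value at
    both poles, so that no distinction between the two caps remains. *)
Lemma near_poles phi e (eps : R) : {within sphere R, continuous phi} ->
  sphere R e -> 0 < eps -> exists2 d, 0 < d &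
  forall q, sphere R q -> 1 - d < dotmx e q ^+ 2 ->
  `|2^-1 * (phi q + phi (- q)) - 2^-1 * (phi e + phi (- e))| <= eps.
Proof.
move=> phic Se e0.
have SN p : sphere R p -> sphere R (- p) by move=> Sp; rewrite -sphere_opp in Sp.
have [r1 r10 H1] := within_sphere_continuous phic Se e0.
have [r2 r20 H2] := within_sphere_continuous phic (SN _ Se) e0.
pose r := Num.min r1 r2; have r0 : 0 < r by rewrite lt_min r10.
(* For [x = dotmx e q] in [[0, 1]] the squared distance to the pole is [2 - 2 x <= 2 (1 - x ^ 2)],
   below [r ^ 2] as soon as [x ^ 2 > 1 - r ^ 2 / 2]. *)
exists (r ^+ 2 / 2); first by rewrite divr_gt0// exprn_gt0.
have pole q : sphere R q -> 0 <= dotmx e q -> 1 - r ^+ 2 / 2 < dotmx e q ^+ 2 ->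
    `|phi q - phi e| <= eps /\ `|phi (- q) - phi (- e)| <= eps.
  move=> Sq d0 dr.
  have dist : enorm (q - e) ^+ 2 = 2 - 2 * dotmx e q.
    have := dotmx_sphere Sq; have := dotmx_sphere Se.
    rewrite enorm_dotmx !dotmxE !mxE.
    by move: (q 0 0) (q 1 0) (q 2%:R 0) (e 0 0) (e 1 0) (e 2%:R 0) => *; lra.
  have d1 : dotmx e q <= 1 by have := sqr_ge0 (enorm (q - e)); rewrite dist; lra.
  have qr : enorm (q - e) < r.
    rewrite -(@ltr_pXn2r _ 2) ?nnegrE ?enorm_ge0 ?(ltW r0)// dist.
    by move: d0 d1 dr; move: (dotmx e q) (r ^+ 2) => *; nra.
  split; first by apply: H1 => //; apply: lt_le_trans qr _; rewrite ge_min lexx.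
  apply: H2; first exact: SN.
  by rewrite -opprD enormN; apply: lt_le_trans qr _; rewrite ge_min lexx orbT.
move=> q Sq dq; have [d0|d0] := leP 0 (dotmx e q).
  have [] := pole q Sq d0 dq; rewrite !ler_norml => /andP[? ?] /andP[? ?].
  by apply/andP; split; lra.
have dN : dotmx e (- q) = - dotmx e q by rewrite !dotmxE !mxE; lra.
have [] := pole (- q) (SN _ Sq) _ _; rewrite ?dN ?sqrrN ?oppr_ge0 ?(ltW d0)// opprK.
by rewrite !ler_norml => /andP[? ?] /andP[? ?]; apply/andP; split; lra.
Qed.

Lemma bmeas_orthogonal (A : 'M[R]_3) phi : A^T *m A = 1%:M -> bmeas phi ->
  bmeas (fun p => phi (A *m p)).
Proof.
move=> AA [mphi [C phiC]]; split.
  apply: (measurable_comp (F := S) _ _ mphi).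
  - exact: measurable_sphere.
  - by move=> _ [p Sp <-]; rewrite -(sphere_orthogonal AA) in Sp.
  - apply: (measurable_funS measurableT (@subsetT _ _)).
    have AK : cancel (mulmx A^T) (mulmx A : 'cV[R]_3 -> 'cV[R]_3).
      by move=> p; rewrite mulmxA (mulmx1C AA) mul1mx.
    have KA : cancel (mulmx A) (mulmx A^T : 'cV[R]_3 -> 'cV[R]_3).
      by move=> p; rewrite mulmxA AA mul1mx.
    exact: (measurable_fun_isometry (fun p q => orthogonal_isometry p q AA) KA AK).
by exists C => p Sp; apply: phiC; rewrite -(sphere_orthogonal AA) in Sp.
Qed.

Lemma density_functional_rotate (A : 'M[R]_3) f phi : A^T *m A = 1%:M -> bmeas phi ->
  (H2 R).-integrable S (EFin \o f) ->
  density_functional (rotate A f) phi =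
  \int[H2 R]_(p in sphere R) (phi (A^T *m p) * f p).
Proof.
move=> AA bphi fi; have bpsi := bmeas_orthogonal (orthogonal_tr AA) bphi.
have Gi := bmeas_mul_integrable bpsi fi.
have AK : cancel (mulmx A^T) (mulmx A : 'cV[R]_3 -> 'cV[R]_3).
  by move=> p; rewrite mulmxA (mulmx1C AA) mul1mx.
have mG : measurable_fun S ((EFin \o (fun p => phi (A^T *m p) * f p)) : space3 R -> \bar R).
  by case/integrableP: Gi.
have KA : cancel (mulmx A) (mulmx A^T : 'cV[R]_3 -> 'cV[R]_3).
  by move=> p; rewrite mulmxA AA mul1mx.
have := integral_isometry (fun p q => orthogonal_isometry p q AA) KA AK measurable_sphere mG.
rewrite (sphere_orthogonal AA) => E; congr fine; rewrite -[RHS]E.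
by apply: eq_integral => p _ /=; rewrite /rotate KA.
Qed.

Lemma concentration (Q : Sym0 R) (s eta : R) e e1 (A : 'M[R]_3) f phi (eps d : R) :
  sphere R e -> sphere R e1 -> 0 < s < 1 ->
  Q = s *: (outer_square e - 3^-1%:M) :> 'M[R]_3 ->
  (J Q eta < +oo)%E -> optimal_distribution Q eta f ->
  SO3 R A -> A *m e1 = e \/ A *m e1 = - e ->
  bmeas phi -> 0 <= eps ->
  (forall q, sphere R q -> 1 - d < dotmx e1 q ^+ 2 ->
    `|2^-1 * (phi q + phi (- q)) - 2^-1 * (phi e1 + phi (- e1))| <= eps) ->
  0 < eta -> 2 / 3 - d < eta ->
  `|density_functional (rotate A f) phi - 2^-1 * (phi e1 + phi (- e1))| <= eps.
Proof.
move=> Se Se1 /andP[s0 s1] QE Joo fopt [AA _] Ae1 bphi eps0 near eta0 etad.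
have [Qf fJ] := fopt; have [df _] := Qf; have [fi f0 f1] := df.
have feven := optimal_even Joo fopt.
have fsupp : {ae H2 R, forall p, sphere R p -> f p = 0 \/ eta < quad Q p}.
  by apply: energy_support => //; rewrite fJ.
rewrite (density_functional_rotate AA bphi fi).
set c := 2^-1 * (phi e1 + phi (- e1)).
pose psi p := phi (A^T *m p).
have bpsi : bmeas psi by exact: bmeas_orthogonal (orthogonal_tr AA) bphi.
have bphiN : bmeas (fun q => phi (- q)).
  have NN : (- 1%:M : 'M[R]_3)^T *m (- 1%:M) = 1%:M.
    by apply: orthogonal_opp; rewrite trmx1 mulmx1.
  have E p : phi ((- 1%:M : 'M[R]_3) *m p) = phi (- p) by rewrite mulNmx mul1mx.
  exact: (eq_bmeas E (bmeas_orthogonal NN bphi)).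
have psiN p : phi (- (A^T *m p)) = psi (- p) by rewrite /psi mulmxN.
have bpsi' := eq_bmeas psiN (bmeas_orthogonal (orthogonal_tr AA) bphiN).
(* Since [f] is even with mass 1, the quantity to be bounded is the integral of [X] against [f], and
   [X] is small on the support of [f]. *)
pose X p := 2^-1 * (psi p + psi (- p)) - c.
have bX : bmeas X.
  exact: (bmeasB (bmeasZ _ (bmeasD bpsi bpsi')) (bmeas_cst c)).
have i1 := bmeas_mul_integrable bpsi fi.
have i2 := bmeas_mul_integrable bpsi' fi.
have iX := bmeas_mul_integrable bX fi.
have even : \int[H2 R]_(p in sphere R) (psi (- p) * f p) =
    \int[H2 R]_(p in sphere R) (psi p * f p).
  rewrite -[RHS]Rintegral_opp; last by apply/measurable_EFinP; case/integrableP: i1.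
  congr fine; apply: ae_eq_integral.
  - exact: measurable_sphere.
  - by case/integrableP: i2.
  - by have /integrableP[] := integrable_opp i1.
  - apply: (@filterS _ _ (ae_filter_ringOfSetsType (H2 R)) _ _ _ feven) => p fp Sp /=.
    by rewrite fp.
have XE : \int[H2 R]_(p in sphere R) (X p * f p) =
    \int[H2 R]_(p in sphere R) (psi p * f p) - c.
  have i12 := integrableD measurable_sphere i1 i2.
  transitivity (\int[H2 R]_(p in sphere R) (2^-1 * (psi p * f p + psi (- p) * f p) - c * f p)).
    by apply: eq_Rintegral => p _; rewrite /X; lra.
  rewrite (RintegralB measurable_sphere (integrableZl measurable_sphere _ i12)
    (integrableZl measurable_sphere c fi)).
  rewrite (RintegralZl _ measurable_sphere i12) (RintegralZl _ measurable_sphere fi).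
  rewrite (RintegralD measurable_sphere i1 i2) even (admissible_fin Qf).
  by move: (\int[H2 R]_(p in _) _) => *; lra.
rewrite -XE; apply: (le_trans (le_normr_Rintegral measurable_sphere iX)).
rewrite -lee_fin fineK; last first.
  apply: (integrable_fin_num measurable_sphere).
  exact: (integrable_abse iX).
have -> : eps%:E = (\int[H2 R]_(p in sphere R) (eps * f p)%:E)%E.
  have ie := integrableZl measurable_sphere eps fi.
  rewrite -[RHS]fineK; last exact: (integrable_fin_num measurable_sphere ie).
  congr EFin; rewrite -[RHS]/(\int[H2 R]_(p in sphere R) (eps * f p)).
  by rewrite (RintegralZl _ measurable_sphere fi) (admissible_fin Qf) mulr1.
have mXf : measurable_fun S ((EFin \o (fun p => `|X p * f p|)) : space3 R -> \bar R).
  by have /integrableP[] := integrable_abse iX.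
have mef : measurable_fun S ((EFin \o (fun p => eps * f p)) : space3 R -> \bar R).
  by have /integrableP[] := integrableZl measurable_sphere eps fi.
apply: (ae_le_integral measurable_sphere mXf mef).
apply: (@filterS2 _ _ (ae_filter_ringOfSetsType (H2 R)) _ _ _ _ f0 fsupp) => p fp sp Sp.
rewrite lee_fin normrM (ger0_norm (fp Sp)).
have [->|etap] := sp Sp; first by rewrite !mulr0.
apply: ler_wpM2r; first exact: fp.
have Sq : sphere R (A^T *m p).
  by rewrite -(sphere_orthogonal (orthogonal_tr AA)) in Sp.
rewrite /X /psi mulmxN; apply: near => //.
have -> : dotmx e1 (A^T *m p) ^+ 2 = dotmx e p ^+ 2.
  rewrite -(dotmx_orthogonal _ _ AA) mulmxA (mulmx1C AA) mul1mx.
  case: Ae1 => -> //.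
  by rewrite !dotmxE !mxE !mulNr -!opprD sqrrN.
(* From [s (x ^ 2 - 1 / 3) > eta > 0] and [s < 1] follows [x ^ 2 - 1 / 3 > eta > 2 / 3 - d]. *)
move: etap; rewrite QE quad_prolate//.
by move: (dotmx e p ^+ 2) => D; nra.
Qed.

End concentration.

Theorem corollary5p9 (R : realType) :
  (forall eta : R, 0 <= eta < 2 / 3 ->
     exists Q : Sym0 R, prolate_uniaxial Q /\ critical_point eta Q) /\
  (forall (e1 : 'cV[R]_3) (eta_ : nat -> R) (Q_ : nat -> Sym0 R)
          (f_ : nat -> 'cV[R]_3 -> R),
     sphere R e1 ->
     (forall j, eta_ j < 2 / 3) ->
     eta_ j @[j --> \oo] --> (2 / 3 : R) ->
     (forall j, prolate_uniaxial (Q_ j) /\ critical_point (eta_ j) (Q_ j)) ->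
     (forall j, optimal_distribution (Q_ j) (eta_ j) (f_ j)) ->
     exists2 R_ : nat -> 'M[R]_3, (forall j, SO3 R (R_ j)) &
       weak_star_cvg (fun j => density_functional (rotate (R_ j) (f_ j)))
         (fun phi => 2^-1 * (dirac_functional e1 phi +
                             dirac_functional (- e1) phi))).
Proof.
split; first exact: prolate_critical_point_exists.
move=> e1 eta_ Q_ f_ Se1 _ eta_lim Qcrit fopt.
(* A single choice yields rotation, axis and scalar order parameter together. The sign left open by
   [exists_rotation] is harmless because the limit is symmetric under [e1 -> - e1]. *)
pose P j (T : 'M[R]_3 * 'cV[R]_3 * R) := [/\ SO3 R T.1.1, sphere R T.1.2,
  0 < T.2 < 1, T.1.1 *m e1 = T.1.2 \/ T.1.1 *m e1 = - T.1.2 &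
  Q_ j = T.2 *: (outer_square T.1.2 - 3^-1%:M) :> 'M[R]_3].
have /choice[T TP] : forall j, exists T, P j T.
  move=> j; have [[e [s [Se s01 QE]]] _] := Qcrit j.
  have [A [AR Ae]] := exists_rotation Se1 Se.
  by exists (A, e, s).
exists (fun j => (T j).1.1) => [j|phi phic]; first by have [] := TP j.
have bphi := bmeas_within_continuous phic.
apply/cvgrPdist_le => eps eps0.
have [d d0 near] := near_poles phic Se1 eps0.
have near0 : \forall j \near \oo, 0 < eta_ j.
  by apply: (cvgr_gt _ eta_lim); lra.
have neard : \forall j \near \oo, 2 / 3 - d < eta_ j.
  by apply: (cvgr_gt _ eta_lim); lra.
near=> j; rewrite distrC /dirac_functional.
have [AR Se s01 Ae QE] := TP j.
have [_ [[_ Joo] _ _]] := Qcrit j.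
apply: (concentration Se Se1 s01 QE Joo (fopt j) AR Ae bphi (ltW eps0) near).
- by near: j.
- by near: j.
Unshelve. all: by end_near. Qed.
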